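(* Let $0<q<1$ and let $a,b,c,d,r,s,t,h,z,\beta,\delta$ be complex numbers with $\max\{|a|,|b|,|c|,|d|,|r|,|s|,|t|,|h|,|z|\}<1$. Put $\alpha=a^2bcdr/q$. Then \begin{align*} &\int_{0}^{\pi} \frac{(e^{2i\theta},e^{-2i\theta};q)_\infty}{(ae^{i\theta},ae^{-i\theta},be^{i\theta},be^{-i\theta},ce^{i\theta},ce^{-i\theta},de^{i\theta},de^{-i\theta},re^{i\theta},re^{-i\theta};q)_\infty}\, {}_4\phi_3\left({{ae^{i\theta}, a e^{-i\theta}, \beta, \delta}\atop{s, t, h}}; q, bcdrz\right)d\theta\\ &=\frac{2\pi(abcd, abcr, abdr, acdr; q)_\infty}{(q, ab, ac, ad, ar, bc, bd, br, cd, cr, dr, q\alpha; q)_\infty} \sum_{n=0}^\infty \frac{(1-\alpha q^{2n})(\alpha, ab, ac, ad, ar; q)_n}{(1-\alpha)(q, abcd, abcr, abdr, acdr; q)_n}(-bcdr)^n q^{n(n-1)/2}\, {}_4\phi_3\left({{q^{-n}, \alpha q^{n}, \beta, \delta}\atop{s, t, h}}; q, qz\right). \end{align*} The identity also holds when $|z|=1$, provided the series on the right-hand side converges absolutely for $|z|=1$.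
   Context: For $0<q<1$: $(a;q)_0=1$, $(a;q)_n=\prod_{k=0}^{n-1}(1-aq^k)$, $(a;q)_\infty=\prod_{k=0}^\infty(1-aq^k)$, and $(a_1,\dots,a_m;q)_n=(a_1;q)_n\cdots(a_m;q)_n$ (also for $n=\infty$). The basic hypergeometric series is ${}_{r+1}\phi_r\left({{a_1,\dots,a_{r+1}}\atop{b_1,\dots,b_r}};q,z\right)=\sum_{n\ge0}\frac{(a_1,\dots,a_{r+1};q)_n}{(q,b_1,\dots,b_r;q)_n}z^n$ (terminating when some $a_j=q^{-n}$). *)

(* Defs.v *)
From Stdlib Require Export Reals List.
From Coquelicot Require Export Coquelicot.
Export ListNotations.
Open Scope C_scope.

(* Like [Lim_seq] and [Series], the two operators below are total: they are the
   limit and the sum only when the sequence, resp. the series, converges in C. *)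
Definition CLim_seq (u : nat -> C) : C :=
  (real (Lim_seq (fun n => Re (u n))), real (Lim_seq (fun n => Im (u n)))).

Definition CSeries (u : nat -> C) : C :=
  (Series (fun n => Re (u n)), Series (fun n => Im (u n))).

(* e^{i x} for real x *)
Definition expi (x : R) : C := (cos x, sin x).

Fixpoint qpoch (a : C) (q : R) (n : nat) : C :=
  match n with
  | O => 1
  | S k => qpoch a q k * (1 - a * q ^ k)
  end.

Definition qpoch_inf (a : C) (q : R) : C := CLim_seq (fun n => qpoch a q n).

(* (a_1, ..., a_m; q)_n and (a_1, ..., a_m; q)_oo *)
Definition qpochs (l : list C) (q : R) (n : nat) : C :=
  fold_right Cmult 1 (map (fun a => qpoch a q n) l).

Definition qpochs_inf (l : list C) (q : R) : C :=
  fold_right Cmult 1 (map (fun a => qpoch_inf a q) l).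

(* The series _{r+1}phi_r, so A is meant to have one more entry than B: no
   power of (-1)^n q^{n(n-1)/2}, needed for other lengths, is included. *)
Definition bhyp (A B : list C) (q : R) (z : C) : C :=
  CSeries (fun n => qpochs A q n / qpochs (RtoC q :: B) q n * z ^ n).

(* Main.v *)
(* The numerator parameters a e^{i th}, a e^{-i th} of the 4phi3 turn 1/(a e^{+-i th})_oo
   into 1/(a q^k e^{+-i th})_oo, and on the right-hand side the k-th terms of the
   terminating 4phi3's are those of the same very-well-poised series with a replaced
   by a q^k.  So, after an interchange of summations, everything reduces to the case
   of a 4phi3 equal to 1, that is, to I(a,b,c,d,r) = V(a,b,c,d,r), where I is the
   integral with weight
     (e^{2i th}, e^{-2i th})_oo / prod_x (x e^{i th}, x e^{-i th})_oo
   and V is the prefactor times the very-well-poised series.  Both satisfy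
     r F(bq, r) - b F(b, rq) = (r - b) (1 - b r) F(b, r),
   the integral because of the identity
     r (1 - b e)(1 - b/e) - b (1 - r e)(1 - r/e) = (r - b) (1 - b r),
   the series by a q-Zeilberger certificate.  A solution analytic
   in b is determined by its values at b = 0, since the lowest-order term c(r) b^m of
   the difference of two solutions satisfies r (q^m - 1) c(r) = 0.  This reduces five
   parameters to four, four to three, and so on, down to one, where I is constant
   by the orthogonality of the Rogers polynomials to 1.  With a = 0 the series V is
   summed by Euler's formula, which gives the initial value V(a,0,c,d,r) = V(0,a,c,d,r).

   To avoid complex analysis, "analytic in b" means: uniform limit of polynomials on a
   disc. *)
Require Import Defs.
From Stdlib Require Import Lra Lia Psatz ZArith ClassicalEpsilon.
Open Scope C_scope.

(** * Limits and series in C *)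

(** Integrals are taken over the full period [-PI, PI], where exponentials are orthogonal; evenness
    halves the result at the end, so constants are doubled until then. The parameter alpha = a^2 b c
    d r / q may have modulus 1 or more, so the series are written in terms of alpha q, of modulus
    below 1, and the quotient by 1 - alpha appears only when terms are matched with the statement.
    The functional equation links r to r q, hence Taylor coefficients are shown to vanish order by
    order, for all r at once. It is void at r = 0, where the symmetry in b and r takes over. The
    orthogonality behind the one-parameter case comes from the Fourier coefficients of a theta
    product, obtained as limits from a finite Jacobi triple product, itself an instance of the
    q-binomial theorem. The interchange of summations runs along the diagonals n = k + j of a double
    array: entry (k, j) comes from the j-th term of the series for a q^k, row k sums to an integral,
    and diagonal n is a constant multiple of the n-th term of the right-hand side. *)

Fixpoint psum (u : nat -> C) (n : nat) : C :=
  match n with O => 0 | S k => psum u k + u k end.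

Fixpoint rsum (u : nat -> R) (n : nat) : R :=
  match n with O => 0%R | S k => (rsum u k + u k)%R end.

(** The closed inequality [<= eps] survives passage to a limit, so bounds on partial sums transfer
    to sums without loss. *)
Definition climit (u : nat -> C) (l : C) : Prop :=
  forall eps : R, (0 < eps)%R ->
  exists N, forall n, (N <= n)%nat -> (Cmod (u n - l) <= eps)%R.

Definition csums (u : nat -> C) (l : C) : Prop := climit (psum u) l.

Definition summable (M : nat -> R) : Prop :=
  (forall n, 0 <= M n)%R /\ exists B, forall n, (rsum M n <= B)%R.

Lemma Cmod_triangle_minus (x y z : C) :
  (Cmod (x - z) <= Cmod (x - y) + Cmod (y - z))%R.
Proof.
  replace (x - z) with ((x - y) + (y - z)) by ring. apply Cmod_triangle.
Qed.

Lemma Cmod_minus_sym (x y : C) : Cmod (x - y) = Cmod (y - x).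
Proof. rewrite <- (Cmod_opp (x - y)). f_equal. ring. Qed.

Lemma Cmod_le_0_eq (x y : C) :
  (forall eps : R, (0 < eps)%R -> (Cmod (x - y) <= eps)%R) -> x = y.
Proof.
  intros H. apply Ceq_minus, Cmod_eq_0.
  destruct (Rle_lt_or_eq_dec _ _ (Cmod_ge_0 (x - y))) as [h | h]; [ | now symmetry].
  specialize (H (Cmod (x - y) / 2)%R ltac:(lra)). lra.
Qed.

Lemma climit_unique (u : nat -> C) (l m : C) : climit u l -> climit u m -> l = m.
Proof.
  intros Hl Hm. apply Cmod_le_0_eq. intros eps He.
  destruct (Hl (eps / 2)%R) as [N1 H1]; [lra | ].
  destruct (Hm (eps / 2)%R) as [N2 H2]; [lra | ].
  specialize (H1 (N1 + N2)%nat ltac:(lia)). specialize (H2 (N1 + N2)%nat ltac:(lia)).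
  generalize (Cmod_triangle_minus l (u (N1 + N2)%nat) m).
  rewrite (Cmod_minus_sym l (u _)). lra.
Qed.

Lemma climit_ext (u v : nat -> C) (l : C) :
  (forall n, u n = v n) -> climit u l -> climit v l.
Proof.
  intros E H eps He. destruct (H eps He) as [N HN]. exists N. intros n Hn.
  rewrite <- E. auto.
Qed.

Lemma climit_const (l : C) : climit (fun _ => l) l.
Proof.
  intros eps He. exists O. intros n _. replace (l - l) with (RtoC 0) by ring.
  rewrite Cmod_0. lra.
Qed.

Lemma climit_plus (u v : nat -> C) (l m : C) :
  climit u l -> climit v m -> climit (fun n => u n + v n) (l + m).
Proof.
  intros Hu Hv eps He.
  destruct (Hu (eps / 2)%R) as [N1 H1]; [lra | ].
  destruct (Hv (eps / 2)%R) as [N2 H2]; [lra | ].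
  exists (N1 + N2)%nat. intros n Hn.
  replace (u n + v n - (l + m)) with ((u n - l) + (v n - m)) by ring.
  eapply Rle_trans; [apply Cmod_triangle | ].
  specialize (H1 n ltac:(lia)). specialize (H2 n ltac:(lia)). lra.
Qed.

Lemma climit_scal (k : C) (u : nat -> C) (l : C) :
  climit u l -> climit (fun n => k * u n) (k * l).
Proof.
  intros H eps He.
  assert (Hk := Cmod_ge_0 k).
  destruct (H (eps / (Cmod k + 1))%R) as [N HN].
  { apply Rdiv_lt_0_compat; lra. }
  exists N. intros n Hn. replace (k * u n - k * l) with (k * (u n - l)) by ring.
  rewrite Cmod_mult. specialize (HN n Hn).
  apply Rle_trans with (Cmod k * (eps / (Cmod k + 1)))%R.
  { apply Rmult_le_compat_l; lra. }
  apply Rmult_le_reg_r with (Cmod k + 1)%R; [lra | ].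
  replace (Cmod k * (eps / (Cmod k + 1)) * (Cmod k + 1))%R with (Cmod k * eps)%R
    by (field; lra).
  nra.
Qed.

Lemma climit_minus (u v : nat -> C) (l m : C) :
  climit u l -> climit v m -> climit (fun n => u n - v n) (l - m).
Proof.
  intros Hu Hv. replace (l - m) with (l + (-(1)) * m) by ring.
  eapply climit_ext; [ | exact (climit_plus _ _ _ _ Hu (climit_scal (-(1)) _ _ Hv))].
  intros n; simpl; ring.
Qed.

Lemma climit_shift (u : nat -> C) (l : C) : climit (fun n => u (S n)) l <-> climit u l.
Proof.
  split; intros H eps He; destruct (H eps He) as [N HN].
  - exists (S N). intros [ | n] Hn; [lia | ]. apply HN. lia.
  - exists N. intros n Hn. apply HN. lia.
Qed.

Lemma climit_bound (u : nat -> C) (l k : C) (B : R) :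
  climit u l -> (exists N, forall n, (N <= n)%nat -> Cmod (u n - k) <= B)%R ->
  (Cmod (l - k) <= B)%R.
Proof.
  intros H [N0 HB]. apply le_epsilon. intros eps He.
  destruct (H eps He) as [N HN].
  specialize (HN (N + N0)%nat ltac:(lia)). specialize (HB (N + N0)%nat ltac:(lia)).
  generalize (Cmod_triangle_minus l (u (N + N0)%nat) k).
  rewrite (Cmod_minus_sym l (u _)). lra.
Qed.

Lemma Cmod_le_abs (x y : R) : (Cmod (x, y) <= Rabs x + Rabs y)%R.
Proof.
  replace ((x, y) : C) with (RtoC x + (0%R, y)).
  2:{ unfold RtoC, Cplus; simpl. f_equal; ring. }
  eapply Rle_trans; [apply Cmod_triangle | ]. rewrite Cmod_R.
  apply Rplus_le_compat_l. unfold Cmod; simpl.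
  replace (0 * (0 * 1) + y * (y * 1))%R with (Rsqr y) by (unfold Rsqr; ring).
  rewrite sqrt_Rsqr_abs. lra.
Qed.

Lemma Rabs_im_le (z : C) : (Rabs (Im z) <= Cmod z)%R.
Proof. eapply Rle_trans; [ | apply Rmax_Cmod]. apply Rmax_r. Qed.

Lemma climit_cauchy (u : nat -> C) :
  (forall eps, (0 < eps)%R -> exists N, forall n m, (N <= n)%nat -> (N <= m)%nat ->
     (Cmod (u n - u m) <= eps)%R) -> exists l, climit u l.
Proof.
  intros H.
  destruct (Rcomplete.R_complete (fun n => Re (u n))) as [x Hx].
  { intros eps He. destruct (H (eps / 2)%R) as [N HN]; [lra | ].
    exists N. intros n m Hn Hm. unfold Rdist.
    replace (Re (u n) - Re (u m))%R with (Re (u n - u m)) by (unfold Re, Im, Cminus, Cplus, Copp; simpl; ring).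
    eapply Rle_lt_trans; [apply re_le_Cmod | ]. specialize (HN n m Hn Hm). lra. }
  destruct (Rcomplete.R_complete (fun n => Im (u n))) as [y Hy].
  { intros eps He. destruct (H (eps / 2)%R) as [N HN]; [lra | ].
    exists N. intros n m Hn Hm. unfold Rdist.
    replace (Im (u n) - Im (u m))%R with (Im (u n - u m)) by (unfold Re, Im, Cminus, Cplus, Copp; simpl; ring).
    eapply Rle_lt_trans; [apply Rabs_im_le | ]. specialize (HN n m Hn Hm). lra. }
  exists (x, y). intros eps He.
  destruct (Hx (eps / 2)%R) as [N1 H1]; [lra | ].
  destruct (Hy (eps / 2)%R) as [N2 H2]; [lra | ].
  exists (N1 + N2)%nat. intros n Hn.
  specialize (H1 n ltac:(lia)). specialize (H2 n ltac:(lia)).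
  unfold Rdist, Re, Im in *. destruct (u n) as [a b]. simpl in *.
  eapply Rle_trans; [apply (Cmod_le_abs (a - x) (b - y)) | ]. lra.
Qed.

Lemma climit_Re_Im (u : nat -> C) (l : C) : climit u l ->
  is_lim_seq (fun n => Re (u n)) (Re l) /\ is_lim_seq (fun n => Im (u n)) (Im l).
Proof.
  intros H.
  split; apply is_lim_seq_spec; intros eps;
    (destruct (H (eps / 2)%R) as [N HN]; [destruct eps; simpl; lra | ]);
    exists N; intros n Hn; specialize (HN n Hn).
  - replace (Re (u n) - Re l)%R with (Re (u n - l)) by (unfold Re, Im, Cminus, Cplus, Copp; simpl; ring).
    generalize (re_le_Cmod (u n - l)). destruct eps as [e He]; simpl in *. lra.
  - replace (Im (u n) - Im l)%R with (Im (u n - l)) by (unfold Re, Im, Cminus, Cplus, Copp; simpl; ring).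
    generalize (Rabs_im_le (u n - l)). destruct eps as [e He]; simpl in *. lra.
Qed.

Lemma climit_CLim_seq (u : nat -> C) (l : C) : climit u l -> CLim_seq u = l.
Proof.
  intros H. destruct (climit_Re_Im u l H) as [H1 H2]. unfold CLim_seq.
  rewrite (is_lim_seq_unique _ _ H1), (is_lim_seq_unique _ _ H2). simpl.
  now destruct l.
Qed.

Lemma sum_n_psum (u : nat -> C) (n : nat) :
  sum_n (G := C_AbelianMonoid) u n = psum u (S n).
Proof.
  induction n as [ | n IH].
  - rewrite sum_O. simpl psum. symmetry. apply (Cplus_0_l (u O)).
  - rewrite sum_Sn, IH. reflexivity.
Qed.

Lemma Re_psum (u : nat -> C) (n : nat) : Re (psum u (S n)) = sum_n (fun k => Re (u k)) n.
Proof.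
  induction n as [ | n IH].
  - rewrite sum_O. simpl psum. now rewrite Cplus_0_l.
  - rewrite sum_Sn, <- IH. reflexivity.
Qed.

Lemma Im_psum (u : nat -> C) (n : nat) : Im (psum u (S n)) = sum_n (fun k => Im (u k)) n.
Proof.
  induction n as [ | n IH].
  - rewrite sum_O. simpl psum. now rewrite Cplus_0_l.
  - rewrite sum_Sn, <- IH. reflexivity.
Qed.

Lemma csums_CSeries (u : nat -> C) (l : C) : csums u l -> CSeries u = l.
Proof.
  intros H. apply climit_shift in H. destruct (climit_Re_Im _ _ H) as [H1 H2].
  unfold CSeries.
  rewrite (is_series_unique (fun n => Re (u n)) (Re l)).
  2:{ change (is_lim_seq (sum_n (fun k => Re (u k))) (Re l)).
      eapply is_lim_seq_ext; [ | exact H1]. intros n. apply Re_psum. }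
  rewrite (is_series_unique (fun n => Im (u n)) (Im l)).
  2:{ change (is_lim_seq (sum_n (fun k => Im (u k))) (Im l)).
      eapply is_lim_seq_ext; [ | exact H2]. intros n. apply Im_psum. }
  now destruct l.
Qed.

Lemma csums_is_series (u : nat -> C) (l : C) :
  csums u l -> is_series (V := C_NormedModule) u l.
Proof.
  intros H. apply climit_shift in H.
  apply (filterlim_locally_ball_norm (K := C_AbsRing) (U := C_NormedModule)).
  intros eps. destruct (H (eps / 2)%R) as [N HN]; [destruct eps; simpl; lra | ].
  exists N. intros n Hn. specialize (HN n Hn). unfold ball_norm.
  change (Cmod (sum_n (G := C_AbelianMonoid) u n - l) < eps)%R.
  rewrite sum_n_psum. destruct eps as [e He]; simpl in *. lra.
Qed.

Lemma csums_unique (u : nat -> C) (l m : C) : csums u l -> csums u m -> l = m.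
Proof. apply climit_unique. Qed.

Lemma psum_ext (u v : nat -> C) (n : nat) :
  (forall k, (k < n)%nat -> u k = v k) -> psum u n = psum v n.
Proof.
  induction n as [ | n IH]; intros H; simpl; [easy | ].
  rewrite IH, H; auto.
Qed.

Lemma csums_ext (u v : nat -> C) (l : C) :
  (forall n, u n = v n) -> csums u l -> csums v l.
Proof. intros E. apply climit_ext. intros n. apply psum_ext; auto. Qed.

Lemma psum_plus (u v : nat -> C) (n : nat) :
  psum (fun k => u k + v k) n = psum u n + psum v n.
Proof. induction n as [ | n IH]; simpl; [ | rewrite IH]; ring. Qed.

Lemma psum_scal (k : C) (u : nat -> C) (n : nat) :
  psum (fun j => k * u j) n = k * psum u n.
Proof. induction n as [ | n IH]; simpl; [ | rewrite IH]; ring. Qed.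

Lemma csums_scal (k : C) (u : nat -> C) (l : C) :
  csums u l -> csums (fun n => k * u n) (k * l).
Proof.
  intros H. eapply climit_ext; [ | exact (climit_scal k _ _ H)].
  intros n. simpl. now rewrite psum_scal.
Qed.

Lemma csums_finite (u : nat -> C) (N : nat) :
  (forall n, (N <= n)%nat -> u n = 0) -> csums u (psum u N).
Proof.
  intros H eps He. exists N. intros n Hn.
  replace (psum u n) with (psum u N).
  - replace (psum u N - psum u N) with (RtoC 0) by ring. rewrite Cmod_0. lra.
  - induction Hn as [ | n Hn IH]; simpl; [easy | ]. rewrite <- IH, H by lia. ring.
Qed.

Lemma rsum_tail (M : nat -> R) (n k : nat) : summable M ->
  (rsum M n <= rsum M (n + k))%R.
Proof.
  intros [H _]. induction k as [ | k IH].
  - rewrite Nat.add_0_r. lra.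
  - rewrite Nat.add_succ_r. simpl. specialize (H (n + k)%nat). lra.
Qed.

(** Classical argument: if no partial sum came within [eps] of the supremum [s], then [s - eps]
    would be a smaller upper bound. *)
Lemma summable_cauchy (M : nat -> R) : summable M ->
  forall eps, (0 < eps)%R -> exists N, forall n k, (N <= n)%nat ->
  (rsum M (n + k) - rsum M n <= eps)%R.
Proof.
  intros HM eps He. assert (HM' := HM). destruct HM' as [H0 [B HB]].
  destruct (completeness (fun x => exists n, x = rsum M n)) as [s [Hs1 Hs2]].
  { exists B. intros x [n ->]. auto. }
  { exists (rsum M 0). now exists O. }
  destruct (Classical_Prop.classic (exists N, s - eps <= rsum M N)%R) as [[N HN] | HN].
  - exists N. intros n k Hn.
    assert (rsum M (n + k) <= s)%R by (apply Hs1; eauto).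
    assert (rsum M N <= rsum M n)%R.
    { replace n with (N + (n - N))%nat by lia. now apply rsum_tail. }
    lra.
  - exfalso. assert (s <= s - eps)%R; [ | lra].
    apply Hs2. intros x [n ->]. destruct (Rle_dec (rsum M n) (s - eps)); [easy | ].
    exfalso. apply HN. exists n. lra.
Qed.

Lemma psum_diff_bound (u : nat -> C) (M : nat -> R) (n k : nat) :
  (forall j, Cmod (u j) <= M j)%R ->
  (Cmod (psum u (n + k) - psum u n) <= rsum M (n + k) - rsum M n)%R.
Proof.
  intros H. induction k as [ | k IH].
  - rewrite Nat.add_0_r. replace (psum u n - psum u n) with (RtoC 0) by ring.
    rewrite Cmod_0. lra.
  - rewrite Nat.add_succ_r. simpl.
    replace (psum u (n + k) + u (n + k)%nat - psum u n)
      with ((psum u (n + k) - psum u n) + u (n + k)%nat) by ring.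
    eapply Rle_trans; [apply Cmod_triangle | ]. specialize (H (n + k)%nat). lra.
Qed.

Lemma psum_bound (u : nat -> C) (M : nat -> R) (n : nat) :
  (forall j, Cmod (u j) <= M j)%R -> (Cmod (psum u n) <= rsum M n)%R.
Proof.
  intros H. generalize (psum_diff_bound u M 0 n H). simpl.
  replace (psum u n - 0) with (psum u n) by ring. lra.
Qed.

(** Weierstrass test. [N] is chosen from the majorant before [u], so one [N] serves all values of
    the variables on which [u] may depend. *)
Lemma dominated_uniform (M : nat -> R) : summable M ->
  forall eps, (0 < eps)%R -> exists N, forall u l,
    (forall j, Cmod (u j) <= M j)%R -> csums u l ->
    forall n, (N <= n)%nat -> (Cmod (l - psum u n) <= eps)%R.
Proof.
  intros HM eps He. destruct (summable_cauchy M HM eps He) as [N HN].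
  exists N. intros u l Hu Hl n Hn.
  apply climit_bound with (psum u); [exact Hl | ].
  exists n. intros m Hm. replace m with (n + (m - n))%nat by lia.
  eapply Rle_trans; [now apply psum_diff_bound | ]. now apply HN.
Qed.

Lemma dominated_csums (M : nat -> R) (u : nat -> C) : summable M ->
  (forall j, Cmod (u j) <= M j)%R -> exists l, csums u l.
Proof.
  intros HM Hu. apply climit_cauchy. intros eps He.
  destruct (summable_cauchy M HM (eps / 2)%R) as [N HN]; [lra | ].
  exists N. intros n m Hn Hm.
  assert (A : forall p, (N <= p)%nat -> (Cmod (psum u p - psum u N) <= eps / 2)%R).
  { intros p Hp. replace p with (N + (p - N))%nat by lia.
    eapply Rle_trans; [now apply psum_diff_bound | ]. now apply HN. }
  assert (A1 := A n Hn). assert (A2 := A m Hm).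
  generalize (Cmod_triangle_minus (psum u n) (psum u N) (psum u m)).
  rewrite (Cmod_minus_sym (psum u N) (psum u m)). lra.
Qed.

Lemma csums_bound (u : nat -> C) (M : nat -> R) (B : R) (l : C) :
  (forall j, Cmod (u j) <= M j)%R -> (forall n, rsum M n <= B)%R ->
  csums u l -> (Cmod l <= B)%R.
Proof.
  intros Hu HB Hl. replace l with (l - 0) by ring.
  apply climit_bound with (psum u); [exact Hl | ]. exists O. intros n _.
  replace (psum u n - 0) with (psum u n) by ring.
  eapply Rle_trans; [now apply psum_bound | ]. apply HB.
Qed.

Lemma rsum_geom (K x : R) (n : nat) : (0 <= x < 1)%R -> (0 <= K)%R ->
  (rsum (fun k => K * x ^ k) n <= K / (1 - x))%R.
Proof.
  intros Hx HK.
  assert (E : (rsum (fun k => K * x ^ k) n = K * (1 - x ^ n) / (1 - x))%R).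
  { induction n as [ | n IH]; simpl; [field; lra | ]. rewrite IH. field. lra. }
  rewrite E. unfold Rdiv. apply Rmult_le_compat_r.
  - left. apply Rinv_0_lt_compat. lra.
  - assert (0 <= x ^ n)%R by (apply pow_le; lra). nra.
Qed.

Lemma summable_geom (K x : R) : (0 <= x < 1)%R -> (0 <= K)%R ->
  summable (fun k => K * x ^ k)%R.
Proof.
  intros Hx HK. split.
  - intros n. apply Rmult_le_pos; [easy | ]. apply pow_le. lra.
  - exists (K / (1 - x))%R. intros n. now apply rsum_geom.
Qed.

(** * Euler's expansions of the infinite products *)

Definition tri (n : nat) : nat := (n * (n - 1) / 2)%nat.

Lemma tri_S (n : nat) : tri (S n) = (tri n + n)%nat.
Proof.
  unfold tri. destruct n as [ | n]; [easy | ].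
  replace (S (S n) * (S (S n) - 1))%nat with (S n * (S n - 1) + S n * 2)%nat by nia.
  now rewrite Nat.div_add by lia.
Qed.

Lemma Cmod_1_minus_ge (x : C) : (1 - Cmod x <= Cmod (1 - x))%R.
Proof.
  generalize (Cmod_triangle (1 - x) x). replace (1 - x + x) with (RtoC 1) by ring.
  rewrite Cmod_1. lra.
Qed.

Lemma Cmod_1_minus_le (x : C) : (Cmod (1 - x) <= 1 + Cmod x)%R.
Proof.
  unfold Cminus. eapply Rle_trans; [apply Cmod_triangle | ].
  rewrite Cmod_1, Cmod_opp. lra.
Qed.

Lemma one_minus_neq_0 (x : C) : (Cmod x < 1)%R -> 1 - x <> 0.
Proof.
  intros H E. generalize (Cmod_1_minus_ge x). rewrite E, Cmod_0. lra.
Qed.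

Lemma Cmod_mult_le (x y : C) (A B : R) :
  (Cmod x <= A)%R -> (Cmod y <= B)%R -> (Cmod (x * y) <= A * B)%R.
Proof.
  intros. rewrite Cmod_mult. apply Rmult_le_compat; auto using Cmod_ge_0.
Qed.

Lemma Cmod_mult_lt_1 (x y : C) : (Cmod x < 1)%R -> (Cmod y < 1)%R -> (Cmod (x * y) < 1)%R.
Proof.
  intros Hx Hy. rewrite Cmod_mult.
  generalize (Cmod_ge_0 x) (Cmod_ge_0 y). nra.
Qed.

Section QSeries.
Context (q : R) (Hq : (0 < q < 1)%R).

Lemma Cmod_q : Cmod q = q.
Proof. rewrite Cmod_R. apply Rabs_pos_eq. lra. Qed.

Lemma q_neq_0 : RtoC q <> 0.
Proof. intros E. apply RtoC_inj in E. lra. Qed.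

Lemma Cmod_qpow (n : nat) : Cmod (q ^ n) = (q ^ n)%R.
Proof. now rewrite Cmod_pow, Cmod_q. Qed.

Lemma qpow_neq_0 (n : nat) : RtoC q ^ n <> 0.
Proof. apply Cpow_nz, q_neq_0. Qed.

Lemma qpow_le_1 (n : nat) : (0 < q ^ n <= 1)%R.
Proof.
  split; [apply pow_lt; lra | ]. induction n as [ | n IH]; simpl; [lra | ].
  assert (0 < q ^ n)%R by (apply pow_lt; lra). nra.
Qed.

Lemma Cmod_mul_qpow_le (x : C) (n : nat) : (Cmod (x * q ^ n) <= Cmod x)%R.
Proof.
  rewrite Cmod_mult, Cmod_qpow. generalize (Cmod_ge_0 x) (qpow_le_1 n). nra.
Qed.

Lemma Cmod_mul_q_le (x : C) : (Cmod (x * q) <= Cmod x)%R.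
Proof. generalize (Cmod_mul_qpow_le x 1). now rewrite Cpow_1_r. Qed.

Lemma qpow_S_lt_1 (n : nat) : (Cmod (q ^ S n) < 1)%R.
Proof. rewrite Cmod_qpow. simpl. generalize (qpow_le_1 n). nra. Qed.

Lemma qpoch_add (x : C) (n m : nat) :
  qpoch x q (n + m) = qpoch x q n * qpoch (x * q ^ n) q m.
Proof.
  induction m as [ | m IH].
  - rewrite Nat.add_0_r. simpl. ring.
  - rewrite Nat.add_succ_r. simpl. rewrite IH, Cpow_add_r. ring.
Qed.

Lemma qpoch_S_l (x : C) (n : nat) : qpoch x q (S n) = (1 - x) * qpoch (x * q) q n.
Proof.
  change (S n) with (1 + n)%nat. rewrite qpoch_add, Cpow_1_r. simpl. ring.
Qed.

Lemma qpoch_0 (n : nat) : qpoch 0 q n = 1.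
Proof. induction n as [ | n IH]; simpl; [easy | ]. rewrite IH. ring. Qed.

(** The exponent is the geometric sum of A q^k, after 1 + x <= e^x has been applied to each
    factor. *)
Definition upper_bound_qpoch (A : R) : R := exp (A / (1 - q)).
(** An upper bound for the reciprocal of (x;q)_n when |x| <= A < 1: each factor obeys 1/(1-t) = 1 +
    t/(1-t) <= exp(t/(1-t)), and t = A q^k gives t/(1-t) <= A q^k/(1-A). *)
Definition lower_bound_qpoch (A : R) : R := exp (A / (1 - A) / (1 - q)).

Lemma qpoch_bound (x : C) (A : R) (n : nat) :
  (Cmod x <= A)%R -> (Cmod (qpoch x q n) <= upper_bound_qpoch A)%R.
Proof.
  intros HA. assert (HA0 := Cmod_ge_0 x).
  apply Rle_trans with (exp (rsum (fun k => A * q ^ k) n))%R.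
  - induction n as [ | n IH]; simpl.
    + rewrite exp_0, Cmod_1. lra.
    + rewrite exp_plus. apply Cmod_mult_le; [easy | ].
      eapply Rle_trans; [apply Cmod_1_minus_le | ].
      apply Rle_trans with (1 + A * q ^ n)%R; [ | apply exp_ineq1_le].
      rewrite Cmod_mult, Cmod_qpow. generalize (qpow_le_1 n). nra.
  - unfold upper_bound_qpoch. destruct (rsum_geom A q n) as [H | H]; try lra.
    + left. now apply exp_increasing.
    + rewrite H. lra.
Qed.

Lemma qpoch_neq_0 (x : C) (n : nat) : (Cmod x < 1)%R -> qpoch x q n <> 0.
Proof.
  intros H. induction n as [ | n IH]; simpl; [apply C1_nz | ].
  apply Cmult_neq_0; [easy | ]. apply one_minus_neq_0.
  generalize (Cmod_mul_qpow_le x n). lra.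
Qed.

Lemma inv_one_minus_bound (x : C) (t : R) : (Cmod x <= t)%R -> (t < 1)%R ->
  (Cmod (/ (1 - x)) <= exp (t / (1 - t)))%R.
Proof.
  intros H Ht. assert (H0 := Cmod_ge_0 x).
  rewrite Cmod_inv by (apply one_minus_neq_0; lra).
  generalize (Cmod_1_minus_ge x). intros H1.
  apply Rle_trans with (/ (1 - t))%R.
  - apply Rinv_le_contravar; lra.
  - replace (/ (1 - t))%R with (1 + t / (1 - t))%R by (field; lra).
    apply exp_ineq1_le.
Qed.

Lemma inv_qpoch_bound (x : C) (A : R) (n : nat) : (Cmod x <= A)%R -> (A < 1)%R ->
  (Cmod (/ qpoch x q n) <= lower_bound_qpoch A)%R.
Proof.
  intros HA HA1. assert (HA0 := Cmod_ge_0 x).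
  assert (P : (0 <= A / (1 - A))%R) by (apply Rdiv_le_0_compat; lra).
  apply Rle_trans with (exp (rsum (fun k => A / (1 - A) * q ^ k) n))%R.
  - induction n as [ | n IH]; simpl.
    + rewrite exp_0. replace (/ 1) with (RtoC 1) by (field; apply C1_nz).
      rewrite Cmod_1. lra.
    + rewrite exp_plus.
      assert (Hn := qpow_le_1 n).
      assert (Hx : (Cmod (x * q ^ n) <= A * q ^ n)%R).
      { rewrite Cmod_mult, Cmod_qpow. nra. }
      assert (Hx1 : (A * q ^ n <= A)%R) by nra.
      replace (/ (qpoch x q n * (1 - x * q ^ n)))
        with (/ qpoch x q n * / (1 - x * q ^ n)).
      2:{ field. split; [apply one_minus_neq_0; lra | apply qpoch_neq_0; lra]. }
      apply Cmod_mult_le; [easy | ].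
      eapply Rle_trans; [apply inv_one_minus_bound; [exact Hx | lra] | ].
      assert (L : (A * q ^ n / (1 - A * q ^ n) <= A / (1 - A) * q ^ n)%R).
      { replace (A / (1 - A) * q ^ n)%R with (A * q ^ n / (1 - A))%R by (field; lra).
        unfold Rdiv. apply Rmult_le_compat_l; [nra | ].
        apply Rinv_le_contravar; lra. }
      destruct L as [L | L]; [left; now apply exp_increasing | rewrite L; lra].
  - unfold lower_bound_qpoch. destruct (rsum_geom (A / (1 - A)) q n) as [H | H]; try lra.
    + left. now apply exp_increasing.
    + rewrite H. lra.
Qed.

(** Euler's Taylor coefficients of (x;q)_oo; those of its reciprocal are [Fc]. *)
Definition Ec (n : nat) : C := (-(1)) ^ n * q ^ tri n / qpoch q q n.
Definition Fc (n : nat) : C := / qpoch q q n.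

Lemma qpoch_q_neq_0 (n : nat) : qpoch q q n <> 0.
Proof. apply qpoch_neq_0. rewrite Cmod_q. lra. Qed.

Lemma qpow_S_neq_1 (n : nat) : 1 - RtoC q * q ^ n <> 0.
Proof. apply one_minus_neq_0. rewrite <- Cpow_S. apply qpow_S_lt_1. Qed.

Lemma Ec_S (n : nat) : Ec (S n) * (1 - q ^ S n) = - q ^ n * Ec n.
Proof.
  unfold Ec. rewrite tri_S, Cpow_add_r. simpl. field.
  repeat split; first [apply qpow_S_neq_1 | apply qpoch_q_neq_0].
Qed.

Lemma Fc_S (n : nat) : Fc (S n) * (1 - q ^ S n) = Fc n.
Proof.
  unfold Fc. simpl. field. repeat split; first [apply qpow_S_neq_1 | apply qpoch_q_neq_0].
Qed.

(** The factor 1/q pays for replacing q^(n(n-1)/2) by a geometric term, as n(n-1)/2 >= n-1. *)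
Definition coef_bound : R := (lower_bound_qpoch q / q)%R.

Lemma lower_bound_pos (A : R) : (0 < lower_bound_qpoch A)%R.
Proof. apply exp_pos. Qed.

Lemma upper_bound_pos (A : R) : (0 < upper_bound_qpoch A)%R.
Proof. apply exp_pos. Qed.

Lemma coef_bound_ge : (lower_bound_qpoch q <= coef_bound)%R.
Proof.
  unfold coef_bound. generalize (lower_bound_pos q). intros H.
  apply Rmult_le_reg_r with q; [lra | ]. unfold Rdiv.
  rewrite Rmult_assoc, Rinv_l by lra. nra.
Qed.

Lemma Cmod_m1_pow (n : nat) : Cmod ((-(1)) ^ n) = 1%R.
Proof. rewrite Cmod_pow, Cmod_m1. apply pow1. Qed.

Lemma q_tri_le (n : nat) : (q ^ tri n <= / q * q ^ n)%R.
Proof.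
  destruct n as [ | n].
  - simpl. rewrite Rmult_1_r. rewrite <- Rinv_1 at 1. apply Rinv_le_contravar; lra.
  - rewrite tri_S, pow_add. simpl.
    replace (/ q * (q * q ^ n))%R with (q ^ n)%R by (field; lra).
    generalize (qpow_le_1 n) (qpow_le_1 (tri n)). nra.
Qed.

Lemma Ec_bound (x : C) (n : nat) : (Cmod x <= 1)%R ->
  (Cmod (Ec n * x ^ n) <= coef_bound * q ^ n)%R.
Proof.
  intros Hx. unfold Ec, Cdiv.
  replace ((-(1)) ^ n * q ^ tri n * / qpoch q q n * x ^ n)
    with (/ qpoch q q n * ((-(1)) ^ n * x ^ n * q ^ tri n)) by ring.
  unfold coef_bound.
  replace (lower_bound_qpoch q / q * q ^ n)%R
    with (lower_bound_qpoch q * (1 * (/ q * q ^ n)))%R by (field; lra).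
  apply Cmod_mult_le.
  - apply inv_qpoch_bound; rewrite ?Cmod_q; lra.
  - apply Cmod_mult_le.
    + rewrite Cmod_mult, Cmod_m1_pow, Cmod_pow, Rmult_1_l.
      rewrite <- (pow1 n). apply pow_incr. split; [apply Cmod_ge_0 | easy].
    + rewrite Cmod_qpow. apply q_tri_le.
Qed.

Lemma Fc_bound (x : C) (A : R) (n : nat) : (Cmod x <= A)%R ->
  (Cmod (Fc n * x ^ n) <= lower_bound_qpoch q * A ^ n)%R.
Proof.
  intros Hx. apply Cmod_mult_le.
  - apply inv_qpoch_bound; rewrite ?Cmod_q; lra.
  - rewrite Cmod_pow. apply pow_incr. split; [apply Cmod_ge_0 | easy].
Qed.

Lemma summable_Ec : summable (fun n => coef_bound * q ^ n)%R.
Proof.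
  apply summable_geom; [lra | ]. generalize coef_bound_ge (lower_bound_pos q). lra.
Qed.

Lemma Ec_csums (x : C) : (Cmod x <= 1)%R -> exists l, csums (fun n => Ec n * x ^ n) l.
Proof.
  intros Hx. apply dominated_csums with (1 := summable_Ec).
  intros n. now apply Ec_bound.
Qed.

Lemma Fc_csums (x : C) : (Cmod x < 1)%R -> exists l, csums (fun n => Fc n * x ^ n) l.
Proof.
  intros Hx. apply (dominated_csums (fun n => lower_bound_qpoch q * Cmod x ^ n)%R).
  - apply summable_geom; [ | left; apply lower_bound_pos].
    split; [apply Cmod_ge_0 | easy].
  - intros n. apply Fc_bound. lra.
Qed.

(** The coefficient recursion [Ec_S] relates the partial sums at x and at x q exactly; the limit is
    the functional equation f(x) = (1-x) f(xq) of the infinite product. *)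
Lemma Ec_step (x l m : C) : csums (fun n => Ec n * x ^ n) l ->
  csums (fun n => Ec n * (x * q) ^ n) m -> l = (1 - x) * m.
Proof.
  intros Hl Hm.
  assert (E : forall n, psum (fun n => Ec n * x ^ n) (S n) =
     psum (fun n => Ec n * (x * q) ^ n) (S n)
     - x * psum (fun n => Ec n * (x * q) ^ n) n).
  { intros n. induction n as [ | n IH].
    - simpl. ring.
    - change (psum (fun n => Ec n * x ^ n) (S (S n)))
        with (psum (fun n => Ec n * x ^ n) (S n) + Ec (S n) * x ^ S n).
      change (psum (fun n => Ec n * (x * q) ^ n) (S (S n)))
        with (psum (fun n => Ec n * (x * q) ^ n) (S n) + Ec (S n) * (x * q) ^ S n).
      rewrite IH.
      replace (Ec (S n) * x ^ S n)
        with (Ec (S n) * (x * q) ^ S n + Ec (S n) * (1 - q ^ S n) * x ^ S n).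
      2:{ rewrite Cpow_mult_l. ring. }
      rewrite Ec_S. simpl. rewrite !Cpow_mult_l. ring. }
  apply (climit_unique (fun n => psum (fun n => Ec n * x ^ n) (S n))).
  - now apply climit_shift.
  - eapply climit_ext; [intros n; symmetry; apply E | ].
    replace ((1 - x) * m) with (m - x * m) by ring.
    apply climit_minus; [now apply climit_shift | ]. now apply climit_scal.
Qed.

Lemma Fc_step (x l m : C) : csums (fun n => Fc n * x ^ n) l ->
  csums (fun n => Fc n * (x * q) ^ n) m -> m = (1 - x) * l.
Proof.
  intros Hl Hm.
  assert (E : forall n, psum (fun n => Fc n * (x * q) ^ n) (S n) =
     psum (fun n => Fc n * x ^ n) (S n) - x * psum (fun n => Fc n * x ^ n) n).
  { intros n. induction n as [ | n IH].
    - simpl. ring.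
    - change (psum (fun n => Fc n * x ^ n) (S (S n)))
        with (psum (fun n => Fc n * x ^ n) (S n) + Fc (S n) * x ^ S n).
      change (psum (fun n => Fc n * (x * q) ^ n) (S (S n)))
        with (psum (fun n => Fc n * (x * q) ^ n) (S n) + Fc (S n) * (x * q) ^ S n).
      rewrite IH.
      replace (Fc (S n) * (x * q) ^ S n)
        with (Fc (S n) * x ^ S n - Fc (S n) * (1 - q ^ S n) * x ^ S n).
      2:{ rewrite Cpow_mult_l. ring. }
      rewrite Fc_S. simpl. ring. }
  apply (climit_unique (fun n => psum (fun n => Fc n * (x * q) ^ n) (S n))).
  - now apply climit_shift.
  - eapply climit_ext; [intros n; symmetry; apply E | ].
    replace ((1 - x) * l) with (l - x * l) by ring.
    apply climit_minus; [now apply climit_shift | ]. now apply climit_scal.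
Qed.

Lemma Ec_iter (x l m : C) (n : nat) : (Cmod x <= 1)%R ->
  csums (fun n => Ec n * x ^ n) l ->
  csums (fun k => Ec k * (x * q ^ n) ^ k) m -> l = qpoch x q n * m.
Proof.
  intros Hx Hl. revert m. induction n as [ | n IH]; intros m Hm.
  - simpl. rewrite Cmult_1_l. eapply csums_unique; [exact Hl | ].
    eapply csums_ext; [ | exact Hm]. intros k. simpl. now rewrite Cmult_1_r.
  - destruct (Ec_csums (x * q ^ n)) as [p Hp].
    { generalize (Cmod_mul_qpow_le x n). lra. }
    rewrite (IH p Hp). simpl. rewrite <- Cmult_assoc. f_equal.
    apply Ec_step with (1 := Hp). eapply csums_ext; [ | exact Hm].
    intros k. simpl. do 2 f_equal. ring.
Qed.

Lemma Fc_iter (x l m : C) (n : nat) : (Cmod x < 1)%R ->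
  csums (fun n => Fc n * x ^ n) l ->
  csums (fun k => Fc k * (x * q ^ n) ^ k) m -> m = qpoch x q n * l.
Proof.
  intros Hx Hl. revert m. induction n as [ | n IH]; intros m Hm.
  - simpl. rewrite Cmult_1_l. eapply csums_unique; [ | exact Hl].
    eapply csums_ext; [ | exact Hm]. intros k. simpl. now rewrite Cmult_1_r.
  - destruct (Fc_csums (x * q ^ n)) as [p Hp].
    { generalize (Cmod_mul_qpow_le x n). lra. }
    simpl. rewrite (Cmult_comm (qpoch x q n)), <- Cmult_assoc, <- (IH p Hp).
    apply Fc_step with (1 := Hp). eapply csums_ext; [ | exact Hm].
    intros k. simpl. do 2 f_equal. ring.
Qed.

(** Continuity at 0 with an explicit constant. Iterating the functional equations drives the
    argument to x q^n, where the series must approach its constant term 1 at a known rate. *)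
Lemma series_near_1 (u : nat -> C) (K x : R) (y : C) (l : C) :
  u O = 1 -> (0 <= x < 1)%R -> (0 <= K)%R -> (Cmod y <= 1)%R ->
  (forall n, Cmod (u (S n)) <= K * x ^ n)%R ->
  csums (fun n => u n * y ^ n) l -> (Cmod (l - 1) <= K / (1 - x) * Cmod y)%R.
Proof.
  intros H0 Hx HK Hy Hu Hl.
  apply climit_bound with (1 := proj2 (climit_shift _ _) Hl).
  exists O. intros n _.
  apply Rle_trans with (rsum (fun k => K * x ^ k) n * Cmod y)%R.
  - induction n as [ | n IH].
    + simpl. rewrite H0. replace (0 + 1 * 1 - 1) with (RtoC 0) by ring.
      rewrite Cmod_0. lra.
    + change (psum (fun n => u n * y ^ n) (S (S n)))
        with (psum (fun n => u n * y ^ n) (S n) + u (S n) * y ^ S n).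
      replace (psum (fun n => u n * y ^ n) (S n) + u (S n) * y ^ S n - 1)
        with ((psum (fun n => u n * y ^ n) (S n) - 1) + u (S n) * (y ^ n * y))
        by (simpl; ring).
      eapply Rle_trans; [apply Cmod_triangle | ]. simpl rsum.
      rewrite Rmult_plus_distr_r. apply Rplus_le_compat; [easy | ].
      rewrite Rmult_assoc.
      replace (K * (x ^ n * Cmod y))%R with (K * x ^ n * (1 * Cmod y))%R by ring.
      apply Cmod_mult_le; [easy | ]. apply Cmod_mult_le; [ | lra].
      rewrite Cmod_pow, <- (pow1 n). apply pow_incr.
      split; [apply Cmod_ge_0 | easy].
  - apply Rmult_le_compat_r; [apply Cmod_ge_0 | ]. now apply rsum_geom.
Qed.

Definition near_1_const : R := (coef_bound / (1 - q))%R.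

Lemma near_1_const_pos : (0 < near_1_const)%R.
Proof.
  unfold near_1_const. apply Rdiv_lt_0_compat; [ | lra].
  generalize coef_bound_ge (lower_bound_pos q). lra.
Qed.

Lemma Ec_near_1 (y l : C) : (Cmod y <= 1)%R ->
  csums (fun n => Ec n * y ^ n) l -> (Cmod (l - 1) <= near_1_const * Cmod y)%R.
Proof.
  intros Hy. apply (series_near_1 Ec coef_bound q); try lra; try easy.
  - unfold Ec. simpl. change (tri 0) with O. simpl. field.
  - generalize coef_bound_ge (lower_bound_pos q). lra.
  - intros n. generalize (Ec_bound 1 (S n)). rewrite Cpow_1_l, Cmult_1_r, Cmod_1.
    intros H. eapply Rle_trans; [apply H; lra | ]. simpl.
    generalize coef_bound_ge (lower_bound_pos q) (qpow_le_1 n). intros.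
    assert (0 <= coef_bound * q ^ n)%R by nra. nra.
Qed.

Lemma qpow_to_0 (K eps : R) : (0 < eps)%R -> (0 <= K)%R ->
  exists N, forall n, (N <= n)%nat -> (K * q ^ n <= eps)%R.
Proof.
  intros He HK.
  destruct (pow_lt_1_zero q ltac:(rewrite Rabs_pos_eq; lra) (eps / (K + 1))%R) as [N HN].
  { apply Rdiv_lt_0_compat; lra. }
  exists N. intros n Hn. specialize (HN n Hn). generalize (qpow_le_1 n). intros Hp.
  rewrite Rabs_pos_eq in HN by lra.
  apply Rmult_lt_compat_r with (r := (K + 1)%R) in HN; [ | lra].
  replace (eps / (K + 1) * (K + 1))%R with eps in HN by (field; lra). nra.
Qed.

(** By iteration the sum l is (x;q)_n times the series at x q^n; the latter tends to 1 while (x;q)_n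
    stays bounded. *)
Lemma qpoch_climit (x l : C) : (Cmod x <= 1)%R ->
  csums (fun n => Ec n * x ^ n) l -> climit (fun n => qpoch x q n) l.
Proof.
  intros Hx Hl eps He.
  assert (HU := upper_bound_pos 1). assert (HN1 := near_1_const_pos).
  destruct (qpow_to_0 (upper_bound_qpoch 1 * near_1_const) eps He) as [N HN]; [nra | ].
  exists N. intros n Hn.
  destruct (Ec_csums (x * q ^ n)) as [m Hm].
  { generalize (Cmod_mul_qpow_le x n). lra. }
  rewrite (Ec_iter x l m n Hx Hl Hm).
  replace (qpoch x q n - qpoch x q n * m) with (qpoch x q n * - (m - 1)) by ring.
  eapply Rle_trans; [ | exact (HN n Hn)]. rewrite Rmult_assoc.
  apply Cmod_mult_le; [now apply qpoch_bound | ]. rewrite Cmod_opp.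
  eapply Rle_trans; [apply Ec_near_1; [ | exact Hm] | ].
  { generalize (Cmod_mul_qpow_le x n). lra. }
  apply Rmult_le_compat_l; [lra | ]. rewrite Cmod_mult, Cmod_qpow.
  generalize (qpow_le_1 n). nra.
Qed.

Lemma qinf_climit (x : C) : (Cmod x <= 1)%R -> climit (fun n => qpoch x q n) (qpoch_inf x q).
Proof.
  intros Hx. destruct (Ec_csums x Hx) as [l Hl].
  assert (H := qpoch_climit x l Hx Hl). unfold qpoch_inf.
  now rewrite (climit_CLim_seq _ _ H).
Qed.

Lemma qinf_series (x : C) : (Cmod x <= 1)%R ->
  csums (fun n => Ec n * x ^ n) (qpoch_inf x q).
Proof.
  intros Hx. destruct (Ec_csums x Hx) as [l Hl].
  now rewrite (climit_unique _ _ _ (qinf_climit x Hx) (qpoch_climit x l Hx Hl)).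
Qed.

Lemma qinf_split (x : C) (n : nat) : (Cmod x <= 1)%R ->
  qpoch_inf x q = qpoch x q n * qpoch_inf (x * q ^ n) q.
Proof.
  intros Hx. apply Ec_iter; [easy | now apply qinf_series | ].
  apply qinf_series. generalize (Cmod_mul_qpow_le x n). lra.
Qed.

Lemma qinf_step (x : C) : (Cmod x <= 1)%R ->
  qpoch_inf x q = (1 - x) * qpoch_inf (x * q) q.
Proof.
  intros Hx. rewrite (qinf_split x 1 Hx), Cpow_1_r. simpl. ring.
Qed.

Lemma qinf_near_1 (y : C) : (Cmod y <= 1)%R ->
  (Cmod (qpoch_inf y q - 1) <= near_1_const * Cmod y)%R.
Proof. intros Hy. apply Ec_near_1; [easy | now apply qinf_series]. Qed.

Lemma qinf_0 : qpoch_inf 0 q = 1.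
Proof.
  apply Ceq_minus, Cmod_eq_0. generalize (qinf_near_1 0). rewrite Cmod_0.
  generalize (Cmod_ge_0 (qpoch_inf 0 q - 1)). lra.
Qed.

(** The sequence l (x;q)_n tends to l times the infinite product; it is also the sum of the [Fc]
    series at x q^n, which tends to 1. *)
Lemma inv_qinf_aux (x l : C) : (Cmod x < 1)%R ->
  csums (fun n => Fc n * x ^ n) l -> qpoch_inf x q * l = 1.
Proof.
  intros Hx Hl. apply (climit_unique (fun n => l * qpoch x q n)).
  - rewrite Cmult_comm. apply climit_scal, qinf_climit. lra.
  - intros eps He.
    set (A := Cmod x). assert (HA := Cmod_ge_0 x). fold A in HA, Hx.
    assert (HK := lower_bound_pos q).
    destruct (qpow_to_0 (lower_bound_qpoch q / (1 - A)) eps He) as [N HN].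
    { apply Rdiv_le_0_compat; lra. }
    exists N. intros n Hn.
    destruct (Fc_csums (x * q ^ n)) as [m Hm].
    { generalize (Cmod_mul_qpow_le x n). fold A. lra. }
    rewrite Cmult_comm, <- (Fc_iter x l m n Hx Hl Hm).
    eapply Rle_trans; [ | exact (HN n Hn)].
    rewrite <- (Cmod_qpow n).
    (* The powers of [x] go into the coefficients, so that [q ^ n] alone is the small variable. *)
    apply (series_near_1 (fun n => Fc n * x ^ n)); try easy; try lra.
    + unfold Fc. simpl. field.
    + rewrite Cmod_qpow. apply qpow_le_1.
    + intros k. eapply Rle_trans; [apply (Fc_bound x A); unfold A; lra | ].
      apply Rmult_le_compat_l; [lra | ]. simpl.
      assert (0 <= A ^ k)%R by (apply pow_le; lra). nra.
    + eapply csums_ext; [ | exact Hm]. intros k. simpl.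
      rewrite Cpow_mult_l. ring.
Qed.

Lemma qinf_neq_0 (x : C) : (Cmod x < 1)%R -> qpoch_inf x q <> 0.
Proof.
  intros Hx E. destruct (Fc_csums x Hx) as [l Hl].
  generalize (inv_qinf_aux x l Hx Hl). rewrite E, Cmult_0_l.
  intros F. now apply C1_nz.
Qed.

Lemma inv_qinf_series (x : C) : (Cmod x < 1)%R ->
  csums (fun n => Fc n * x ^ n) (/ qpoch_inf x q).
Proof.
  intros Hx. destruct (Fc_csums x Hx) as [l Hl].
  replace (/ qpoch_inf x q) with l; [easy | ].
  rewrite <- (Cmult_1_r (/ qpoch_inf x q)), <- (inv_qinf_aux x l Hx Hl).
  field. now apply qinf_neq_0.
Qed.

Lemma qinf_bound (x : C) : (Cmod x <= 1)%R -> (Cmod (qpoch_inf x q) <= upper_bound_qpoch 1)%R.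
Proof.
  intros Hx. replace (qpoch_inf x q) with (qpoch_inf x q - 0) by ring.
  apply climit_bound with (1 := qinf_climit x Hx). exists O. intros n _.
  replace (qpoch x q n - 0) with (qpoch x q n) by ring. now apply qpoch_bound.
Qed.

Lemma inv_qinf_bound (x : C) (A : R) : (Cmod x <= A)%R -> (A < 1)%R ->
  (Cmod (/ qpoch_inf x q) <= lower_bound_qpoch q / (1 - A))%R.
Proof.
  intros Hx HA. assert (H0 := Cmod_ge_0 x).
  apply csums_bound with (3 := inv_qinf_series x ltac:(lra))
    (M := fun n => (lower_bound_qpoch q * A ^ n)%R).
  - intros n. now apply Fc_bound.
  - intros n. apply rsum_geom; [lra | ]. left. apply lower_bound_pos.
Qed.

End QSeries.

(** * Integration over a period *)

Lemma expi_add (x y : R) : expi (x + y) = expi x * expi y.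
Proof. unfold expi, Cmult; simpl. rewrite cos_plus, sin_plus. f_equal; ring. Qed.

Lemma expi_0 : expi 0 = 1.
Proof. unfold expi. now rewrite cos_0, sin_0. Qed.

Lemma expi_opp_r (x : R) : expi x * expi (- x) = 1.
Proof. rewrite <- expi_add, Rplus_opp_r. apply expi_0. Qed.

Lemma Cmod_expi (x : R) : Cmod (expi x) = 1%R.
Proof.
  unfold expi, Cmod; simpl.
  replace (cos x * (cos x * 1) + sin x * (sin x * 1))%R with (Rsqr (sin x) + Rsqr (cos x))%R
    by (unfold Rsqr; ring).
  rewrite sin2_cos2. apply sqrt_1.
Qed.

Lemma expi_double (x : R) : expi (2 * x) = expi x * expi x.
Proof. rewrite <- expi_add. f_equal. ring. Qed.

Definition Int (f : R -> C) (v : C) : Prop :=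
  is_RInt (V := C_R_NormedModule) f (- PI) PI v.

Lemma Int_ext (f g : R -> C) (v : C) : (forall x, f x = g x) -> Int f v -> Int g v.
Proof. intros E. apply is_RInt_ext. intros x _. apply E. Qed.

Lemma Int_plus (f g : R -> C) (u v : C) :
  Int f u -> Int g v -> Int (fun x => f x + g x) (u + v).
Proof. intros Hf Hg. exact (is_RInt_plus (V := C_R_NormedModule) _ _ _ _ _ _ Hf Hg). Qed.

Lemma Int_unique (f : R -> C) (u v : C) : Int f u -> Int f v -> u = v.
Proof.
  intros Hu Hv.
  rewrite <- (is_RInt_unique (V := C_R_CompleteNormedModule) f _ _ u Hu).
  exact (is_RInt_unique (V := C_R_CompleteNormedModule) f _ _ v Hv).
Qed.

Lemma is_RInt_Cmult (f : R -> C) (k v : C) (x y : R) :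
  is_RInt (V := C_R_NormedModule) f x y v ->
  is_RInt (V := C_R_NormedModule) (fun t => k * f t) x y (k * v).
Proof.
  intros H.
  assert (H1 := is_RInt_fct_extend_fst (U := R_NormedModule) (V := R_NormedModule) _ _ _ _ H).
  assert (H2 := is_RInt_fct_extend_snd (U := R_NormedModule) (V := R_NormedModule) _ _ _ _ H).
  apply (is_RInt_fct_extend_pair (U := R_NormedModule) (V := R_NormedModule)
           (fun t => k * f t)).
  - exact (is_RInt_minus _ _ _ _ _ _ (is_RInt_scal _ _ _ (fst k) _ H1)
             (is_RInt_scal _ _ _ (snd k) _ H2)).
  - exact (is_RInt_plus _ _ _ _ _ _ (is_RInt_scal _ _ _ (fst k) _ H2)
             (is_RInt_scal _ _ _ (snd k) _ H1)).
Qed.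

Lemma Int_scal (k : C) (f : R -> C) (v : C) : Int f v -> Int (fun x => k * f x) (k * v).
Proof. apply is_RInt_Cmult. Qed.

Lemma norm_C_R (z : C) : norm (K := R_AbsRing) (V := C_R_NormedModule) z = Cmod z.
Proof.
  destruct z as [x y].
  change (sqrt (norm (K := R_AbsRing) (V := R_NormedModule) x ^ 2
    + norm (K := R_AbsRing) (V := R_NormedModule) y ^ 2) = Cmod (x, y)).
  unfold Cmod; simpl. f_equal.
  change (norm (K := R_AbsRing) (V := R_NormedModule) x) with (Rabs x).
  change (norm (K := R_AbsRing) (V := R_NormedModule) y) with (Rabs y).
  rewrite !Rmult_1_r, <- !Rabs_mult, !Rabs_pos_eq; [easy | nra | nra].
Qed.

Lemma Int_bound (f : R -> C) (v : C) (B : R) :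
  Int f v -> (forall x, Cmod (f x) <= B)%R -> (Cmod v <= 2 * PI * B)%R.
Proof.
  intros Hf HB. rewrite <- norm_C_R.
  replace (2 * PI * B)%R with ((PI - - PI) * B)%R by ring.
  apply (norm_RInt_le_const (V := C_R_NormedModule) f (- PI) PI v B).
  - generalize PI_RGT_0. lra.
  - intros x _. rewrite norm_C_R. apply HB.
  - exact Hf.
Qed.

Definition ulimit (f : nat -> R -> C) (g : R -> C) : Prop :=
  forall eps, (0 < eps)%R -> exists N, forall n, (N <= n)%nat ->
  forall x, (Cmod (f n x - g x) <= eps)%R.

Lemma Int_lim (f : nat -> R -> C) (g : R -> C) (v : nat -> C) :
  (forall n, Int (f n) (v n)) -> ulimit f g -> exists w, Int g w /\ climit v w.
Proof.
  intros Hf Hl.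
  destruct (filterlim_RInt (V := C_R_CompleteNormedModule) f (- PI) PI Hierarchy.eventually
              Hierarchy.eventually_filter g v Hf) as [w [Hw1 Hw2]].
  - apply filterlim_locally. intros eps.
    destruct (Hl (eps / 2)%R) as [N HN]; [destruct eps; simpl; lra | ].
    exists N. intros n Hn x. specialize (HN n Hn x).
    apply C_NormedModule_mixin_compat1.
    change (Cmod (f n x - g x) < eps)%R. destruct eps as [e He]; simpl in *. lra.
  - exists w. split; [exact Hw2 | ].
    assert (B : forall eps, (0 < eps)%R -> exists N, forall n, (N <= n)%nat ->
      (Cmod (v n - w) <= eps)%R); [ | exact B].
    intros eps He. destruct (Hl (eps / (2 * PI))%R) as [N HN].
    { apply Rdiv_lt_0_compat; [easy | ]. generalize PI_RGT_0. lra. }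
    exists N. intros n Hn.
    assert (HI : Int (fun x => f n x + -(1) * g x) (v n + -(1) * w)).
    { apply Int_plus; [apply Hf | ]. now apply Int_scal. }
    replace (v n - w) with (v n + -(1) * w) by ring.
    replace eps with (2 * PI * (eps / (2 * PI)))%R
      by (field; generalize PI_RGT_0; lra).
    apply (Int_bound _ _ _ HI). intros x.
    replace (f n x + -(1) * g x) with (f n x - g x) by ring. now apply HN.
Qed.

Lemma Int_const (k : C) : Int (fun _ => k) (2 * PI * k).
Proof.
  assert (H := is_RInt_const (V := C_R_NormedModule) (- PI) PI k).
  assert (E : @eq C (scal (V := C_R_NormedModule) (PI - - PI)%R k) (2 * PI * k)).
  { etransitivity; [apply scal_R_Cmult | ]. rewrite RtoC_minus, RtoC_opp. ring. }
  unfold Int. now rewrite <- E.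
Qed.

Lemma Int_zero : Int (fun _ => 0) 0.
Proof. generalize (Int_const 0). now replace (2 * PI * 0) with (RtoC 0) by ring. Qed.

Lemma sin_IZR_PI (k : Z) : sin (IZR k * PI) = 0%R.
Proof. apply sin_eq_0_1. now exists k. Qed.

Lemma Int_expi (k : Z) : k <> 0%Z -> Int (fun x => expi (IZR k * x)) 0.
Proof.
  intros Hk. assert (HK : IZR k <> 0%R) by now apply not_0_IZR.
  apply (is_RInt_fct_extend_pair (U := R_NormedModule) (V := R_NormedModule)
           (fun x => expi (IZR k * x))).
  - simpl. evar_last.
    + apply (is_RInt_derive (fun x => sin (IZR k * x) / IZR k)%R).
      * intros x _. auto_derive; [easy | field; easy].
      * intros x _. apply continuity_pt_filterlim.
        apply derivable_continuous_pt. apply ex_derive_Reals_0. auto_derive. easy.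
    + unfold minus, plus, opp; simpl.
      replace (IZR k * - PI)%R with (- (IZR k * PI))%R by ring.
      rewrite sin_neg, sin_IZR_PI. field. easy.
  - simpl. evar_last.
    + apply (is_RInt_derive (fun x => - cos (IZR k * x) / IZR k)%R).
      * intros x _. auto_derive; [easy | field; easy].
      * intros x _. apply continuity_pt_filterlim.
        apply derivable_continuous_pt. apply ex_derive_Reals_0. auto_derive. easy.
    + unfold minus, plus, opp; simpl.
      replace (IZR k * - PI)%R with (- (IZR k * PI))%R by ring.
      rewrite cos_neg. ring.
Qed.

(** * Uniform limits of trigonometric polynomials with a parameter *)

Lemma Int_diff (f g : R -> C) (u v : C) (eps : R) :
  Int f u -> Int g v -> (forall x, Cmod (f x - g x) <= eps)%R ->
  (Cmod (u - v) <= 2 * PI * eps)%R.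
Proof.
  intros Hf Hg H. replace (u - v) with (u + -(1) * v) by ring.
  apply (Int_bound (fun x => f x + -(1) * g x)).
  - apply Int_plus; [easy | ]. now apply Int_scal.
  - intros x. now replace (f x + -(1) * g x) with (f x - g x) by ring.
Qed.

Lemma inv_INR_small (eps : R) : (0 < eps)%R ->
  exists N, forall n, (N <= n)%nat -> (/ (INR n + 1) <= eps)%R.
Proof.
  intros He. exists (Z.to_nat (up (/ eps))). intros n Hn.
  assert (0 < / eps)%R by now apply Rinv_0_lt_compat.
  destruct (archimed (/ eps)) as [Hup _].
  apply le_INR in Hn. rewrite INR_IZR_INZ, Z2Nat.id in Hn.
  2:{ apply le_IZR. lra. }
  rewrite <- (Rinv_inv eps). apply Rinv_le_contravar; lra.
Qed.

(** Integrability as a by-product of uniform approximation: approximants with error at most 1/(n+1)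
    are chosen and [Int_lim] is applied. No continuity of infinite products has to be discussed. *)
Lemma Int_approx (f : R -> C) :
  (forall eps, (0 < eps)%R ->
     exists g v, Int g v /\ forall x, (Cmod (g x - f x) <= eps)%R) ->
  exists w, Int f w.
Proof.
  intros H.
  assert (Hn : forall n : nat, exists gv : (R -> C) * C, Int (fst gv) (snd gv) /\
             forall x, (Cmod (fst gv x - f x) <= / (INR n + 1))%R).
  { intros n. destruct (H (/ (INR n + 1))%R) as [g [v Hgv]].
    { apply Rinv_0_lt_compat. generalize (pos_INR n). lra. }
    now exists (g, v). }
  pose (s := fun n => constructive_indefinite_description _ (Hn n)).
  destruct (Int_lim (fun n => fst (proj1_sig (s n))) f (fun n => snd (proj1_sig (s n))))
    as [w [Hw _]].
  - intros n. apply (proj2_sig (s n)).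
  - intros eps He. destruct (inv_INR_small eps He) as [N HN].
    exists N. intros n Hn' x. eapply Rle_trans; [apply (proj2_sig (s n)) | ].
    now apply HN.
  - now exists w.
Qed.

(** * Polynomials as coefficient lists, lowest degree first *)

Fixpoint peval (l : list C) (b : C) : C :=
  match l with nil => 0 | c :: l' => c + b * peval l' b end.

Fixpoint padd (l m : list C) : list C :=
  match l, m with
  | nil, _ => m
  | _, nil => l
  | c :: l', d :: m' => (c + d) :: padd l' m'
  end.

Lemma peval_padd (l m : list C) (b : C) : peval (padd l m) b = peval l b + peval m b.
Proof.
  revert m. induction l as [ | c l IH]; intros [ | d m]; simpl; try ring.
  rewrite IH. ring.
Qed.

Lemma psum_S_l (u : nat -> C) (n : nat) : psum u (S n) = u O + psum (fun k => u (S k)) n.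
Proof.
  induction n as [ | n IH]; [simpl; ring | ].
  change (psum u (S (S n))) with (psum u (S n) + u (S n)). rewrite IH. simpl. ring.
Qed.

Lemma peval_psum (l : list C) (b : C) (n : nat) : (length l <= n)%nat ->
  psum (fun j => nth j l 0 * b ^ j) n = peval l b.
Proof.
  revert n. induction l as [ | c l IH]; intros n Hn.
  - simpl. clear Hn. induction n as [ | n IHn]; simpl; [easy | ].
    rewrite IHn. destruct n; ring.
  - destruct n as [ | n]; [simpl in Hn; lia | ].
    rewrite psum_S_l. simpl peval. rewrite <- (IH n) by (simpl in Hn; lia).
    rewrite <- psum_scal. f_equal; [simpl; ring | ].
    apply psum_ext. intros k _. simpl. ring.
Qed.

Section Disc.
Context (rho : R) (Hrho : (0 < rho < 1)%R).

(* One class serves both variables: integration over the first one turns its elements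
   into uniform limits of polynomials in the second one ([ulimpoly_Int]). *)
Inductive trigpoly : (R -> C -> C) -> Prop :=
| tp_const k : trigpoly (fun _ _ => k)
| tp_add f g : trigpoly f -> trigpoly g -> trigpoly (fun t b => f t b + g t b)
| tp_expi f : trigpoly f -> trigpoly (fun t b => expi t * f t b)
| tp_expi_opp f : trigpoly f -> trigpoly (fun t b => expi (- t) * f t b)
| tp_var f : trigpoly f -> trigpoly (fun t b => b * f t b)
| tp_ext f g : (forall t b, f t b = g t b) -> trigpoly f -> trigpoly g.

(** Induction on the left factor. Its constant case needs the inner induction [Hs], as no
    constructor multiplies by a scalar. *)
Lemma tp_mul (f g : R -> C -> C) : trigpoly f -> trigpoly g ->
  trigpoly (fun t b => f t b * g t b).
Proof.
  intros Hf Hg. revert f Hf.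
  assert (Hs : forall k g, trigpoly g -> trigpoly (fun t b => k * g t b)).
  { clear g Hg. intros k g Hg. induction Hg as [l | f g _ IHf _ IHg | f _ IH | f _ IH | f _ IH | f g E _ IH].
    - apply tp_ext with (fun _ _ => k * l); [easy | apply tp_const].
    - eapply tp_ext; [ | exact (tp_add _ _ IHf IHg)]. intros; simpl; ring.
    - eapply tp_ext; [ | exact (tp_expi _ IH)]. intros; simpl; ring.
    - eapply tp_ext; [ | exact (tp_expi_opp _ IH)]. intros; simpl; ring.
    - eapply tp_ext; [ | exact (tp_var _ IH)]. intros; simpl; ring.
    - eapply tp_ext; [ | exact IH]. intros; simpl. now rewrite E. }
  intros f Hf. induction Hf as [l | f h _ IHf _ IHg | f _ IH | f _ IH | f _ IH | f h E _ IH].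
  - now apply Hs.
  - eapply tp_ext; [ | exact (tp_add _ _ IHf IHg)]. intros; simpl; ring.
  - eapply tp_ext; [ | exact (tp_expi _ IH)]. intros; simpl; ring.
  - eapply tp_ext; [ | exact (tp_expi_opp _ IH)]. intros; simpl; ring.
  - eapply tp_ext; [ | exact (tp_var _ IH)]. intros; simpl; ring.
  - eapply tp_ext; [ | exact IH]. intros; simpl. now rewrite E.
Qed.

Definition bounded (f : R -> C -> C) (B : R) : Prop :=
  forall t b, (Cmod b <= rho)%R -> (Cmod (f t b) <= B)%R.

Lemma bounded_nonneg (f : R -> C -> C) (B : R) : bounded f B -> (0 <= B)%R.
Proof.
  intros H. apply Rle_trans with (2 := H 0%R 0 ltac:(rewrite Cmod_0; lra)).
  apply Cmod_ge_0.
Qed.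

Lemma tp_bounded (f : R -> C -> C) : trigpoly f -> exists B, bounded f B.
Proof.
  intros Hf. induction Hf as [l | f g _ [A IHf] _ [B IHg] | f _ [B IH] | f _ [B IH] | f _ [B IH] | f g E _ [B IH]].
  - exists (Cmod l). intros t b _. lra.
  - exists (A + B)%R. intros t b Hb. eapply Rle_trans; [apply Cmod_triangle | ].
    apply Rplus_le_compat; auto.
  - exists B. intros t b Hb. rewrite Cmod_mult, Cmod_expi, Rmult_1_l. auto.
  - exists B. intros t b Hb. rewrite Cmod_mult, Cmod_expi, Rmult_1_l. auto.
  - exists (rho * B)%R. intros t b Hb. apply Cmod_mult_le; auto.
  - exists B. intros t b Hb. rewrite <- E. auto.
Qed.

Definition ulim (f : R -> C -> C) : Prop :=
  forall eps, (0 < eps)%R -> exists p, trigpoly p /\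
  forall t b, (Cmod b <= rho)%R -> (Cmod (f t b - p t b) <= eps)%R.

Lemma ulim_lim (f : R -> C -> C) :
  (forall eps, (0 < eps)%R -> exists g, ulim g /\
     forall t b, (Cmod b <= rho)%R -> (Cmod (f t b - g t b) <= eps)%R) -> ulim f.
Proof.
  intros H eps He. destruct (H (eps / 2)%R) as [g [Hg1 Hg2]]; [lra | ].
  destruct (Hg1 (eps / 2)%R) as [p [Hp1 Hp2]]; [lra | ].
  exists p. split; [easy | ]. intros t b Hb.
  generalize (Cmod_triangle_minus (f t b) (g t b) (p t b)) (Hg2 t b Hb) (Hp2 t b Hb).
  lra.
Qed.

Lemma ulim_ext (f g : R -> C -> C) :
  (forall t b, (Cmod b <= rho)%R -> f t b = g t b) -> ulim f -> ulim g.
Proof.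
  intros E H eps He. destruct (H eps He) as [p [Hp1 Hp2]]. exists p.
  split; [easy | ]. intros t b Hb. rewrite <- E; auto.
Qed.

Lemma ulim_tp (f : R -> C -> C) : trigpoly f -> ulim f.
Proof.
  intros Hf eps He. exists f. split; [easy | ]. intros t b _.
  replace (f t b - f t b) with (RtoC 0) by ring. rewrite Cmod_0. lra.
Qed.

Lemma ulim_const (k : C) : ulim (fun _ _ => k).
Proof. apply ulim_tp, tp_const. Qed.

Lemma ulim_expi : ulim (fun t _ => expi t).
Proof.
  apply ulim_tp. eapply tp_ext; [ | exact (tp_expi _ (tp_const 1))].
  intros; simpl; ring.
Qed.

Lemma ulim_expi_opp : ulim (fun t _ => expi (- t)).
Proof.
  apply ulim_tp. eapply tp_ext; [ | exact (tp_expi_opp _ (tp_const 1))].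
  intros; simpl; ring.
Qed.

Lemma ulim_var : ulim (fun _ b => b).
Proof.
  apply ulim_tp. eapply tp_ext; [ | exact (tp_var _ (tp_const 1))].
  intros; simpl; ring.
Qed.

Lemma ulim_add (f g : R -> C -> C) : ulim f -> ulim g -> ulim (fun t b => f t b + g t b).
Proof.
  intros Hf Hg eps He.
  destruct (Hf (eps / 2)%R) as [p [Hp1 Hp2]]; [lra | ].
  destruct (Hg (eps / 2)%R) as [r [Hr1 Hr2]]; [lra | ].
  exists (fun t b => p t b + r t b). split; [now apply tp_add | ].
  intros t b Hb.
  replace (f t b + g t b - (p t b + r t b)) with ((f t b - p t b) + (g t b - r t b)) by ring.
  eapply Rle_trans; [apply Cmod_triangle | ].
  specialize (Hp2 t b Hb). specialize (Hr2 t b Hb). lra.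
Qed.

Lemma ulim_bounded (f : R -> C -> C) : ulim f -> exists B, bounded f B.
Proof.
  intros H. destruct (H 1%R) as [p [Hp1 Hp2]]; [lra | ].
  destruct (tp_bounded p Hp1) as [B HB]. exists (1 + B)%R. intros t b Hb.
  replace (f t b) with ((f t b - p t b) + p t b) by ring.
  eapply Rle_trans; [apply Cmod_triangle | ]. apply Rplus_le_compat; auto.
Qed.

Lemma ulim_mul (f g : R -> C -> C) : ulim f -> ulim g -> ulim (fun t b => f t b * g t b).
Proof.
  intros Hf Hg eps He.
  destruct (ulim_bounded f Hf) as [A HA]. assert (HA0 := bounded_nonneg _ _ HA).
  destruct (Hg (eps / (2 * (A + 1)))%R) as [r [Hr1 Hr2]].
  { apply Rdiv_lt_0_compat; lra. }
  destruct (tp_bounded r Hr1) as [B HB]. assert (HB0 := bounded_nonneg _ _ HB).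
  destruct (Hf (eps / (2 * (B + 1)))%R) as [p [Hp1 Hp2]].
  { apply Rdiv_lt_0_compat; lra. }
  exists (fun t b => p t b * r t b). split; [now apply tp_mul | ].
  intros t b Hb.
  replace (f t b * g t b - p t b * r t b)
    with (f t b * (g t b - r t b) + r t b * (f t b - p t b)) by ring.
  eapply Rle_trans; [apply Cmod_triangle | ].
  assert (H1 := Cmod_mult_le _ _ _ _ (HA t b Hb) (Hr2 t b Hb)).
  assert (H2 := Cmod_mult_le _ _ _ _ (HB t b Hb) (Hp2 t b Hb)).
  assert (L : forall D, (0 <= D)%R -> (D * (eps / (2 * (D + 1))) <= eps / 2)%R).
  { intros D HD. apply Rmult_le_reg_r with (D + 1)%R; [lra | ].
    replace (D * (eps / (2 * (D + 1))) * (D + 1))%R with (D * (eps / 2))%R by (field; lra).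
    nra. }
  generalize (L A HA0) (L B HB0). lra.
Qed.

Lemma ulim_scal (k : C) (f : R -> C -> C) : ulim f -> ulim (fun t b => k * f t b).
Proof. intros Hf. apply (ulim_mul (fun _ _ => k)); [apply ulim_const | easy]. Qed.

Lemma ulim_minus (f g : R -> C -> C) : ulim f -> ulim g -> ulim (fun t b => f t b - g t b).
Proof.
  intros Hf Hg. eapply ulim_ext; [ | exact (ulim_add _ _ Hf (ulim_scal (-(1)) _ Hg))].
  intros t b _. simpl. ring.
Qed.

Lemma ulim_pow (f : R -> C -> C) (n : nat) : ulim f -> ulim (fun t b => f t b ^ n).
Proof.
  intros Hf. induction n as [ | n IH]; simpl; [apply ulim_const | ].
  now apply ulim_mul.
Qed.

Lemma ulim_psum (u : nat -> R -> C -> C) (n : nat) : (forall k, ulim (u k)) ->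
  ulim (fun t b => psum (fun k => u k t b) n).
Proof.
  intros H. induction n as [ | n IH]; simpl; [apply ulim_const | ].
  now apply ulim_add.
Qed.

Lemma ulim_series (u : nat -> R -> C -> C) (f : R -> C -> C) (M : nat -> R) :
  (forall k, ulim (u k)) -> summable M ->
  (forall k t b, (Cmod b <= rho)%R -> (Cmod (u k t b) <= M k)%R) ->
  (forall t b, (Cmod b <= rho)%R -> csums (fun k => u k t b) (f t b)) -> ulim f.
Proof.
  intros Hu HM HB Hf. apply ulim_lim. intros eps He.
  destruct (dominated_uniform M HM eps He) as [N HN].
  exists (fun t b => psum (fun k => u k t b) N). split; [now apply ulim_psum | ].
  intros t b Hb. apply HN; auto.
Qed.

Lemma ulim_qpoch (q : R) (f : R -> C -> C) (n : nat) : ulim f ->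
  ulim (fun t b => qpoch (f t b) q n).
Proof.
  intros Hf. induction n as [ | n IH]; simpl; [apply ulim_const | ].
  apply ulim_mul; [easy | ]. apply ulim_minus; [apply ulim_const | ].
  apply (ulim_mul f); [easy | apply ulim_const].
Qed.

Lemma ulim_qinf (q : R) (f : R -> C -> C) : (0 < q < 1)%R -> ulim f -> bounded f 1 ->
  ulim (fun t b => qpoch_inf (f t b) q).
Proof.
  intros Hq Hf HB.
  apply ulim_series with (2 := summable_Ec q Hq) (u := fun n t b => Ec q n * f t b ^ n).
  - intros k. now apply ulim_scal, ulim_pow.
  - intros k t b Hb. apply Ec_bound; [easy | ]. now apply HB.
  - intros t b Hb. apply qinf_series; [easy | ]. now apply HB.
Qed.

Lemma ulim_inv_qinf (q : R) (f : R -> C -> C) (A : R) :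
  (0 < q < 1)%R -> (A < 1)%R -> ulim f -> bounded f A ->
  ulim (fun t b => / qpoch_inf (f t b) q).
Proof.
  intros Hq HA Hf HB. assert (HA0 := bounded_nonneg _ _ HB).
  apply ulim_series with (u := fun n t b => Fc q n * f t b ^ n)
    (M := fun n => (lower_bound_qpoch q q * A ^ n)%R).
  - intros k. now apply ulim_scal, ulim_pow.
  - apply summable_geom; [lra | ]. left. apply lower_bound_pos.
  - intros k t b Hb. apply Fc_bound; [easy | ]. now apply HB.
  - intros t b Hb. apply inv_qinf_series; [easy | ].
    generalize (HB t b Hb). lra.
Qed.

(** As (x;q)_n is the quotient of (x;q)_oo by (x q^n;q)_oo, its reciprocal is a product of two
    limits already available. *)
Lemma ulim_inv_qpoch (q : R) (f : R -> C -> C) (A : R) (n : nat) :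
  (0 < q < 1)%R -> (A < 1)%R -> ulim f -> bounded f A ->
  ulim (fun t b => / qpoch (f t b) q n).
Proof.
  intros Hq HA Hf HB.
  assert (HB1 : bounded (fun t b => f t b * q ^ n) 1).
  { intros t b Hb. specialize (HB t b Hb).
    generalize (Cmod_mul_qpow_le q Hq (f t b) n). lra. }
  eapply ulim_ext; [ | exact (ulim_mul _ _ (ulim_inv_qinf q f A Hq HA Hf HB)
    (ulim_qinf q (fun t b => f t b * q ^ n) Hq
       (ulim_mul _ _ Hf (ulim_const _)) HB1))].
  intros t b Hb. simpl. specialize (HB t b Hb).
  rewrite (qinf_split q Hq (f t b) n) by lra. field. split.
  - apply qpoch_neq_0; [easy | lra].
  - apply qinf_neq_0; [easy | ]. generalize (Cmod_mul_qpow_le q Hq (f t b) n). lra.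
Qed.

(** The frequency [k] is general because the constructors [tp_expi] and [tp_expi_opp] shift it by
    one; only k = 0 is wanted in the end. *)
Lemma tp_Int (p : R -> C -> C) : trigpoly p -> forall k : Z, exists l, forall b,
  Int (fun t => expi (IZR k * t) * p t b) (peval l b).
Proof.
  intros Hp. induction Hp as [c | f g _ IHf _ IHg | f _ IH | f _ IH | f _ IH | f g E _ IH];
    intros k.
  - destruct (Z.eq_dec k 0) as [-> | Hk].
    + exists (cons (2 * PI * c) nil). intros b. simpl.
      replace (2 * PI * c + b * 0) with (2 * PI * c) by ring.
      eapply Int_ext; [ | apply Int_const]. intros x. simpl.
      rewrite Rmult_0_l, expi_0. ring.
    + exists nil. intros b. simpl. replace (RtoC 0) with (c * 0) by ring.
      eapply Int_ext; [ | exact (Int_scal c _ _ (Int_expi k Hk))].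
      intros x. simpl. ring.
  - destruct (IHf k) as [l Hl]. destruct (IHg k) as [m Hm].
    exists (padd l m). intros b. rewrite peval_padd.
    eapply Int_ext; [ | exact (Int_plus _ _ _ _ (Hl b) (Hm b))].
    intros x. simpl. ring.
  - destruct (IH (k + 1)%Z) as [l Hl]. exists l. intros b.
    eapply Int_ext; [ | exact (Hl b)]. intros x. simpl.
    rewrite Cmult_assoc, <- expi_add, plus_IZR. do 2 f_equal. ring.
  - destruct (IH (k - 1)%Z) as [l Hl]. exists l. intros b.
    eapply Int_ext; [ | exact (Hl b)]. intros x. simpl.
    rewrite Cmult_assoc, <- expi_add, minus_IZR. do 2 f_equal. ring.
  - destruct (IH k) as [l Hl]. exists (cons (RtoC 0) l). intros b. simpl.
    rewrite Cplus_0_l. eapply Int_ext; [ | exact (Int_scal b _ _ (Hl b))].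
    intros x. simpl. ring.
  - destruct (IH k) as [l Hl]. exists l. intros b.
    eapply Int_ext; [ | exact (Hl b)]. intros x. simpl. now rewrite E.
Qed.

Lemma tp_Int_0 (p : R -> C -> C) : trigpoly p -> exists l, forall b,
  Int (fun t => p t b) (peval l b).
Proof.
  intros Hp. destruct (tp_Int p Hp 0) as [l Hl]. exists l. intros b.
  eapply Int_ext; [ | exact (Hl b)]. intros x. simpl.
  rewrite Rmult_0_l, expi_0. ring.
Qed.

Lemma ulim_Int (f : R -> C -> C) (b : C) : ulim f -> (Cmod b <= rho)%R ->
  exists v, Int (fun t => f t b) v.
Proof.
  intros Hf Hb. apply Int_approx. intros eps He.
  destruct (Hf eps He) as [p [Hp1 Hp2]]. destruct (tp_Int_0 p Hp1) as [l Hl].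
  exists (fun t => p t b), (peval l b). split; [apply Hl | ].
  intros x. rewrite Cmod_minus_sym. auto.
Qed.

(** * Taylor expansion of uniform limits of polynomials *)

Definition ulimpoly (g : C -> C) : Prop :=
  forall eps, (0 < eps)%R -> exists l, forall b, (Cmod b <= rho)%R ->
  (Cmod (g b - peval l b) <= eps)%R.

Lemma ulimpoly_Int (f : R -> C -> C) (g : C -> C) : ulim f ->
  (forall b, (Cmod b <= rho)%R -> Int (fun t => f t b) (g b)) -> ulimpoly g.
Proof.
  intros Hf Hg eps He. assert (HPI := PI_RGT_0).
  destruct (Hf (eps / (2 * PI))%R) as [p [Hp1 Hp2]].
  { apply Rdiv_lt_0_compat; lra. }
  destruct (tp_Int_0 p Hp1) as [l Hl]. exists l. intros b Hb.
  replace eps with (2 * PI * (eps / (2 * PI)))%R by (field; lra).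
  apply Int_diff with (1 := Hg b Hb) (2 := Hl b). auto.
Qed.

(** Cauchy's coefficient formula on the circle of radius [rho]. The vanishing at positive
    frequencies is proved along with it: prepending a coefficient multiplies the old polynomial by
    rho e^{it}, so the new case m = 0 calls on frequency 1 of the old one. *)
Lemma Int_peval (l : list C) :
  (forall m, Int (fun t => expi (- INR m * t) * peval l (rho * expi t))
                 (2 * PI * nth m l 0 * rho ^ m)) /\
  (forall m, Int (fun t => expi (INR (S m) * t) * peval l (rho * expi t)) 0).
Proof.
  assert (Z0 : forall m, Int (fun t => expi (INR (S m) * t)) 0).
  { intros m. rewrite INR_IZR_INZ. apply Int_expi. lia. }
  assert (Z1 : forall m, Int (fun t => expi (- INR (S m) * t)) 0).
  { intros m. rewrite INR_IZR_INZ, <- opp_IZR. apply Int_expi. lia. }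
  induction l as [ | c l [IH1 IH2]]; split; intros m.
  - assert (E : 2 * PI * nth m (@nil C) 0 * rho ^ m = 2 * PI * 0) by (destruct m; simpl; ring).
    rewrite E.
    eapply Int_ext; [ | exact (Int_const 0)]. intros x. cbv beta. simpl peval. ring.
  - replace (RtoC 0) with (2 * PI * 0) by ring.
    eapply Int_ext; [ | exact (Int_const 0)]. intros x. cbv beta. simpl peval. ring.
  - destruct m as [ | m].
    + replace (2 * PI * nth 0 (c :: l) 0 * rho ^ 0) with (2 * PI * c + rho * 0)
        by (simpl nth; simpl Cpow; ring).
      eapply Int_ext; [ | exact (Int_plus _ _ _ _ (Int_const c) (Int_scal rho _ _ (IH2 O)))].
      intros x. simpl. replace (- 0 * x)%R with 0%R by ring. rewrite expi_0, Rmult_1_l. ring.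
    + replace (2 * PI * nth (S m) (c :: l) 0 * rho ^ S m)
        with (c * 0 + rho * (2 * PI * nth m l 0 * rho ^ m)) by (simpl nth; rewrite Cpow_S; ring).
      eapply Int_ext; [ | exact (Int_plus _ _ _ _ (Int_scal c _ _ (Z1 m)) (Int_scal rho _ _ (IH1 m)))].
      intros x. cbv beta. simpl peval.
      replace (- INR m * x)%R with (- INR (S m) * x + x)%R by (rewrite S_INR; ring).
      rewrite expi_add. ring.
  - replace (RtoC 0) with (c * 0 + rho * 0) by ring.
    eapply Int_ext; [ | exact (Int_plus _ _ _ _ (Int_scal c _ _ (Z0 m)) (Int_scal rho _ _ (IH2 (S m))))].
    intros x. cbv beta. simpl peval.
    replace (INR (S (S m)) * x)%R with (INR (S m) * x + x)%R by (rewrite (S_INR (S m)); ring).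
    rewrite expi_add. ring.
Qed.

Lemma Cmod_circle (t : R) : Cmod (rho * expi t) = rho.
Proof. rewrite Cmod_mult, Cmod_expi, Cmod_R, Rabs_pos_eq; lra. Qed.

Lemma rho_pow_neq_0 (m : nat) : RtoC rho ^ m <> 0.
Proof. apply Cpow_nz. intros E. apply RtoC_inj in E. lra. Qed.

Lemma C_2PI_neq_0 : 2 * PI <> 0.
Proof.
  rewrite <- RtoC_mult. intros E. apply RtoC_inj in E. generalize PI_RGT_0. lra.
Qed.

Lemma Cmod_2PI : Cmod (2 * PI) = (2 * PI)%R.
Proof.
  rewrite <- RtoC_mult, Cmod_R. apply Rabs_pos_eq. generalize PI_RGT_0. lra.
Qed.

Lemma Cmod_rho_pow (m : nat) : Cmod (rho ^ m) = (rho ^ m)%R.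
Proof. rewrite Cmod_pow, Cmod_R, Rabs_pos_eq; lra. Qed.

(** The Cauchy integral exists because polynomials approximate the integrand uniformly; the factor
    [2 * PI] and the power of [rho] make [c] the m-th Taylor coefficient. *)
Lemma ulimpoly_coef (g : C -> C) (m : nat) : ulimpoly g ->
  exists c, Int (fun t => expi (- INR m * t) * g (rho * expi t)) (2 * PI * c * rho ^ m).
Proof.
  intros Hg.
  destruct (Int_approx (fun t => expi (- INR m * t) * g (rho * expi t))) as [w Hw].
  - intros eps He. destruct (Hg eps He) as [l Hl].
    exists (fun t => expi (- INR m * t) * peval l (rho * expi t)),
      (2 * PI * nth m l 0 * rho ^ m). split; [exact (proj1 (Int_peval l) m) | ].
    intros x.
    replace (expi (- INR m * x) * peval l (rho * expi x) - expi (- INR m * x) * g (rho * expi x))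
      with (expi (- INR m * x) * - (g (rho * expi x) - peval l (rho * expi x))) by ring.
    rewrite Cmod_mult, Cmod_expi, Rmult_1_l, Cmod_opp. apply Hl.
    rewrite Cmod_circle. lra.
  - exists (w / (2 * PI * rho ^ m)).
    replace (2 * PI * (w / (2 * PI * rho ^ m)) * rho ^ m) with w; [easy | ].
    assert (HP := rho_pow_neq_0 m). assert (H2 := C_2PI_neq_0). set (p := 2 * PI) in *.
    field. now split.
Qed.

(** The first clause is the Cauchy estimate; it makes the series geometric with ratio |b|/rho inside
    the disc. *)
Definition taylor (g : C -> C) (c : nat -> C) (M : R) : Prop :=
  (forall j, Cmod (c j) * rho ^ j <= M)%R /\
  forall b, (Cmod b < rho)%R -> csums (fun j => c j * b ^ j) (g b).

Lemma coef_le (c : C) (j : nat) (M : R) (b : C) : (Cmod c * rho ^ j <= M)%R ->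
  (Cmod (c * b ^ j) <= M * (Cmod b / rho) ^ j)%R.
Proof.
  intros H. rewrite Cmod_mult, Cmod_pow. unfold Rdiv.
  rewrite Rpow_mult_distr, pow_inv.
  assert (Hp : (0 < rho ^ j)%R) by (apply pow_lt; lra).
  replace (Cmod c * Cmod b ^ j)%R with (Cmod c * rho ^ j * (Cmod b ^ j * / rho ^ j))%R
    by (field; lra).
  apply Rmult_le_compat_r; [ | easy]. apply Rmult_le_pos.
  - apply pow_le, Cmod_ge_0.
  - left. now apply Rinv_0_lt_compat.
Qed.

Lemma div_rho (b : C) : (Cmod b < rho)%R -> (0 <= Cmod b / rho < 1)%R.
Proof.
  intros Hb. split.
  - apply Rdiv_le_0_compat; [apply Cmod_ge_0 | lra].
  - apply Rmult_lt_reg_r with rho; [lra | ]. unfold Rdiv.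
    rewrite Rmult_assoc, Rinv_l by lra. lra.
Qed.

(** If a polynomial is uniformly eps-close to [g], its m-th coefficient is within eps/rho^m of the
    Cauchy coefficient of [g]. Inside the disc these errors sum geometrically, so the polynomial is
    close to the Taylor series as well as to [g]. *)
Lemma ulimpoly_taylor (g : C -> C) : ulimpoly g -> exists c M, taylor g c M.
Proof.
  intros Hg. assert (HPI := PI_RGT_0).
  assert (Hc := fun m => constructive_indefinite_description _ (ulimpoly_coef g m Hg)).
  pose (c := fun m => proj1_sig (Hc m)).
  assert (Hci : forall m, Int (fun t => expi (- INR m * t) * g (rho * expi t))
                              (2 * PI * c m * rho ^ m)) by (intros m; apply (proj2_sig (Hc m))).
  clearbody c. clear Hc.
  assert (Hd : forall l eps, (forall b, (Cmod b <= rho)%R -> (Cmod (g b - peval l b) <= eps)%R) ->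
    forall m, (Cmod (c m - nth m l 0) * rho ^ m <= eps)%R).
  { intros l eps Hl m.
    assert (H : (Cmod (2 * PI * c m * rho ^ m - 2 * PI * nth m l 0 * rho ^ m) <= 2 * PI * eps)%R).
    { apply Int_diff with (1 := Hci m) (2 := proj1 (Int_peval l) m). intros x.
      replace (expi (- INR m * x) * g (rho * expi x) - expi (- INR m * x) * peval l (rho * expi x))
        with (expi (- INR m * x) * (g (rho * expi x) - peval l (rho * expi x))) by ring.
      rewrite Cmod_mult, Cmod_expi, Rmult_1_l. apply Hl. rewrite Cmod_circle. lra. }
    replace (2 * PI * c m * rho ^ m - 2 * PI * nth m l 0 * rho ^ m)
      with (2 * PI * ((c m - nth m l 0) * rho ^ m)) in H by ring.
    rewrite Cmod_mult, Cmod_2PI, Cmod_mult, Cmod_rho_pow in H.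
    apply Rmult_le_reg_l with (2 * PI)%R; lra. }
  (* A single polynomial at distance 1 bounds all the coefficients, hence the constant [1 + M]. *)
  destruct (Hg 1%R) as [l1 Hl1]; [lra | ].
  assert (HM : exists M, forall m, (Cmod (nth m l1 0) * rho ^ m <= M)%R).
  { clear - Hrho. exists (fold_right (fun x y => Cmod x + y)%R 0%R l1). intros m.
    assert (0 <= rho ^ m <= 1)%R as Hp.
    { split; [apply pow_le; lra | ]. rewrite <- (pow1 m). apply pow_incr. lra. }
    assert (Cmod (nth m l1 0) <= fold_right (fun x y => Cmod x + y)%R 0%R l1)%R as Hn.
    { clear Hp. revert m. induction l1 as [ | x l IH]; intros m; simpl.
      - destruct m; rewrite Cmod_0; lra.
      - assert (0 <= fold_right (fun x y => Cmod x + y)%R 0%R l)%R.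
        { clear. induction l as [ | y l IH]; simpl; [lra | ]. generalize (Cmod_ge_0 y). lra. }
        destruct m as [ | m]; [lra | ]. generalize (IH m) (Cmod_ge_0 x). lra. }
    generalize (Cmod_ge_0 (nth m l1 0)). nra. }
  destruct HM as [M HM]. exists c, (1 + M)%R. split.
  - intros j. generalize (Hd l1 1%R Hl1 j) (HM j).
    assert (0 <= rho ^ j)%R by (apply pow_le; lra).
    generalize (Cmod_triangle (c j - nth j l1 0) (nth j l1 0)).
    replace (c j - nth j l1 0 + nth j l1 0) with (c j) by ring. nra.
  - intros b Hb eps He. assert (Hx := div_rho b Hb). set (x := (Cmod b / rho)%R) in *.
    (* The factor [1 - x] offsets the sum 1/(1-x) of the coefficient errors, so both contributions
       are at most [eps / 2]. *)
    destruct (Hg (eps / 2 * (1 - x))%R) as [l Hl]; [nra | ].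
    exists (length l). intros n Hn.
    replace (psum (fun j => c j * b ^ j) n - g b) with
      (psum (fun j => (c j - nth j l 0) * b ^ j) n - (g b - peval l b)).
    2:{ rewrite <- (peval_psum l b n Hn).
        replace (psum (fun j => (c j - nth j l 0) * b ^ j) n)
          with (psum (fun j => c j * b ^ j) n - psum (fun j => nth j l 0 * b ^ j) n); [ring | ].
        clear. induction n as [ | n IH]; simpl; [ring | ]. rewrite <- IH. ring. }
    unfold Cminus at 1. eapply Rle_trans; [apply Cmod_triangle | ]. rewrite Cmod_opp.
    specialize (Hd l _ Hl). specialize (Hl b ltac:(lra)).
    assert (H1 : (Cmod (psum (fun j => ((c j - nth j l 0) * b ^ j)%C) n) <= eps / 2)%R).
    { eapply Rle_trans.
      - apply (psum_bound _ (fun j => eps / 2 * (1 - x) * x ^ j)%R).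
        intros j. now apply coef_le.
      - eapply Rle_trans; [apply rsum_geom; [easy | nra] | ]. right. field. lra. }
    nra.
Qed.

Lemma csums_geom_tail (u : nat -> C) (l : C) (K x : R) (n : nat) :
  (0 <= x < 1)%R -> (0 <= K)%R -> (forall j, Cmod (u j) <= K * x ^ j)%R -> csums u l ->
  (Cmod (l - psum u n) <= K * x ^ n / (1 - x))%R.
Proof.
  intros Hx HK Hu Hl. apply climit_bound with (1 := Hl). exists n. intros m Hm.
  replace m with (n + (m - n))%nat by lia.
  eapply Rle_trans; [apply psum_diff_bound; exact Hu | ].
  assert (E : forall k, (rsum (fun k => K * x ^ k) (n + k) - rsum (fun k => K * x ^ k) n
     = K * x ^ n * ((1 - x ^ k) / (1 - x)))%R).
  { induction k as [ | k IH]; [rewrite Nat.add_0_r; simpl; field; lra | ].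
    rewrite Nat.add_succ_r. simpl.
    replace (rsum (fun k => K * x ^ k) (n + k) + K * x ^ (n + k) - rsum (fun k => K * x ^ k) n)%R
      with (rsum (fun k => K * x ^ k) (n + k) - rsum (fun k => K * x ^ k) n + K * x ^ (n + k))%R by ring.
    rewrite IH, pow_add. field. lra. }
  rewrite E. unfold Rdiv. rewrite <- Rmult_assoc.
  apply Rmult_le_compat_r; [left; apply Rinv_0_lt_compat; lra | ].
  assert (0 <= x ^ n)%R by (apply pow_le; lra).
  assert (0 <= x ^ (m - n))%R by (apply pow_le; lra).
  assert (0 <= K * x ^ n)%R by nra. nra.
Qed.

Lemma psum_leading (u : nat -> C) (m : nat) :
  (forall j, (j < m)%nat -> u j = 0) -> psum u (S m) = u m.
Proof.
  intros H. simpl. rewrite (psum_ext u (fun _ => 0) m H).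
  replace (psum (fun _ => 0) m) with (RtoC 0); [ring | ].
  clear. induction m as [ | m IH]; simpl; [easy | rewrite <- IH; ring].
Qed.

(** For |b| <= rho/2 the tail has ratio at most 1/2, whence the factor 2 in the witness; M/rho^(m+1)
    is the Cauchy bound on the first omitted coefficient. *)
Lemma taylor_leading (g : C -> C) (c : nat -> C) (M : R) (m : nat) : taylor g c M ->
  (forall j, (j < m)%nat -> c j = 0) ->
  exists K, (0 <= K)%R /\ forall b, (Cmod b <= rho / 2)%R ->
  (Cmod (g b - c m * b ^ m) <= K * Cmod b ^ S m)%R.
Proof.
  intros [H1 H2] H.
  assert (HM : (0 <= M)%R).
  { eapply Rle_trans; [ | apply (H1 O)]. simpl. rewrite Rmult_1_r. apply Cmod_ge_0. }
  assert (Hp : (0 < rho ^ S m)%R) by (apply pow_lt; lra).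
  exists (2 * M / rho ^ S m)%R. split; [apply Rdiv_le_0_compat; lra | ].
  intros b Hb. assert (Hb' : (Cmod b < rho)%R) by lra.
  assert (Hx := div_rho b Hb').
  rewrite <- (psum_leading (fun j => c j * b ^ j) m).
  2:{ intros j Hj. rewrite H by easy. ring. }
  eapply Rle_trans.
  - apply csums_geom_tail with (K := M) (x := (Cmod b / rho)%R); try easy.
    + intros j. apply coef_le, H1.
    + now apply H2.
  - assert (Hx2 : (Cmod b / rho <= 1 / 2)%R).
    { apply Rmult_le_reg_r with rho; [lra | ]. unfold Rdiv at 1.
      rewrite Rmult_assoc, Rinv_l by lra. lra. }
    apply Rle_trans with (M * (Cmod b / rho) ^ S m * 2)%R.
    + unfold Rdiv at 1. apply Rmult_le_compat_l.
      * apply Rmult_le_pos; [easy | ]. apply pow_le. lra.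
      * replace 2%R with (/ (1 / 2))%R by field. apply Rinv_le_contravar; lra.
    + unfold Rdiv. rewrite Rpow_mult_distr, pow_inv. right. field. lra.
Qed.

End Disc.

(** * Uniqueness for the functional equation *)

Lemma small_multiple_eq_0 (x : C) (K d : R) : (0 < d)%R ->
  (forall e, 0 < e <= d -> Cmod x <= K * e)%R -> x = 0.
Proof.
  intros Hd H. apply Cmod_eq_0.
  assert (H0 := Cmod_ge_0 x).
  destruct (Rle_lt_or_eq_dec _ _ H0) as [Hx | Hx]; [ | now symmetry].
  exfalso.
  assert (HK : (0 < K)%R) by (specialize (H d ltac:(lra)); nra).
  set (e := Rmin d (Cmod x / (2 * K))).
  assert (He : (0 < e <= d)%R).
  { unfold e. split; [ | apply Rmin_l]. apply Rmin_glb_lt; [easy | ].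
    apply Rdiv_lt_0_compat; lra. }
  specialize (H e He).
  assert (He2 : (K * e <= Cmod x / 2)%R).
  { replace (Cmod x / 2)%R with (K * (Cmod x / (2 * K)))%R by (field; lra).
    apply Rmult_le_compat_l; [lra | apply Rmin_r]. }
  lra.
Qed.

Lemma Cmod_plus_le (x y : C) (A B : R) :
  (Cmod x <= A)%R -> (Cmod y <= B)%R -> (Cmod (x + y) <= A + B)%R.
Proof. intros. eapply Rle_trans; [apply Cmod_triangle | ]. lra. Qed.

Section Uniqueness.
Context (q : R) (Hq : (0 < q < 1)%R) (rho : R) (Hrho : (0 < rho < 1)%R).

(* The lowest-order term c b^m of a solution satisfies r (q^m - 1) c = 0. *)
Lemma leading_coef_0 (D1 D2 : C -> C) (c1 c2 : nat -> C) (M1 M2 : R) (r : C) (m : nat) :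
  r <> 0 -> (Cmod r < 1)%R -> taylor rho D1 c1 M1 -> taylor rho D2 c2 M2 ->
  (forall b, (Cmod b <= rho)%R ->
     r * D1 (b * q) - b * D2 b = (r - b) * (1 - b * r) * D1 b) ->
  (forall j, (j < S m)%nat -> c1 j = 0) -> (forall j, (j < S m)%nat -> c2 j = 0) ->
  c1 (S m) = 0.
Proof.
  intros Hr Hr1 H1 H2 HF Hc1 Hc2.
  destruct (taylor_leading rho Hrho D1 c1 M1 (S m) H1 Hc1) as [K1 [HK1 HD1]].
  destruct (taylor_leading rho Hrho D2 c2 M2 m H2 (fun j Hj => Hc2 j (Nat.lt_lt_succ_r _ _ Hj)))
    as [K2 [HK2 HD2]].
  (* So [D2] is O(b^(m+1)), and the factor b in front of it in the equation makes its contribution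
     O(b^(m+2)), beyond the leading order m+1. *)
  rewrite (Hc2 m ltac:(lia)) in HD2.
  set (c := c1 (S m)) in *.
  assert (HL : r * (q ^ S m - 1) * c = 0).
  (* The equation is tested at real b = e > 0 and compared at order e^(m+1). The summands of [K]
     bound, in order, the remainders of D1 at e q, of D2 at e and of D1 at e, and the excess of
     (r-e)(1-er) over r in front of the leading term. *)
  { apply small_multiple_eq_0 with (K := (K1 + K2 + 4 * K1 + 3 * Cmod c)%R) (d := (rho / 2)%R);
      [lra | ].
    intros e He.
    assert (HCe : Cmod e = e) by (rewrite Cmod_R; apply Rabs_pos_eq; lra).
    assert (Hep : (0 < e ^ S m)%R) by (apply pow_lt; lra).
    apply Rmult_le_reg_r with (e ^ S m)%R; [easy | ].
    rewrite <- (Rabs_pos_eq (e ^ S m)) at 1 by lra.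
    rewrite <- Cmod_R, RtoC_pow, <- Cmod_mult.
    specialize (HF e ltac:(lra)).
    assert (E1 := HD1 (e * q) ltac:(generalize (Cmod_mul_q_le q Hq e); lra)).
    assert (E2 := HD1 e ltac:(lra)). assert (E3 := HD2 e ltac:(lra)).
    set (u := D1 (e * q) - c * (e * q) ^ S m) in *.
    set (v := D1 e - c * e ^ S m) in *.
    set (w := D2 e - 0 * e ^ m) in *.
    replace (r * (q ^ S m - 1) * c * e ^ S m)
      with (- (r * u) + e * w + (r - e) * (1 - e * r) * v
            + (- e * (1 + r * r) + e * e * r) * (c * e ^ S m)).
    2:{ assert (T : r * u + c * r * e ^ S m * q ^ S m - e * w = (r - e) * (1 - e * r) * (v + c * e ^ S m)).
        { transitivity (r * D1 (e * q) - e * D2 e).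
          - unfold u, w. rewrite Cpow_mult_l. ring.
          - rewrite HF. unfold v. ring. }
        transitivity (- (r * u + c * r * e ^ S m * q ^ S m - e * w) + (r - e) * (1 - e * r) * v
            + (- e * (1 + r * r) + e * e * r) * (c * e ^ S m) + c * r * e ^ S m * q ^ S m); [ring | ].
        rewrite T. ring. }
    assert (He1 : (e <= 1)%R) by lra.
    assert (Hr0 := Cmod_ge_0 r). assert (Hc0 := Cmod_ge_0 c).
    assert (B1 : (Cmod (- (r * u)) <= 1 * (K1 * e ^ S (S m)))%R).
    { rewrite Cmod_opp. apply Cmod_mult_le; [lra | ].
      eapply Rle_trans; [exact E1 | ]. apply Rmult_le_compat_l; [easy | ].
      apply pow_incr. split; [apply Cmod_ge_0 | ]. rewrite <- HCe at 2. now apply Cmod_mul_q_le. }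
    assert (B2 : (Cmod (e * w) <= e * (K2 * e ^ S m))%R).
    { apply Cmod_mult_le; [lra | ]. now rewrite HCe in E3. }
    assert (B3 : (Cmod ((r - e) * (1 - e * r) * v) <= (1 + 1) * (1 + 1 * 1) * (K1 * e ^ S (S m)))%R).
    { apply Cmod_mult_le; [ | now rewrite HCe in E2]. apply Cmod_mult_le.
      - apply Cmod_plus_le; [lra | ]. rewrite Cmod_opp. lra.
      - apply Cmod_plus_le; [rewrite Cmod_1; lra | ]. rewrite Cmod_opp.
        apply Cmod_mult_le; lra. }
    assert (B4 : (Cmod ((- e * (1 + r * r) + e * e * r) * (c * e ^ S m))
                  <= (e * (1 + 1 * 1) + e * 1 * 1) * (Cmod c * e ^ S m))%R).
    { apply Cmod_mult_le.
      - apply Cmod_plus_le; apply Cmod_mult_le.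
        + rewrite Cmod_opp. lra.
        + apply Cmod_plus_le; [rewrite Cmod_1; lra | ]. apply Cmod_mult_le; lra.
        + apply Cmod_mult_le; lra.
        + lra.
      - apply Cmod_mult_le; [lra | ]. rewrite Cmod_pow, HCe. lra. }
    eapply Rle_trans; [exact (Cmod_plus_le _ _ _ _ (Cmod_plus_le _ _ _ _ (Cmod_plus_le _ _ _ _ B1 B2) B3) B4) | ].
    simpl. right. ring. }
  destruct (Ceq_dec c 0) as [Hc | Hc]; [easy | exfalso].
  revert HL. apply Cmult_neq_0; [ | easy]. apply Cmult_neq_0; [easy | ].
  intros E. apply (one_minus_neq_0 (q ^ S m)); [now apply qpow_S_lt_1 | ].
  replace (1 - q ^ S m) with (- (q ^ S m - 1)) by ring. rewrite E. ring.
Qed.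

(** The induction on the order keeps [r] general: the equation at [r] brings in [D (r * q)], whose
    lower coefficients must already be known to vanish. *)
Lemma functional_equation_unique (D : C -> C -> C) :
  (forall r : C, r <> 0 -> (Cmod r < 1)%R -> ulimpoly rho (D r)) ->
  (forall r : C, r <> 0 -> (Cmod r < 1)%R -> D r 0 = 0) ->
  (forall r b : C, r <> 0 -> (Cmod r < 1)%R -> (Cmod b <= rho)%R ->
     r * D r (b * q) - b * D (r * q) b = (r - b) * (1 - b * r) * D r b) ->
  forall r b : C, r <> 0 -> (Cmod r < 1)%R -> (Cmod b < rho)%R -> D r b = 0.
Proof.
  intros HU H0 HF.
  assert (HC : forall m (r : C) c M, r <> 0 -> (Cmod r < 1)%R -> taylor rho (D r) c M ->
                 forall j, (j < S m)%nat -> c j = 0).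
  { induction m as [ | m IH]; intros r c M Hr Hr1 HT j Hj.
    - replace j with O by lia.
      rewrite <- (H0 r Hr Hr1).
      apply (csums_unique (fun j => c j * 0 ^ j)).
      + replace (c O) with (psum (fun j => c j * 0 ^ j) 1) by (simpl; ring).
        apply csums_finite. intros [ | n] Hn; [lia | ]. simpl. ring.
      + apply (proj2 HT). rewrite Cmod_0. lra.
    - destruct (Nat.eq_dec j (S m)) as [-> | Hne]; [ | apply (IH r c M); auto; lia].
      assert (Hrq : r * q <> 0) by exact (Cmult_neq_0 _ _ Hr (q_neq_0 q Hq)).
      assert (Hrq1 : (Cmod (r * q) < 1)%R).
      { generalize (Cmod_mul_q_le q Hq r). lra. }
      destruct (ulimpoly_taylor rho Hrho _ (HU (r * q) Hrq Hrq1)) as [c' [M' HT']].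
      apply (leading_coef_0 (D r) (D (r * q)) c c' M M' r m); auto.
      + intros k Hk. now apply (IH r c M).
      + intros k Hk. now apply (IH (r * q) c' M'). }
  intros r b Hr Hr1 Hb.
  destruct (ulimpoly_taylor rho Hrho _ (HU r Hr Hr1)) as [c [M HT]].
  apply (csums_unique (fun j => c j * b ^ j)); [now apply (proj2 HT) | ].
  apply (csums_finite _ 0). intros n _. rewrite (HC n r c M) by (auto; lia). ring.
Qed.

End Uniqueness.

(** * The very-well-poised series *)

Section VeryWellPoised.
Context (q : R) (Hq : (0 < q < 1)%R).

(* [vwp k n = (1 - A q^(2n)) (A;q)_n / (1 - A)] with [A = k / q], in a form which
   makes sense also for [A = 1]. *)
Definition vwp (k : C) (n : nat) : C :=
  match n with O => 1 | S m => (1 - k * q ^ (2 * m + 1)) * qpoch k q m end.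

(** This is alpha q for the alpha of the theorem. With parameters in the open unit disc it has
    modulus below 1, so dividing by 1 - [kap] is safe. *)
Definition kap (a b c d r : C) : C := a * a * b * c * d * r.

(** The factor [w] is left free so that the same bounds and symmetries serve the series and the
    second half of the certificate, where [w] is a plain q-shifted factorial. *)
Definition weighted_term (w a b c d r : C) (n : nat) : C :=
  w * (qpoch (a * b) q n * qpoch (a * c) q n * qpoch (a * d) q n * qpoch (a * r) q n)
  * / (qpoch q q n * qpoch (a * b * c * d) q n * qpoch (a * b * c * r) q n
       * qpoch (a * b * d * r) q n * qpoch (a * c * d * r) q n)
  * (- (b * c * d * r)) ^ n * q ^ tri n.

Definition vwp_term (a b c d r : C) (n : nat) : C :=
  weighted_term (vwp (kap a b c d r) n) a b c d r n.

Definition vwp_sum (a b c d r : C) : C := CSeries (vwp_term a b c d r).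

Definition prefac (a b c d r : C) : C :=
  qpoch_inf (a * b * c * d) q * qpoch_inf (a * b * c * r) q
  * qpoch_inf (a * b * d * r) q * qpoch_inf (a * c * d * r) q
  * / (qpoch_inf q q * qpoch_inf (a * b) q * qpoch_inf (a * c) q * qpoch_inf (a * d) q
       * qpoch_inf (a * r) q * qpoch_inf (b * c) q * qpoch_inf (b * d) q
       * qpoch_inf (b * r) q * qpoch_inf (c * d) q * qpoch_inf (c * r) q
       * qpoch_inf (d * r) q * qpoch_inf (kap a b c d r) q).

Definition in_disc (A : R) (x : C) : Prop := (Cmod x <= A)%R.

Lemma in_disc_mul (A : R) (x y : C) : (0 <= A <= 1)%R ->
  in_disc A x -> in_disc 1 y -> in_disc A (x * y).
Proof.
  unfold in_disc. intros HA Hx Hy. replace A with (A * 1)%R by ring.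
  now apply Cmod_mult_le.
Qed.

Lemma in_disc_weaken (A : R) (x : C) : (A <= 1)%R -> in_disc A x -> in_disc 1 x.
Proof. unfold in_disc. lra. Qed.

Lemma vwp_bound (k : C) (n : nat) : in_disc 1 k ->
  (Cmod (vwp k n) <= 2 * upper_bound_qpoch q 1)%R.
Proof.
  intros Hk. assert (H1 : (1 <= upper_bound_qpoch q 1)%R).
  { generalize (qpoch_bound q Hq 0 1 0). simpl. rewrite Cmod_0, Cmod_1. intros H. apply H. lra. }
  destruct n as [ | m]; simpl vwp.
  - rewrite Cmod_1. lra.
  - apply Cmod_mult_le.
    + unfold Cminus. eapply Rle_trans; [apply Cmod_triangle | ].
      rewrite Cmod_1, Cmod_opp.
      generalize (Cmod_mul_qpow_le q Hq k (m + (m + 0) + 1)). unfold in_disc in Hk. lra.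
    + now apply qpoch_bound.
Qed.

Lemma Cmod_inv_mult_le (x y : C) (A B : R) : x <> 0 -> y <> 0 ->
  (Cmod (/ x) <= A)%R -> (Cmod (/ y) <= B)%R -> (Cmod (/ (x * y)) <= A * B)%R.
Proof.
  intros Hx Hy HA HB. replace (/ (x * y)) with (/ x * / y) by (field; auto).
  now apply Cmod_mult_le.
Qed.

Definition weighted_bound (A : R) : R :=
  (2 * upper_bound_qpoch q 1
   * (upper_bound_qpoch q 1 * upper_bound_qpoch q 1 * upper_bound_qpoch q 1 * upper_bound_qpoch q 1)
   * (lower_bound_qpoch q q * lower_bound_qpoch q A * lower_bound_qpoch q A
      * lower_bound_qpoch q A * lower_bound_qpoch q A))%R.

Lemma weighted_bound_pos (A : R) : (0 < weighted_bound A)%R.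
Proof.
  unfold weighted_bound.
  assert (H1 := upper_bound_pos q 1). assert (H2 := lower_bound_pos q q).
  assert (H3 := lower_bound_pos q A). repeat (apply Rmult_lt_0_compat; try lra).
Qed.

(** The q-shifted factorials and their reciprocals are bounded uniformly in [n]; all decay is drawn
    from the power of b c d r, with q^(n(n-1)/2) estimated by 1. The bound assumed on [w] is that of
    [vwp_bound]. *)
Lemma weighted_term_bound (A : R) (w a b c d r : C) (n : nat) :
  (0 <= A < 1)%R -> in_disc A a -> in_disc A b -> in_disc A c -> in_disc A d -> in_disc A r ->
  (Cmod w <= 2 * upper_bound_qpoch q 1)%R ->
  (Cmod (weighted_term w a b c d r n) <= weighted_bound A * Cmod (b * c * d * r) ^ n)%R.
Proof.
  intros HA Ha Hb Hc Hd Hr Hw.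
  assert (W : forall x, in_disc A x -> in_disc 1 x) by (intros; now apply in_disc_weaken with A; [lra | ]).
  assert (Ml : forall x y, in_disc A x -> in_disc A y -> in_disc A (x * y)).
  { intros. apply in_disc_mul; auto. lra. }
  assert (Hqq : in_disc q q) by (unfold in_disc; rewrite Cmod_q; lra).
  assert (NZ : forall x, in_disc A x -> qpoch x q n <> 0).
  { intros x Hx. apply qpoch_neq_0; [easy | ]. unfold in_disc in Hx. lra. }
  unfold weighted_term, weighted_bound.
  rewrite <- Rmult_1_r. apply Cmod_mult_le.
  2:{ rewrite Cmod_qpow by easy. apply qpow_le_1. easy. }
  apply Cmod_mult_le.
  2:{ rewrite Cmod_pow, Cmod_opp. lra. }
  apply Cmod_mult_le; [apply Cmod_mult_le; [easy | ] | ].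
  - repeat apply Cmod_mult_le; apply qpoch_bound; try easy; apply W, Ml; auto.
  - assert (IB : forall x, in_disc A x -> (Cmod (/ qpoch x q n) <= lower_bound_qpoch q A)%R).
    { intros x Hx. apply inv_qpoch_bound; [easy | exact Hx | lra]. }
    assert (NQ := qpoch_q_neq_0 q Hq n).
    assert (IQ : (Cmod (/ qpoch q q n) <= lower_bound_qpoch q q)%R).
    { apply inv_qpoch_bound; [easy | exact Hqq | lra]. }
    assert (D1 : in_disc A (a * b * c * d)) by auto.
    assert (D2 : in_disc A (a * b * c * r)) by auto.
    assert (D3 : in_disc A (a * b * d * r)) by auto.
    assert (D4 : in_disc A (a * c * d * r)) by auto.
    assert (N1 := NZ _ D1). assert (N2 := NZ _ D2).
    assert (N3 := NZ _ D3). assert (N4 := NZ _ D4).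
    repeat apply Cmod_inv_mult_le; repeat apply Cmult_neq_0; auto.
Qed.

Lemma kap_in_disc (A : R) (a b c d r : C) : (0 <= A < 1)%R ->
  in_disc A a -> in_disc A b -> in_disc A c -> in_disc A d -> in_disc A r ->
  in_disc A (kap a b c d r).
Proof.
  intros HA Ha Hb Hc Hd Hr. unfold kap.
  assert (W : forall x, in_disc A x -> in_disc 1 x) by (intros; now apply in_disc_weaken with A; [lra | ]).
  repeat apply in_disc_mul; auto; lra.
Qed.

Lemma prod4_in_disc (A : R) (b c d r : C) : (0 <= A < 1)%R ->
  in_disc A b -> in_disc A c -> in_disc A d -> in_disc A r -> in_disc A (b * c * d * r).
Proof.
  intros HA Hb Hc Hd Hr.
  assert (W : forall x, in_disc A x -> in_disc 1 x) by (intros; now apply in_disc_weaken with A; [lra | ]).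
  repeat apply in_disc_mul; auto; lra.
Qed.

Lemma vwp_term_bound (A : R) (a b c d r : C) (n : nat) :
  (0 <= A < 1)%R -> in_disc A a -> in_disc A b -> in_disc A c -> in_disc A d -> in_disc A r ->
  (Cmod (vwp_term a b c d r n) <= weighted_bound A * Cmod (b * c * d * r) ^ n)%R.
Proof.
  intros. apply weighted_term_bound; auto. apply vwp_bound.
  apply in_disc_weaken with A; [lra | ]. now apply kap_in_disc.
Qed.

Lemma common_disc (a b c d r : C) :
  (Cmod a < 1)%R -> (Cmod b < 1)%R -> (Cmod c < 1)%R -> (Cmod d < 1)%R -> (Cmod r < 1)%R ->
  exists A, (0 <= A < 1)%R /\
    in_disc A a /\ in_disc A b /\ in_disc A c /\ in_disc A d /\ in_disc A r.
Proof.
  intros Ha Hb Hc Hd Hr. unfold in_disc.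
  exists (Rmax (Cmod a) (Rmax (Cmod b) (Rmax (Cmod c) (Rmax (Cmod d) (Cmod r))))).
  assert (H0 := Cmod_ge_0 a).
  generalize (Rmax_l (Cmod a) (Rmax (Cmod b) (Rmax (Cmod c) (Rmax (Cmod d) (Cmod r)))))
    (Rmax_r (Cmod a) (Rmax (Cmod b) (Rmax (Cmod c) (Rmax (Cmod d) (Cmod r)))))
    (Rmax_l (Cmod b) (Rmax (Cmod c) (Rmax (Cmod d) (Cmod r))))
    (Rmax_r (Cmod b) (Rmax (Cmod c) (Rmax (Cmod d) (Cmod r))))
    (Rmax_l (Cmod c) (Rmax (Cmod d) (Cmod r)))
    (Rmax_r (Cmod c) (Rmax (Cmod d) (Cmod r)))
    (Rmax_l (Cmod d) (Cmod r)) (Rmax_r (Cmod d) (Cmod r)).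
  intros. repeat split; try lra. repeat apply Rmax_lub_lt; easy.
Qed.

Lemma vwp_csums (a b c d r : C) :
  (Cmod a < 1)%R -> (Cmod b < 1)%R -> (Cmod c < 1)%R -> (Cmod d < 1)%R -> (Cmod r < 1)%R ->
  csums (vwp_term a b c d r) (vwp_sum a b c d r).
Proof.
  intros Ha Hb Hc Hd Hr. destruct (common_disc a b c d r) as [A [HA [? [? [? [? ?]]]]]]; auto.
  destruct (dominated_csums (fun n => weighted_bound A * A ^ n)%R (vwp_term a b c d r)) as [l Hl].
  - apply summable_geom; [easy | ]. left. apply weighted_bound_pos.
  - intros n. eapply Rle_trans; [apply (vwp_term_bound A); auto | ].
    apply Rmult_le_compat_l; [left; apply weighted_bound_pos | ].
    apply pow_incr. split; [apply Cmod_ge_0 | ]. now apply prod4_in_disc.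
  - unfold vwp_sum. now rewrite (csums_CSeries _ _ Hl).
Qed.

Lemma qpoch_mul_q (x : C) (n : nat) : (Cmod x < 1)%R ->
  qpoch (x * q) q n = qpoch x q n * (1 - x * q ^ n) / (1 - x).
Proof.
  intros Hx. assert (H := qpoch_S_l q x n). simpl in H. rewrite H. field.
  now apply one_minus_neq_0.
Qed.

(** For the base k q the number called A is [k] itself, so the usual form with a quotient by 1 - A
    becomes legitimate. *)
Lemma vwp_mul_q (k : C) (n : nat) : (Cmod k < 1)%R ->
  vwp (k * q) n = qpoch k q n * (1 - k * q ^ n * q ^ n) / (1 - k).
Proof.
  intros Hk. assert (H1 := one_minus_neq_0 k Hk). destruct n as [ | m].
  - simpl. field. exact H1.
  - unfold vwp. rewrite qpoch_mul_q by easy.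
    replace (2 * m + 1)%nat with (S (m + m)) by lia. simpl. rewrite Cpow_add_r.
    field. exact H1.
Qed.

(* The certificate of the q-Zeilberger recurrence behind [vwp_recurrence]. *)
Definition certificate (a b c d r : C) (n : nat) : C :=
  (r - b) * (vwp_term a b c d r n
             - weighted_term (qpoch (kap a b c d r) q n) a b c d r n * q ^ n).

(** The quotient of [prefac] at b q by [prefac] at b, without its factor 1 - b r; see
    [prefac_mul_q]. *)
Definition recurrence_coef (a b c d r : C) : C :=
  (1 - a * b) * (1 - b * c) * (1 - b * d) * (1 - kap a b c d r)
  / ((1 - a * b * c * d) * (1 - a * b * c * r) * (1 - a * b * d * r)).

Section Recurrence.
Context (a b c d r : C).
Context (Ha : (Cmod a < 1)%R) (Hb : (Cmod b < 1)%R) (Hc : (Cmod c < 1)%R)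
  (Hd : (Cmod d < 1)%R) (Hr : (Cmod r < 1)%R).

Let h (n : nat) : C := weighted_term (qpoch (kap a b c d r) q n) a b c d r n.

Lemma Cmod_mult4_lt_1 (x y z w : C) : (Cmod x < 1)%R -> (Cmod y < 1)%R -> (Cmod z < 1)%R ->
  (Cmod w < 1)%R -> (Cmod (x * y * z * w) < 1)%R.
Proof. intros. repeat apply Cmod_mult_lt_1; auto. Qed.

Lemma Cmod_kap_lt_1 : (Cmod (kap a b c d r) < 1)%R.
Proof. unfold kap. repeat apply Cmod_mult_lt_1; auto. Qed.

Lemma lt1_qpow (x : C) (n : nat) : (Cmod x < 1)%R -> (Cmod (x * q ^ n) < 1)%R.
Proof. intros Hx. generalize (Cmod_mul_qpow_le q Hq x n). lra. Qed.

(** Writing each ingredient as the common [h n] times a rational function of q^n is what reduces the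
    recurrence to a polynomial identity. *)
Lemma term_shift_b (n : nat) :
  recurrence_coef a b c d r * vwp_term a (b * q) c d r n =
  h n * ((1 - b * c) * (1 - b * d) * (1 - a * b * q ^ n)
         * (1 - kap a b c d r * q ^ n * q ^ n) * q ^ n)
  / ((1 - a * b * c * d * q ^ n) * (1 - a * b * c * r * q ^ n) * (1 - a * b * d * r * q ^ n)).
Proof.
  unfold h, vwp_term, weighted_term, recurrence_coef.
  replace (kap a (b * q) c d r) with (kap a b c d r * q) by (unfold kap; ring).
  rewrite vwp_mul_q by apply Cmod_kap_lt_1.
  replace (a * (b * q)) with (a * b * q) by ring.
  replace (a * b * q * c * d) with (a * b * c * d * q) by ring.
  replace (a * b * q * c * r) with (a * b * c * r * q) by ring.
  replace (a * b * q * d * r) with (a * b * d * r * q) by ring.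
  replace (- (b * q * c * d * r)) with (- (b * c * d * r) * q) by ring.
  rewrite Cpow_mult_l.
  assert (L1 := Cmod_mult4_lt_1 a b c d Ha Hb Hc Hd). assert (L2 := Cmod_mult4_lt_1 a b c r Ha Hb Hc Hr).
  assert (L3 := Cmod_mult4_lt_1 a b d r Ha Hb Hd Hr). assert (L4 := Cmod_mult4_lt_1 a c d r Ha Hc Hd Hr).
  assert (L0 := Cmod_mult_lt_1 a b Ha Hb). assert (LK := Cmod_kap_lt_1).
  rewrite !qpoch_mul_q by assumption.
  assert (N1 := qpoch_neq_0 q Hq _ n L1). assert (N2 := qpoch_neq_0 q Hq _ n L2).
  assert (N3 := qpoch_neq_0 q Hq _ n L3). assert (N4 := qpoch_neq_0 q Hq _ n L4).
  assert (N0 := qpoch_q_neq_0 q Hq n).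
  assert (M0 := one_minus_neq_0 _ L0). assert (MK := one_minus_neq_0 _ LK).
  assert (M1 := one_minus_neq_0 _ L1). assert (M2 := one_minus_neq_0 _ L2).
  assert (M3 := one_minus_neq_0 _ L3).
  assert (T1 := one_minus_neq_0 _ (lt1_qpow _ n L1)).
  assert (T2 := one_minus_neq_0 _ (lt1_qpow _ n L2)).
  assert (T3 := one_minus_neq_0 _ (lt1_qpow _ n L3)).
  (* Nonzero factors become opaque atoms, so that [field] does not expand them. *)
  generalize dependent (qpoch (a * b * c * d) q n). intros P1 N1.
  generalize dependent (qpoch (a * b * c * r) q n). intros P2 N2.
  generalize dependent (qpoch (a * b * d * r) q n). intros P3 N3.
  generalize dependent (qpoch (a * c * d * r) q n). intros P4 N4.
  generalize dependent (qpoch q q n). intros P0 N0.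
  set (t1 := 1 - a * b * c * d * q ^ n) in *. set (t2 := 1 - a * b * c * r * q ^ n) in *.
  set (t3 := 1 - a * b * d * r * q ^ n) in *.
  set (m0 := 1 - a * b) in *. set (mk := 1 - kap a b c d r) in *.
  set (m1 := 1 - a * b * c * d) in *. set (m2 := 1 - a * b * c * r) in *.
  set (m3 := 1 - a * b * d * r) in *.
  clearbody t1 t2 t3 m0 mk m1 m2 m3.
  field. repeat split; assumption.
Qed.

Lemma certificate_S (n : nat) :
  certificate a b c d r (S n) =
  - (h n * ((r - b) * (b * c * d * r) * q ^ n * ((1 - a * b * q ^ n) * (1 - a * c * q ^ n)
        * (1 - a * d * q ^ n) * (1 - a * r * q ^ n))))
  / ((1 - a * b * c * d * q ^ n) * (1 - a * b * c * r * q ^ n)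
     * (1 - a * b * d * r * q ^ n) * (1 - a * c * d * r * q ^ n)).
Proof.
  unfold certificate, vwp_term.
  transitivity ((r - b) * weighted_term (vwp (kap a b c d r) (S n)
     - qpoch (kap a b c d r) q (S n) * q ^ S n) a b c d r (S n)).
  { unfold weighted_term. ring. }
  (* With K = [kap a b c d r], (1 - K q^(2n+1)) - (1 - K q^n) q^(n+1) = 1 - q^(n+1), which cancels
     the last factor of (q;q)_(n+1). *)
  replace (vwp (kap a b c d r) (S n) - qpoch (kap a b c d r) q (S n) * q ^ S n)
    with (qpoch (kap a b c d r) q n * (1 - q * q ^ n)).
  2:{ unfold vwp. replace (2 * n + 1)%nat with (S (n + n)) by lia.
      simpl. rewrite Cpow_add_r. ring. }
  unfold h, weighted_term. rewrite tri_S, Cpow_add_r. simpl.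
  assert (L1 := Cmod_mult4_lt_1 a b c d Ha Hb Hc Hd). assert (L2 := Cmod_mult4_lt_1 a b c r Ha Hb Hc Hr).
  assert (L3 := Cmod_mult4_lt_1 a b d r Ha Hb Hd Hr). assert (L4 := Cmod_mult4_lt_1 a c d r Ha Hc Hd Hr).
  assert (N1 := qpoch_neq_0 q Hq _ n L1). assert (N2 := qpoch_neq_0 q Hq _ n L2).
  assert (N3 := qpoch_neq_0 q Hq _ n L3). assert (N4 := qpoch_neq_0 q Hq _ n L4).
  assert (N0 := qpoch_q_neq_0 q Hq n).
  assert (T0 := qpow_S_neq_1 q Hq n).
  assert (T1 := one_minus_neq_0 _ (lt1_qpow _ n L1)).
  assert (T2 := one_minus_neq_0 _ (lt1_qpow _ n L2)).
  assert (T3 := one_minus_neq_0 _ (lt1_qpow _ n L3)).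
  assert (T4 := one_minus_neq_0 _ (lt1_qpow _ n L4)).
  generalize dependent (qpoch (a * b * c * d) q n). intros P1 N1.
  generalize dependent (qpoch (a * b * c * r) q n). intros P2 N2.
  generalize dependent (qpoch (a * b * d * r) q n). intros P3 N3.
  generalize dependent (qpoch (a * c * d * r) q n). intros P4 N4.
  generalize dependent (qpoch q q n). intros P0 N0.
  set (t1 := 1 - a * b * c * d * q ^ n) in *. set (t2 := 1 - a * b * c * r * q ^ n) in *.
  set (t3 := 1 - a * b * d * r * q ^ n) in *. set (t4 := 1 - a * c * d * r * q ^ n) in *.
  set (t0 := 1 - q * q ^ n) in *. set (rb := r - b).
  set (x1 := 1 - a * b * q ^ n). set (x2 := 1 - a * c * q ^ n).
  set (x3 := 1 - a * d * q ^ n). set (x4 := 1 - a * r * q ^ n).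
  set (y := b * c * d * r).
  clearbody t1 t2 t3 t4 t0 rb x1 x2 x3 x4 y.
  field. repeat split; assumption.
Qed.

End Recurrence.

(** The symmetry in b and r lets every statement on the shift of r to r q follow from the one on b
    to b q. *)
Lemma weighted_term_swap (w a b c d r : C) (n : nat) :
  weighted_term w a r c d b n = weighted_term w a b c d r n.
Proof.
  unfold weighted_term.
  replace (a * r * c * d) with (a * c * d * r) by ring.
  replace (a * r * c * b) with (a * b * c * r) by ring.
  replace (a * r * d * b) with (a * b * d * r) by ring.
  replace (a * c * d * b) with (a * b * c * d) by ring.
  replace (r * c * d * b) with (b * c * d * r) by ring.
  replace (qpoch q q n * qpoch (a * c * d * r) q n * qpoch (a * b * c * r) q n *
     qpoch (a * b * d * r) q n * qpoch (a * b * c * d) q n) with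
    (qpoch q q n * qpoch (a * b * c * d) q n * qpoch (a * b * c * r) q n *
     qpoch (a * b * d * r) q n * qpoch (a * c * d * r) q n) by ring.
  ring.
Qed.

Lemma kap_swap (a b c d r : C) : kap a r c d b = kap a b c d r.
Proof. unfold kap. ring. Qed.

Lemma vwp_term_swap (a b c d r : C) (n : nat) :
  vwp_term a r c d b n = vwp_term a b c d r n.
Proof. unfold vwp_term. now rewrite weighted_term_swap, kap_swap. Qed.

Lemma certificate_step (a b c d r : C) (n : nat) :
  (Cmod a < 1)%R -> (Cmod b < 1)%R -> (Cmod c < 1)%R -> (Cmod d < 1)%R -> (Cmod r < 1)%R ->
  r * recurrence_coef a b c d r * vwp_term a (b * q) c d r n
  - b * recurrence_coef a r c d b * vwp_term a b c d (r * q) n =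
  (r - b) * vwp_term a b c d r n + certificate a b c d r (S n) - certificate a b c d r n.
Proof.
  intros Ha Hb Hc Hd Hr.
  rewrite <- (vwp_term_swap a b c d (r * q)), <- !Cmult_assoc.
  rewrite (term_shift_b a r c d b), (term_shift_b a b c d r), certificate_S by assumption.
  rewrite (weighted_term_swap _ a b c d r), (kap_swap a b c d r). unfold certificate.
  replace (a * r * c * d) with (a * c * d * r) by ring.
  replace (a * r * c * b) with (a * b * c * r) by ring.
  replace (a * r * d * b) with (a * b * d * r) by ring.
  set (H := weighted_term (qpoch (kap a b c d r) q n) a b c d r n).
  set (X := q ^ n).
  assert (T1 := one_minus_neq_0 _ (lt1_qpow _ n (Cmod_mult4_lt_1 a b c d Ha Hb Hc Hd))).
  assert (T2 := one_minus_neq_0 _ (lt1_qpow _ n (Cmod_mult4_lt_1 a b c r Ha Hb Hc Hr))).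
  assert (T3 := one_minus_neq_0 _ (lt1_qpow _ n (Cmod_mult4_lt_1 a b d r Ha Hb Hd Hr))).
  assert (T4 := one_minus_neq_0 _ (lt1_qpow _ n (Cmod_mult4_lt_1 a c d r Ha Hc Hd Hr))).
  fold X in T1, T2, T3, T4.
  (* What is left of the recurrence once the common factor [H] is removed and the four denominators
     are cleared: a polynomial identity in X = q^n. *)
  assert (E : (r - b) * X * ((1 - a * b * c * d * X) * (1 - a * b * c * r * X)
                * (1 - a * b * d * r * X) * (1 - a * c * d * r * X)) =
    r * ((1 - b * c) * (1 - b * d) * (1 - a * b * X) * (1 - kap a b c d r * X * X) * X)
      * (1 - a * c * d * r * X)
    - b * ((1 - r * c) * (1 - r * d) * (1 - a * r * X) * (1 - kap a b c d r * X * X) * X)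
      * (1 - a * b * c * d * X)
    + (r - b) * (b * c * d * r) * X * ((1 - a * b * X) * (1 - a * c * X)
        * (1 - a * d * X) * (1 - a * r * X))).
  { unfold kap. ring. }
  set (t1 := 1 - a * b * c * d * X) in *. set (t2 := 1 - a * b * c * r * X) in *.
  set (t3 := 1 - a * b * d * r * X) in *. set (t4 := 1 - a * c * d * r * X) in *.
  set (e1 := (1 - b * c) * (1 - b * d) * (1 - a * b * X) * (1 - kap a b c d r * X * X) * X) in *.
  set (e2 := (1 - r * c) * (1 - r * d) * (1 - a * r * X) * (1 - kap a b c d r * X * X) * X) in *.
  set (e3 := (r - b) * (b * c * d * r) * X * ((1 - a * b * X) * (1 - a * c * X)
        * (1 - a * d * X) * (1 - a * r * X))) in *.
  transitivity ((r - b) * X * H - H * e3 / (t1 * t2 * t3 * t4)).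
  2:{ unfold Cdiv. ring. }
  replace ((r - b) * X) with ((r * e1 * t4 - b * e2 * t1 + e3) / (t1 * t2 * t3 * t4)).
  2:{ rewrite <- E. field. repeat split; assumption. }
  clearbody e1 e2 e3 t1 t2 t3 t4. field. repeat split; assumption.
Qed.

Lemma weighted_climit_0 (a b c d r : C) (w : nat -> C) :
  (Cmod a < 1)%R -> (Cmod b < 1)%R -> (Cmod c < 1)%R -> (Cmod d < 1)%R -> (Cmod r < 1)%R ->
  (forall n, Cmod (w n) <= 2 * upper_bound_qpoch q 1)%R ->
  climit (fun n => weighted_term (w n) a b c d r n) 0.
Proof.
  intros Ha Hb Hc Hd Hr Hw.
  destruct (common_disc a b c d r) as [A [HA [HA1 [HA2 [HA3 [HA4 HA5]]]]]]; auto.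
  intros eps He.
  assert (HW := weighted_bound_pos A).
  destruct (pow_lt_1_zero A ltac:(rewrite Rabs_pos_eq; lra) (eps / weighted_bound A)%R) as [N HN].
  { now apply Rdiv_lt_0_compat. }
  exists N. intros n Hn. specialize (HN n Hn).
  assert (HAn : (0 <= A ^ n)%R) by (apply pow_le; lra).
  rewrite Rabs_pos_eq in HN by easy.
  replace (weighted_term (w n) a b c d r n - 0) with (weighted_term (w n) a b c d r n) by ring.
  eapply Rle_trans; [apply (weighted_term_bound A); auto | ].
  apply Rle_trans with (weighted_bound A * A ^ n)%R.
  - apply Rmult_le_compat_l; [lra | ]. apply pow_incr. split; [apply Cmod_ge_0 | ].
    now apply prod4_in_disc.
  - apply Rmult_lt_compat_l with (r := weighted_bound A) in HN; [ | easy].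
    replace (weighted_bound A * (eps / weighted_bound A))%R with eps in HN by (field; lra).
    lra.
Qed.

Lemma certificate_climit (a b c d r : C) :
  (Cmod a < 1)%R -> (Cmod b < 1)%R -> (Cmod c < 1)%R -> (Cmod d < 1)%R -> (Cmod r < 1)%R ->
  climit (certificate a b c d r) 0.
Proof.
  intros Ha Hb Hc Hd Hr.
  assert (Hk : (Cmod (kap a b c d r) <= 1)%R) by (left; now apply Cmod_kap_lt_1).
  assert (H1U := upper_bound_pos q 1).
  replace (RtoC 0) with ((r - b) * (0 - 0)) by ring.
  unfold certificate. apply climit_scal, climit_minus.
  - apply weighted_climit_0; auto. intros n. now apply vwp_bound.
  - apply climit_ext with
      (fun n => weighted_term (qpoch (kap a b c d r) q n * q ^ n) a b c d r n).
    { intros n. unfold weighted_term. ring. }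
    apply weighted_climit_0; auto. intros n.
    replace (2 * upper_bound_qpoch q 1)%R with (upper_bound_qpoch q 1 * 2)%R by ring.
    apply Cmod_mult_le; [now apply qpoch_bound | ]. rewrite Cmod_qpow by easy.
    generalize (qpow_le_1 q Hq n). lra.
Qed.

Lemma Cmod_mul_q_lt (x : C) : (Cmod x < 1)%R -> (Cmod (x * q) < 1)%R.
Proof. intros Hx. generalize (Cmod_mul_q_le q Hq x). lra. Qed.

(** Summing [certificate_step] telescopes; the certificate is 0 at n = 0 and tends to 0, so only the
    three series remain. *)
Lemma vwp_recurrence (a b c d r : C) :
  (Cmod a < 1)%R -> (Cmod b < 1)%R -> (Cmod c < 1)%R -> (Cmod d < 1)%R -> (Cmod r < 1)%R ->
  r * recurrence_coef a b c d r * vwp_sum a (b * q) c d r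
  - b * recurrence_coef a r c d b * vwp_sum a b c d (r * q)
  = (r - b) * vwp_sum a b c d r.
Proof.
  intros Ha Hb Hc Hd Hr.
  assert (Hbq := Cmod_mul_q_lt b Hb). assert (Hrq := Cmod_mul_q_lt r Hr).
  apply (climit_unique (psum (fun n =>
     r * recurrence_coef a b c d r * vwp_term a (b * q) c d r n
     - b * recurrence_coef a r c d b * vwp_term a b c d (r * q) n))).
  - apply climit_ext with (fun n =>
      r * recurrence_coef a b c d r * psum (vwp_term a (b * q) c d r) n
      - b * recurrence_coef a r c d b * psum (vwp_term a b c d (r * q)) n).
    + intros n. rewrite <- !psum_scal. induction n as [ | n IH]; simpl; [ring | ].
      rewrite <- IH. ring.
    + apply climit_minus; apply climit_scal; now apply vwp_csums.
  - apply climit_ext with (fun n =>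
      (r - b) * psum (vwp_term a b c d r) n + certificate a b c d r n).
    + intros n. induction n as [ | n IH].
      * simpl psum. unfold certificate, vwp_term. simpl.
        unfold weighted_term. ring.
      * simpl psum. rewrite <- IH, certificate_step by assumption. ring.
    + replace ((r - b) * vwp_sum a b c d r) with ((r - b) * vwp_sum a b c d r + 0) by ring.
      apply climit_plus; [ | now apply certificate_climit].
      apply climit_scal. now apply vwp_csums.
Qed.

Lemma qinf_mul_q (x : C) : (Cmod x < 1)%R ->
  qpoch_inf (x * q) q = qpoch_inf x q / (1 - x).
Proof.
  intros Hx. rewrite (qinf_step q Hq x) by lra. field. now apply one_minus_neq_0.
Qed.

Lemma prefac_mul_q (a b c d r : C) :
  (Cmod a < 1)%R -> (Cmod b < 1)%R -> (Cmod c < 1)%R -> (Cmod d < 1)%R -> (Cmod r < 1)%R ->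
  prefac a (b * q) c d r = (1 - b * r) * recurrence_coef a b c d r * prefac a b c d r.
Proof.
  intros Ha Hb Hc Hd Hr. unfold prefac, recurrence_coef.
  replace (kap a (b * q) c d r) with (kap a b c d r * q) by (unfold kap; ring).
  replace (a * (b * q)) with (a * b * q) by ring.
  replace (a * b * q * c * d) with (a * b * c * d * q) by ring.
  replace (a * b * q * c * r) with (a * b * c * r * q) by ring.
  replace (a * b * q * d * r) with (a * b * d * r * q) by ring.
  replace (b * q * c) with (b * c * q) by ring.
  replace (b * q * d) with (b * d * q) by ring.
  replace (b * q * r) with (b * r * q) by ring.
  assert (LL : forall x y, (Cmod x < 1)%R -> (Cmod y < 1)%R -> (Cmod (x * y) < 1)%R)
    by (intros; now apply Cmod_mult_lt_1).
  assert (LK := Cmod_kap_lt_1 a b c d r Ha Hb Hc Hd Hr).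
  assert (Lq : (Cmod q < 1)%R) by (rewrite Cmod_q; lra).
  rewrite !qinf_mul_q by auto.
  assert (NI : forall x, (Cmod x < 1)%R -> qpoch_inf x q <> 0) by (intros; now apply qinf_neq_0).
  assert (N0 := NI _ Lq). assert (N1 := NI _ (LL _ _ Ha Hb)). assert (N2 := NI _ (LL _ _ Ha Hc)).
  assert (N3 := NI _ (LL _ _ Ha Hd)). assert (N4 := NI _ (LL _ _ Ha Hr)).
  assert (N5 := NI _ (LL _ _ Hb Hc)). assert (N6 := NI _ (LL _ _ Hb Hd)).
  assert (N7 := NI _ (LL _ _ Hb Hr)). assert (N8 := NI _ (LL _ _ Hc Hd)).
  assert (N9 := NI _ (LL _ _ Hc Hr)). assert (N10 := NI _ (LL _ _ Hd Hr)).
  assert (N11 := NI _ LK).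
  assert (M1 := one_minus_neq_0 _ (Cmod_mult4_lt_1 a b c d Ha Hb Hc Hd)).
  assert (M2 := one_minus_neq_0 _ (Cmod_mult4_lt_1 a b c r Ha Hb Hc Hr)).
  assert (M3 := one_minus_neq_0 _ (Cmod_mult4_lt_1 a b d r Ha Hb Hd Hr)).
  assert (M4 := one_minus_neq_0 _ (LL _ _ Ha Hb)). assert (M5 := one_minus_neq_0 _ (LL _ _ Hb Hc)).
  assert (M6 := one_minus_neq_0 _ (LL _ _ Hb Hd)). assert (M7 := one_minus_neq_0 _ (LL _ _ Hb Hr)).
  assert (M8 := one_minus_neq_0 _ LK).
  set (m1 := 1 - a * b * c * d) in *. set (m2 := 1 - a * b * c * r) in *.
  set (m3 := 1 - a * b * d * r) in *. set (m4 := 1 - a * b) in *.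
  set (m5 := 1 - b * c) in *. set (m6 := 1 - b * d) in *. set (m7 := 1 - b * r) in *.
  set (m8 := 1 - kap a b c d r) in *. clearbody m1 m2 m3 m4 m5 m6 m7 m8.
  field. repeat split; assumption.
Qed.

Lemma prefac_swap (a b c d r : C) : prefac a r c d b = prefac a b c d r.
Proof.
  unfold prefac. rewrite kap_swap.
  replace (a * r * c * d) with (a * c * d * r) by ring.
  replace (a * r * c * b) with (a * b * c * r) by ring.
  replace (a * r * d * b) with (a * b * d * r) by ring.
  replace (a * c * d * b) with (a * b * c * d) by ring.
  replace (r * c) with (c * r) by ring. replace (r * d) with (d * r) by ring.
  replace (r * b) with (b * r) by ring. replace (c * b) with (b * c) by ring.
  replace (d * b) with (b * d) by ring.
  f_equal; [ring | f_equal; ring].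
Qed.

Definition value (a b c d r : C) : C := 4 * PI * prefac a b c d r * vwp_sum a b c d r.

Lemma vwp_sum_ext (a b c d r a' b' c' d' r' : C) :
  (forall n, vwp_term a b c d r n = vwp_term a' b' c' d' r' n) ->
  vwp_sum a b c d r = vwp_sum a' b' c' d' r'.
Proof.
  intros E. unfold vwp_sum, CSeries. f_equal; apply Series_ext; intros n; now rewrite E.
Qed.

Lemma value_swap (a b c d r : C) : value a r c d b = value a b c d r.
Proof.
  unfold value. rewrite prefac_swap.
  now rewrite (vwp_sum_ext a r c d b a b c d r (vwp_term_swap a b c d r)).
Qed.

(** The factor 1 - b r, absent from the recurrence of the series, comes from 1/(br;q)_oo in the
    prefactor and is the same for both shifts. *)
Lemma value_recurrence (a b c d r : C) :
  (Cmod a < 1)%R -> (Cmod b < 1)%R -> (Cmod c < 1)%R -> (Cmod d < 1)%R -> (Cmod r < 1)%R ->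
  r * value a (b * q) c d r - b * value a b c d (r * q)
  = (r - b) * (1 - b * r) * value a b c d r.
Proof.
  intros Ha Hb Hc Hd Hr. unfold value.
  replace (prefac a b c d (r * q)) with ((1 - b * r) * recurrence_coef a r c d b * prefac a b c d r).
  2:{ rewrite <- (prefac_swap a b c d (r * q)), prefac_mul_q by assumption.
      rewrite (prefac_swap a b c d r). ring. }
  rewrite prefac_mul_q by assumption.
  transitivity (4 * PI * prefac a b c d r * (1 - b * r) *
    (r * recurrence_coef a b c d r * vwp_sum a (b * q) c d r
     - b * recurrence_coef a r c d b * vwp_sum a b c d (r * q))); [ring | ].
  rewrite vwp_recurrence by assumption. ring.
Qed.

End VeryWellPoised.

(** * Moments of the theta weight *)

Lemma Cminus_0_r (x : C) : x - 0 = x.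
Proof. ring. Qed.

Lemma rsum_arith_geom (K x : R) (n : nat) : (0 <= x < 1)%R -> (0 <= K)%R ->
  (rsum (fun k => K * (INR k + 1) * x ^ k) n <= K / (1 - x) ^ 2)%R.
Proof.
  intros Hx HK.
  assert (E : (rsum (fun k => K * (INR k + 1) * x ^ k) n
            = K * (1 - x ^ n - INR n * x ^ n * (1 - x)) / (1 - x) ^ 2)%R).
  { induction n as [ | n IH]; [simpl; field; lra | ].
    simpl rsum. rewrite IH, S_INR. simpl. field. lra. }
  rewrite E. unfold Rdiv. apply Rmult_le_compat_r.
  - left. apply Rinv_0_lt_compat. apply pow_lt. lra.
  - assert (0 <= x ^ n)%R by (apply pow_le; lra).
    assert (0 <= INR n)%R by apply pos_INR.
    assert (0 <= INR n * x ^ n * (1 - x))%R by (apply Rmult_le_pos; [nra | lra]).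
    nra.
Qed.

Lemma summable_arith_geom (K x : R) : (0 <= x < 1)%R -> (0 <= K)%R ->
  summable (fun k => K * (INR k + 1) * x ^ k)%R.
Proof.
  intros Hx HK. split.
  - intros n. assert (0 <= x ^ n)%R by (apply pow_le; lra).
    generalize (pos_INR n). intros. apply Rmult_le_pos; [ | easy].
    apply Rmult_le_pos; lra.
  - exists (K / (1 - x) ^ 2)%R. intros n. now apply rsum_arith_geom.
Qed.

(** The entries with k + j = n, as in a Cauchy product; their number n + 1 explains the majorants
    (n+1) x^n. *)
Definition diagonal (tau : nat -> nat -> C) (n : nat) : C :=
  psum (fun k => tau k (n - k)%nat) (S n).

Lemma Cmod_psum_le (u : nat -> C) (B : R) (n : nat) :
  (forall k, (k < n)%nat -> Cmod (u k) <= B)%R -> (Cmod (psum u n) <= INR n * B)%R.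
Proof.
  induction n as [ | n IH]; intros H.
  - simpl. rewrite Cmod_0. lra.
  - rewrite S_INR. simpl psum. eapply Rle_trans; [apply Cmod_triangle | ].
    assert (H1 := IH (fun k Hk => H k (Nat.lt_lt_succ_r _ _ Hk))).
    assert (H2 := H n (Nat.lt_succ_diag_r n)). lra.
Qed.

Lemma diagonal_bound (tau : nat -> nat -> C) (K x : R) (n : nat) : (0 <= x)%R ->
  (forall k j, Cmod (tau k j) <= K * x ^ k * x ^ j)%R ->
  (Cmod (diagonal tau n) <= K * (INR n + 1) * x ^ n)%R.
Proof.
  intros Hx H. unfold diagonal. eapply Rle_trans.
  - apply Cmod_psum_le with (B := (K * x ^ n)%R). intros k Hk.
    eapply Rle_trans; [apply H | ]. rewrite Rmult_assoc, <- pow_add.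
    right. do 2 f_equal. lia.
  - rewrite S_INR. right. ring.
Qed.

Lemma psum_diagonal (tau : nat -> nat -> C) (N : nat) :
  psum (diagonal tau) N = psum (fun k => psum (tau k) (N - k)) N.
Proof.
  induction N as [ | N IH]; [easy | ].
  change (psum (diagonal tau) (S N)) with (psum (diagonal tau) N + diagonal tau N).
  rewrite IH. unfold diagonal.
  change (psum (fun k => tau k (N - k)%nat) (S N))
    with (psum (fun k => tau k (N - k)%nat) N + tau N (N - N)%nat).
  change (psum (fun k => psum (tau k) (S N - k)) (S N))
    with (psum (fun k => psum (tau k) (S N - k)) N + psum (tau N) (S N - N)).
  rewrite (psum_ext (fun k => psum (tau k) (S N - k))
             (fun k => psum (tau k) (N - k) + tau k (N - k)%nat) N).
  - rewrite psum_plus. replace (S N - N)%nat with 1%nat by lia.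
    rewrite !Nat.sub_diag. simpl. ring.
  - intros k Hk. now replace (S N - k)%nat with (S (N - k)) by lia.
Qed.

(** The triangle k + j < N differs from the first N full rows by N row tails, each at most K x^k
    x^(N-k)/(1-x), hence by at most N K x^N/(1-x). *)
Lemma csums_diagonal (tau : nat -> nat -> C) (s : nat -> C) (l : C) (K x : R) :
  (0 <= x < 1)%R -> (0 <= K)%R ->
  (forall k j, Cmod (tau k j) <= K * x ^ k * x ^ j)%R ->
  (forall k, csums (tau k) (s k)) -> csums s l -> csums (diagonal tau) l.
Proof.
  intros Hx HK H Hs Hl.
  apply climit_ext with (fun N => psum s N - psum (fun k => s k - psum (tau k) (N - k)) N).
  { intros N. rewrite psum_diagonal.
    assert (G : forall v, psum s N - psum (fun k => s k - v k) N = psum v N).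
    { clear. intros v. induction N as [ | N IH]; simpl; [ring | ]. rewrite <- IH. ring. }
    apply (G (fun k => psum (tau k) (N - k))). }
  replace l with (l - 0) by ring. apply climit_minus; [exact Hl | ].
  intros eps He.
  (* That n x^n tends to 0 is read off the Cauchy criterion for the series of (n+1) x^n, applied to
     a block of one term. *)
  destruct (summable_cauchy _ (summable_arith_geom (K / (1 - x)) x Hx
    ltac:(apply Rdiv_le_0_compat; lra)) eps He) as [N HN].
  exists N. intros n Hn.
  specialize (HN n 1%nat Hn). rewrite Nat.add_1_r in HN. simpl rsum in HN.
  cbv beta. rewrite Cminus_0_r.
  apply Rle_trans with (INR n * (K / (1 - x) * x ^ n))%R.
  - apply Cmod_psum_le. intros k Hk.
    eapply Rle_trans.
    + apply (csums_geom_tail (tau k) (s k) (K * x ^ k) x (n - k)); auto.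
      apply Rmult_le_pos; [easy | ]. apply pow_le. lra.
    + right. replace n with (k + (n - k))%nat at 2 by lia.
      rewrite pow_add. field. lra.
  - assert (0 <= K / (1 - x) * x ^ n)%R.
    { apply Rmult_le_pos; [apply Rdiv_le_0_compat; lra | ]. apply pow_le. lra. }
    nra.
Qed.

Lemma Int_psum (f : nat -> R -> C) (v : nat -> C) (n : nat) :
  (forall k, Int (f k) (v k)) -> Int (fun t => psum (fun k => f k t) n) (psum v n).
Proof.
  intros H. induction n as [ | n IH]; simpl.
  - exact Int_zero.
  - exact (Int_plus _ _ _ _ IH (H n)).
Qed.

Lemma Int_csums (f : nat -> R -> C) (g : R -> C) (v : nat -> C) (M : nat -> R) :
  summable M -> (forall k t, Cmod (f k t) <= M k)%R ->
  (forall t, csums (fun k => f k t) (g t)) -> (forall k, Int (f k) (v k)) ->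
  exists w, Int g w /\ csums v w.
Proof.
  intros HM HB Hg Hf.
  destruct (Int_lim (fun n t => psum (fun k => f k t) n) g (psum v)) as [w [H1 H2]].
  - intros n. now apply Int_psum.
  - intros eps He. destruct (dominated_uniform M HM eps He) as [N HN].
    exists N. intros n Hn t. rewrite Cmod_minus_sym. apply HN; auto.
  - now exists w.
Qed.

Lemma climit_bounded (u : nat -> C) (l : C) : climit u l ->
  exists N B, (0 <= B)%R /\ forall n, (N <= n)%nat -> (Cmod (u n) <= B)%R.
Proof.
  intros H. destruct (H 1%R) as [N HN]; [lra | ]. exists N, (1 + Cmod l)%R.
  split; [generalize (Cmod_ge_0 l); lra | ]. intros n Hn. specialize (HN n Hn).
  generalize (Cmod_triangle (u n - l) l). replace (u n - l + l) with (u n) by ring. lra.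
Qed.

Lemma climit_0_mult (u v : nat -> C) (m : C) : climit u 0 -> climit v m ->
  climit (fun n => u n * v n) 0.
Proof.
  intros Hu Hv eps He. destruct (climit_bounded v m Hv) as [N1 [B [HB H1]]].
  destruct (Hu (eps / (B + 1))%R) as [N2 H2]; [apply Rdiv_lt_0_compat; lra | ].
  exists (N1 + N2)%nat. intros n Hn.
  specialize (H1 n ltac:(lia)). specialize (H2 n ltac:(lia)).
  replace (u n - 0) with (u n) in H2 by ring.
  replace (u n * v n - 0) with (u n * v n) by ring.
  eapply Rle_trans; [apply Cmod_mult_le; [exact H2 | exact H1] | ].
  apply Rmult_le_reg_r with (B + 1)%R; [lra | ].
  replace (eps / (B + 1) * B * (B + 1))%R with (eps * B)%R by (field; lra). nra.
Qed.

Lemma climit_mult (u v : nat -> C) (l m : C) : climit u l -> climit v m ->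
  climit (fun n => u n * v n) (l * m).
Proof.
  intros Hu Hv.
  apply climit_ext with (fun n => (u n - l) * v n + l * v n).
  { intros n. ring. }
  replace (l * m) with (0 + l * m) by ring. apply climit_plus; [ | now apply climit_scal].
  apply climit_0_mult with m; [ | easy].
  replace (RtoC 0) with (l - l) by ring. apply climit_minus; [easy | apply climit_const].
Qed.

Lemma climit_subseq (u : nat -> C) (l : C) (f : nat -> nat) :
  (forall n, (n <= f n)%nat) -> climit u l -> climit (fun n => u (f n)) l.
Proof.
  intros Hf H eps He. destruct (H eps He) as [N HN]. exists N. intros n Hn.
  apply HN. specialize (Hf n). lia.
Qed.

Section Theta.
Context (q : R) (Hq : (0 < q < 1)%R).

Lemma Cmod_q_lt_1 : (Cmod q < 1)%R.
Proof. rewrite Cmod_q; lra. Qed.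

Lemma Fc_climit : climit (Fc q) (/ qpoch_inf q q).
Proof.
  assert (NQ := qinf_neq_0 q Hq q Cmod_q_lt_1).
  apply climit_ext with (fun n => / qpoch_inf q q * (1 +
     (qpoch_inf q q - qpoch q q n) * Fc q n)).
  { intros n. unfold Fc. field. split; [now apply qpoch_q_neq_0 | easy]. }
  replace (/ qpoch_inf q q) with (/ qpoch_inf q q * (1 + 0)) at 1 by ring.
  apply climit_scal, climit_plus; [apply climit_const | ].
  intros eps He. assert (HL := lower_bound_pos q q).
  destruct (qinf_climit q Hq q ltac:(generalize Cmod_q_lt_1; lra)
     (eps / lower_bound_qpoch q q)%R) as [N HN]; [now apply Rdiv_lt_0_compat | ].
  exists N. intros n Hn. specialize (HN n Hn).
  cbv beta. rewrite Cminus_0_r.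
  replace eps with (eps / lower_bound_qpoch q q * lower_bound_qpoch q q)%R by (field; lra).
  apply Cmod_mult_le.
  - now rewrite Cmod_minus_sym.
  - apply inv_qpoch_bound; [easy | rewrite Cmod_q; lra | lra].
Qed.

(** The finite q-binomial theorem divided by (q;q)_M. It yields both the coefficients of the theta
    product and the vanishing of the Rogers moments. *)
Lemma q_binomial (x : C) (M : nat) :
  psum (fun j => Ec q j * Fc q (M - j) * x ^ j) (S M) = qpoch x q M * Fc q M.
Proof.
  induction M as [ | M IH].
  - simpl. unfold Ec, Fc. simpl. field.
  - assert (NZ : 1 - RtoC q ^ S M <> 0) by (apply one_minus_neq_0; now apply qpow_S_lt_1).
    replace (qpoch x q (S M) * Fc q (S M))
      with ((1 - x * q ^ M) * (qpoch x q M * Fc q M) / (1 - q ^ S M)).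
    2:{ rewrite <- (Fc_S q Hq M). simpl qpoch. field. exact NZ. }
    rewrite <- IH.
    (* Pascal's rule, 1 - q^(M+1) = (1 - q^(M+1-j)) + q^(M+1-j) (1 - q^j), summed over j <= n: the
       first part lowers the index of [Fc], the second that of [Ec]. *)
    assert (E : forall n, (n <= M)%nat ->
      (1 - q ^ S M) * psum (fun j => Ec q j * Fc q (S M - j) * x ^ j) (S n)
      = psum (fun j => Ec q j * Fc q (M - j) * x ^ j) (S n)
        - x * q ^ M * psum (fun j => Ec q j * Fc q (M - j) * x ^ j) n).
    { induction n as [ | n IHn]; intros Hn.
      - simpl psum. rewrite !Nat.sub_0_r, <- (Fc_S q Hq M). simpl. ring.
      - change (psum (fun j => Ec q j * Fc q (S M - j) * x ^ j) (S (S n)))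
          with (psum (fun j => Ec q j * Fc q (S M - j) * x ^ j) (S n)
                + Ec q (S n) * Fc q (S M - S n) * x ^ S n).
        rewrite Cmult_plus_distr_l, IHn by lia.
        change (psum (fun j => Ec q j * Fc q (M - j) * x ^ j) (S (S n)))
          with (psum (fun j => Ec q j * Fc q (M - j) * x ^ j) (S n)
                + Ec q (S n) * Fc q (M - S n) * x ^ S n).
        change (psum (fun j => Ec q j * Fc q (M - j) * x ^ j) (S n))
          with (psum (fun j => Ec q j * Fc q (M - j) * x ^ j) n
                + Ec q n * Fc q (M - n) * x ^ n).
        rewrite <- (Fc_S q Hq (M - S n)).
        replace (S (M - S n)) with (M - n)%nat by lia.
        replace (S M - S n)%nat with (M - n)%nat by lia.
        assert (HE := Ec_S q Hq n).
        replace (q ^ S M) with (q ^ S n * q ^ (M - n)) by (rewrite <- Cpow_add_r; f_equal; lia).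
        replace (q ^ M) with (q ^ n * q ^ (M - n)) by (rewrite <- Cpow_add_r; f_equal; lia).
        set (F := Fc q (M - n)). set (y := q ^ (M - n)).
        set (p := psum (fun j => Ec q j * Fc q (M - j) * x ^ j) n).
        rewrite (Cpow_S x n).
        match goal with |- ?L = ?Rr =>
          transitivity (L - x * x ^ n * F * y * (Ec q (S n) * (1 - q ^ S n) - - q ^ n * Ec q n)) end.
        + rewrite HE. ring.
        + ring. }
    specialize (E M (le_n M)).
    change (psum (fun j => Ec q j * Fc q (S M - j) * x ^ j) (S (S M)))
      with (psum (fun j => Ec q j * Fc q (S M - j) * x ^ j) (S M)
            + Ec q (S M) * Fc q (S M - S M) * x ^ S M).
    set (P := psum (fun j => Ec q j * Fc q (S M - j) * x ^ j) (S M)) in *.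
    change (psum (fun j => Ec q j * Fc q (M - j) * x ^ j) (S M))
      with (psum (fun j => Ec q j * Fc q (M - j) * x ^ j) M
            + Ec q M * Fc q (M - M) * x ^ M) in *.
    set (p := psum (fun j => Ec q j * Fc q (M - j) * x ^ j) M) in *.
    rewrite !Nat.sub_diag in *.
    assert (HE := Ec_S q Hq M).
    apply (f_equal (fun z => / (1 - q ^ S M) * z)) in E.
    rewrite Cmult_assoc, Cinv_l, Cmult_1_l in E by exact NZ. rewrite E.
    replace (Ec q (S M)) with (- q ^ M * Ec q M / (1 - q ^ S M)).
    2:{ rewrite <- HE. field. exact NZ. }
    rewrite (Cpow_S x M).
    set (z := 1 - q ^ S M) in *. clearbody z. field. exact NZ.
Qed.

(** * The theta product (e^{2it}, q e^{-2it};q)_oo and its Fourier coefficients *)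

Definition theta (t : R) : C :=
  qpoch_inf (expi t * expi t) q * qpoch_inf (q * (expi (- t) * expi (- t))) q.

Definition theta_fin (N : nat) (t : R) : C :=
  qpoch (expi t * expi t) q N * qpoch (q * (expi (- t) * expi (- t))) q N.

(** Each factor 1 - x q^(-i) equals -x q^(-i) (1 - y q^i), as y = 1/x. This joins the two products
    of [theta_fin] into a single one of length 2N. *)
Lemma qpoch_reflect (x y : C) (N : nat) : x * y = 1 ->
  qpoch (x / q ^ N) q N = (- x) ^ N / q ^ tri (S N) * qpoch (q * y) q N.
Proof.
  intros Hxy. assert (NZ := q_neq_0 q Hq).
  induction N as [ | N IH].
  - change (tri 1) with O. simpl. field.
  - rewrite qpoch_S_l.
    replace (x / q ^ S N * q) with (x / q ^ N).
    2:{ simpl. field. split; [now apply qpow_neq_0 | easy]. }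
    rewrite IH, (tri_S (S N)), Cpow_add_r. simpl qpoch.
    replace (1 - x / q ^ S N) with (- x / q ^ S N * (1 - q * y * q ^ N)).
    2:{ replace (- x / q ^ S N * (1 - q * y * q ^ N))
          with (- x / q ^ S N + (x * y) * (q ^ S N / q ^ S N)).
        - rewrite Hxy. field. now apply qpow_neq_0.
        - rewrite (Cpow_S q N). field. split; [now apply qpow_neq_0 | easy]. }
    rewrite (Cpow_S (- x) N). field. split; now apply qpow_neq_0.
Qed.

Definition laurent_coef (N i : nat) : C :=
  qpoch q q (2 * N) * Ec q i * Fc q (2 * N - i) * (-(1)) ^ N * q ^ tri (S N) / (q ^ N) ^ i.

Lemma expi_pow (t : R) (n : nat) : expi t ^ n = expi (INR n * t).
Proof.
  induction n as [ | n IH]; [simpl; now rewrite Rmult_0_l, expi_0 | ].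
  rewrite Cpow_S, IH, <- expi_add, S_INR. f_equal. ring.
Qed.

(** Finite form of Jacobi's triple product: the q-binomial theorem expands (x q^(-N);q)_(2N) with x
    = e^{2it}, and the factor y^N recentres the exponents around 0. *)
Lemma theta_fin_laurent (N : nat) (t : R) :
  theta_fin N t = psum (fun i => laurent_coef N i
    * expi (IZR (2 * (Z.of_nat i - Z.of_nat N)) * t)) (S (2 * N)).
Proof.
  set (x := expi t * expi t). set (y := expi (- t) * expi (- t)).
  assert (Hxy : x * y = 1).
  { unfold x, y. transitivity ((expi t * expi (- t)) * (expi t * expi (- t))); [ring | ].
    rewrite expi_opp_r. ring. }
  assert (NQ := qpow_neq_0 q Hq).
  assert (E1 : theta_fin N t =
     qpoch (x / q ^ N) q (2 * N) * (-(1)) ^ N * q ^ tri (S N) * y ^ N).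
  { replace (2 * N)%nat with (N + N)%nat by lia. rewrite qpoch_add.
    replace (x / q ^ N * q ^ N) with x by (field; apply NQ).
    rewrite (qpoch_reflect x y N Hxy). unfold theta_fin. fold x y.
    transitivity (qpoch x q N * qpoch (q * y) q N * ((x * y) ^ N * ((-(1)) * (-(1))) ^ N)).
    - rewrite Hxy, Cpow_1_l. replace (-(1) * -(1)) with (RtoC 1) by ring.
      rewrite Cpow_1_l. ring.
    - rewrite !Cpow_mult_l. replace (- x) with (-(1) * x) by ring. rewrite Cpow_mult_l.
      field. apply NQ. }
  rewrite E1.
  replace (qpoch (x / q ^ N) q (2 * N))
    with (qpoch q q (2 * N) * (qpoch (x / q ^ N) q (2 * N) * Fc q (2 * N))).
  2:{ unfold Fc. field. now apply qpoch_q_neq_0. }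
  rewrite <- q_binomial.
  transitivity ((qpoch q q (2 * N) * (-(1)) ^ N * q ^ tri (S N) * y ^ N)
    * psum (fun j => Ec q j * Fc q (2 * N - j) * (x / q ^ N) ^ j) (S (2 * N))); [ring | ].
  rewrite <- psum_scal. apply psum_ext. intros i Hi. unfold laurent_coef.
  replace (expi (IZR (2 * (Z.of_nat i - Z.of_nat N)) * t)) with (x ^ i * y ^ N).
  - unfold Cdiv. rewrite (Cpow_mult_l x), Cpow_inv by apply NQ. ring.
  - unfold x, y. rewrite !Cpow_mult_l, !expi_pow, <- !expi_add. f_equal.
    rewrite mult_IZR, minus_IZR, <- !INR_IZR_INZ. ring.
Qed.

Lemma Int_expi_ind (k : Z) :
  Int (fun t => expi (IZR k * t)) (if Z.eq_dec k 0 then 2 * PI else 0).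
Proof.
  destruct (Z.eq_dec k 0) as [-> | Hk]; [ | now apply Int_expi].
  replace (2 * PI) with (2 * PI * 1) by ring.
  eapply Int_ext; [ | exact (Int_const 1)]. intros x. cbv beta.
  now rewrite Rmult_0_l, expi_0.
Qed.

Lemma theta_fin_moment (N : nat) (k : Z) :
  Int (fun t => theta_fin N t * expi (IZR k * t))
    (psum (fun i => laurent_coef N i *
       (if Z.eq_dec (2 * (Z.of_nat i - Z.of_nat N) + k) 0 then 2 * PI else 0)) (S (2 * N))).
Proof.
  eapply Int_ext.
  2:{ apply (Int_psum (fun i t => laurent_coef N i
        * expi (IZR (2 * (Z.of_nat i - Z.of_nat N) + k) * t))).
      intros i. apply Int_scal, Int_expi_ind. }
  intros t. cbv beta. rewrite theta_fin_laurent, Cmult_comm, <- psum_scal.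
  apply psum_ext. intros i _. rewrite plus_IZR, Rmult_plus_distr_r, expi_add. ring.
Qed.

Lemma qpoch_near_qinf (x : C) (N : nat) : (Cmod x <= 1)%R ->
  (Cmod (qpoch x q N - qpoch_inf x q) <= upper_bound_qpoch q 1 * (near_1_const q * q ^ N))%R.
Proof.
  intros Hx. rewrite (qinf_split q Hq x N Hx).
  replace (qpoch x q N - qpoch x q N * qpoch_inf (x * q ^ N) q)
    with (qpoch x q N * - (qpoch_inf (x * q ^ N) q - 1)) by ring.
  apply Cmod_mult_le; [now apply qpoch_bound | ]. rewrite Cmod_opp.
  assert (Hn := near_1_const_pos q Hq).
  eapply Rle_trans; [apply qinf_near_1; [easy | ] | ].
  - generalize (Cmod_mul_qpow_le q Hq x N). lra.
  - apply Rmult_le_compat_l; [lra | ]. rewrite Cmod_mult, Cmod_qpow by easy.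
    generalize (qpow_le_1 q Hq N). nra.
Qed.

Lemma Cmod_expi2 (t : R) : Cmod (expi t * expi t) = 1%R.
Proof. rewrite Cmod_mult, Cmod_expi. ring. Qed.

Lemma theta_ulimit (g : R -> C) : (forall t, Cmod (g t) <= 1)%R ->
  ulimit (fun N t => theta_fin N t * g t) (fun t => theta t * g t).
Proof.
  intros Hg eps He.
  set (U := upper_bound_qpoch q 1). set (K := (U * near_1_const q)%R).
  assert (HU : (0 < U)%R) by apply upper_bound_pos.
  assert (HK : (0 < K)%R) by (apply Rmult_lt_0_compat; [easy | now apply near_1_const_pos]).
  destruct (qpow_to_0 q Hq (2 * U * K) eps He) as [N HN]; [nra | ].
  exists N. intros n Hn t. specialize (HN n Hn).
  set (x := expi t * expi t). set (y := q * (expi (- t) * expi (- t))).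
  assert (Hx : (Cmod x <= 1)%R) by (unfold x; rewrite Cmod_expi2; lra).
  assert (Hy : (Cmod y <= 1)%R).
  { unfold y. rewrite Cmod_mult, Cmod_expi2, Cmod_q; lra. }
  unfold theta_fin, theta. fold x y.
  replace (qpoch x q n * qpoch y q n * g t - qpoch_inf x q * qpoch_inf y q * g t)
    with (((qpoch x q n - qpoch_inf x q) * qpoch y q n
          + qpoch_inf x q * (qpoch y q n - qpoch_inf y q)) * g t) by ring.
  eapply Rle_trans; [ | exact HN].
  replace (2 * U * K * q ^ n)%R with ((K * q ^ n * U + U * (K * q ^ n)) * 1)%R by ring.
  assert (EK : (U * (near_1_const q * q ^ n) = K * q ^ n)%R) by (unfold K; ring).
  apply Cmod_mult_le; [ | apply Hg]. apply Cmod_plus_le; apply Cmod_mult_le.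
  - rewrite <- EK. now apply qpoch_near_qinf.
  - now apply qpoch_bound.
  - now apply qinf_bound.
  - rewrite <- EK. now apply qpoch_near_qinf.
Qed.

Lemma psum_single (u : nat -> C) (i n : nat) : (i < n)%nat ->
  (forall k, k <> i -> u k = 0) -> psum u n = u i.
Proof.
  intros Hi H. induction n as [ | n IH]; [lia | ]. simpl.
  destruct (Nat.eq_dec i n) as [-> | Hne].
  - replace (psum u n) with (RtoC 0); [ring | ].
    assert (E : forall k, (k < n)%nat -> u k = 0) by (intros k Hk; apply H; lia).
    rewrite (psum_ext u (fun _ => 0) n E). clear. induction n as [ | n IH]; simpl; [easy | ].
    rewrite <- IH. ring.
  - rewrite IH by lia. rewrite (H n) by lia. ring.
Qed.

Lemma theta_moment_odd (k : Z) : Int (fun t => theta t * expi (IZR (2 * k + 1) * t)) 0.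
Proof.
  destruct (Int_lim (fun N t => theta_fin N t * expi (IZR (2 * k + 1) * t))
    (fun t => theta t * expi (IZR (2 * k + 1) * t)) (fun _ => 0)) as [w [H1 H2]].
  - intros N.
    replace (RtoC 0) with (psum (fun i => laurent_coef N i *
       (if Z.eq_dec (2 * (Z.of_nat i - Z.of_nat N) + (2 * k + 1)) 0 then 2 * PI else 0))
       (S (2 * N))); [apply theta_fin_moment | ].
    generalize (S (2 * N)). intros n. induction n as [ | n IH]; [easy | ].
    cbn [psum]. rewrite IH. destruct (Z.eq_dec _ 0) as [E | _]; [lia | ring].
  - apply (theta_ulimit (fun t => expi (IZR (2 * k + 1) * t))).
    intros t. cbv beta. rewrite Cmod_expi. lra.
  - now rewrite (climit_unique _ _ _ (climit_const 0) H2).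
Qed.

Lemma tri_spec (n : nat) : (2 * tri n + n = n * n)%nat.
Proof.
  induction n as [ | n IH]; [easy | ]. rewrite tri_S. nia.
Qed.

(** With m = j - p this is Jacobi's coefficient (-1)^m q^(m(m-1)/2) / (q;q)_oo. Splitting m into two
    naturals avoids integer exponents and keeps the dependence on [j] in the shape of [q_binomial]
    with argument q^(-p). *)
Definition theta_coef (p j : nat) : C :=
  (-(1)) ^ p * q ^ tri (S p) * ((-(1)) ^ j * q ^ tri j * (/ q ^ p) ^ j) * / qpoch_inf q q.

Lemma m1_pow_double (n : nat) : (-(1)) ^ (n + n) = 1.
Proof.
  rewrite Cpow_add_r, <- Cpow_mult_l. replace (-(1) * -(1)) with (RtoC 1) by ring.
  apply Cpow_1_l.
Qed.

Lemma laurent_coef_eq (p j M : nat) : (j <= 2 * p + M)%nat ->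
  laurent_coef (p + M) (M + j) =
  (-(1)) ^ p * q ^ tri (S p) * ((-(1)) ^ j * q ^ tri j * (/ q ^ p) ^ j)
  * (qpoch q q (2 * (p + M)) * (Fc q (M + j) * Fc q (2 * p + M - j))).
Proof.
  intros Hj. unfold laurent_coef, Ec.
  replace (2 * (p + M) - (M + j))%nat with (2 * p + M - j)%nat by lia.
  assert (NQ := qpow_neq_0 q Hq).
  assert (ES : (-(1)) ^ (M + j) * (-(1)) ^ (p + M) = (-(1)) ^ p * (-(1)) ^ j).
  { rewrite <- !Cpow_add_r. replace (M + j + (p + M))%nat with (M + M + (p + j))%nat by lia.
    rewrite (Cpow_add_r _ (M + M)), m1_pow_double. ring. }
  assert (EQ : q ^ tri (M + j) * q ^ tri (S (p + M)) * / (q ^ (p + M)) ^ (M + j)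
               = q ^ tri (S p) * q ^ tri j * (/ q ^ p) ^ j).
  { rewrite Cpow_inv by apply NQ. rewrite <- !Cpow_mult_r.
    assert (EN : (tri (M + j) + tri (S (p + M)) + p * j
                  = tri (S p) + tri j + (p + M) * (M + j))%nat).
    { generalize (tri_spec (M + j)) (tri_spec (S (p + M))) (tri_spec (S p)) (tri_spec j). nia. }
    apply (f_equal (fun n => RtoC q ^ n)) in EN. rewrite !Cpow_add_r in EN.
    apply (f_equal (fun z => z * / q ^ (p * j) * / q ^ ((p + M) * (M + j)))) in EN.
    transitivity (q ^ tri (M + j) * q ^ tri (S (p + M)) * q ^ (p * j) * / q ^ (p * j) *
                  / q ^ ((p + M) * (M + j))).
    - field. split; apply NQ.
    - rewrite EN. field. split; apply NQ. }
  unfold Fc. unfold Cdiv.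
  transitivity (qpoch q q (2 * (p + M)) * (/ qpoch q q (M + j) * / qpoch q q (2 * p + M - j))
    * ((-(1)) ^ (M + j) * (-(1)) ^ (p + M))
    * (q ^ tri (M + j) * q ^ tri (S (p + M)) * / (q ^ (p + M)) ^ (M + j))); [ring | ].
  rewrite ES, EQ. ring.
Qed.

(** In the finite product with N = p + M, only the index i = M + j meets the frequency. As M grows,
    the q-factorials of that coefficient tend to (q;q)_oo / (q;q)_oo^2. *)
Lemma theta_moment (p j : nat) :
  Int (fun t => theta t * expi (IZR (2 * (Z.of_nat p - Z.of_nat j)) * t))
    (2 * PI * theta_coef p j).
Proof.
  set (k := (2 * (Z.of_nat p - Z.of_nat j))%Z).
  set (v := fun M => psum (fun i => laurent_coef (p + M) i *
    (if Z.eq_dec (2 * (Z.of_nat i - Z.of_nat (p + M)) + k) 0 then 2 * PI else 0))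
      (S (2 * (p + M)))).
  destruct (Int_lim (fun M t => theta_fin (p + M) t * expi (IZR k * t))
    (fun t => theta t * expi (IZR k * t)) v) as [w [H1 H2]].
  - intros M. apply theta_fin_moment.
  - intros eps He.
    destruct (theta_ulimit (fun t => expi (IZR k * t))
      ltac:(intros t; cbv beta; rewrite Cmod_expi; lra) eps He) as [N HN].
    exists N. intros n Hn t. apply HN. lia.
  - replace (2 * PI * theta_coef p j) with w; [exact H1 | ].
    apply (climit_unique v); [exact H2 | ].
    set (C0 := (-(1)) ^ p * q ^ tri (S p) * ((-(1)) ^ j * q ^ tri j * (/ q ^ p) ^ j)).
    assert (L : climit (fun M => 2 * PI * C0 * (qpoch q q (2 * (p + M))
        * (Fc q (M + j) * Fc q (2 * p + M - j)))) (2 * PI * theta_coef p j)).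
    { replace (2 * PI * theta_coef p j) with (2 * PI * C0 *
        (qpoch_inf q q * (/ qpoch_inf q q * / qpoch_inf q q))).
      2:{ unfold theta_coef. fold C0. field. apply qinf_neq_0; [easy | apply Cmod_q_lt_1]. }
      apply climit_scal, climit_mult; [ | apply climit_mult].
      - apply (climit_subseq (qpoch q q) _ (fun M => 2 * (p + M))%nat); [intros n; lia | ].
        apply qinf_climit; [easy | ]. generalize Cmod_q_lt_1. lra.
      - apply (climit_subseq (Fc q) _ (fun M => M + j)%nat); [intros n; lia | ].
        apply Fc_climit.
      - intros eps He. destruct (Fc_climit eps He) as [N HN]. exists (N + j)%nat.
        intros n Hn. apply HN. lia. }
    intros eps He. destruct (L eps He) as [N HN]. exists (N + j)%nat. intros M HM.
    specialize (HN M ltac:(lia)). unfold v.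
    rewrite (psum_single _ (M + j) (S (2 * (p + M)))) by
      (first [lia | intros i Hi; destruct (Z.eq_dec _ 0) as [E | _];
         [unfold k in E; lia | ring]]).
    destruct (Z.eq_dec _ 0) as [_ | E]; [ | unfold k in E; lia].
    rewrite laurent_coef_eq by lia.
    replace ((-(1)) ^ p * q ^ tri (S p) * ((-(1)) ^ j * q ^ tri j * (/ q ^ p) ^ j)) with C0 by easy.
    replace (C0 * (qpoch q q (2 * (p + M)) * (Fc q (M + j) * Fc q (2 * p + M - j))) * (2 * PI))
      with (2 * PI * C0 * (qpoch q q (2 * (p + M))
        * (Fc q (M + j) * Fc q (2 * p + M - j)))) by ring.
    exact HN.
Qed.

(** * The weight (e^{2it}, e^{-2it};q)_oo and the Rogers polynomials *)

Definition awnum (t : R) : C :=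
  qpoch_inf (expi t * expi t) q * qpoch_inf (expi (- t) * expi (- t)) q.

Lemma awnum_theta (t : R) : awnum t = theta t * (1 - expi (- t) * expi (- t)).
Proof.
  unfold awnum, theta.
  rewrite (qinf_step q Hq (expi (- t) * expi (- t))) by (rewrite Cmod_expi2; lra).
  rewrite (Cmult_comm q). ring.
Qed.

(** The coefficient of x^n in 1/(x e^{it}, x e^{-it};q)_oo, that is, the continuous q-Hermite
    polynomial of Rogers divided by (q;q)_n; see [ipair_diagonal]. *)
Definition rogers (n : nat) (t : R) : C :=
  diagonal (fun i j => Fc q i * Fc q j * (expi t ^ i * expi (- t) ^ j)) n.

Lemma qpoch_inv_qpow_0 (p m : nat) : (p < m)%nat -> qpoch (/ q ^ p) q m = 0.
Proof.
  intros H. replace m with (p + S (m - S p))%nat by lia. rewrite qpoch_add, qpoch_S_l.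
  rewrite Cinv_l by now apply qpow_neq_0. ring.
Qed.

(** For odd [n] only odd frequencies occur, and the theta product has none. For n = 2p the factor 1
    - e^{-2it} of the weight gives two q-binomial sums, multiples of (q^(-p);q)_n and (q^(1-p);q)_n,
    both of which contain a zero factor. *)
Lemma rogers_moment (n : nat) : (0 < n)%nat -> Int (fun t => awnum t * rogers n t) 0.
Proof.
  intros Hn.
  assert (E : forall t, awnum t * rogers n t =
    psum (fun k => Fc q (n - k) * Fc q k *
      (theta t * expi (IZR (Z.of_nat n - 2 * Z.of_nat k) * t)
       + -(1) * (theta t * expi (IZR (Z.of_nat n - 2 * Z.of_nat (S k)) * t)))) (S n)).
  { intros t. rewrite awnum_theta. unfold rogers, diagonal.
    transitivity (psum (fun k => theta t * (1 - expi (- t) * expi (- t)) *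
      (Fc q (n - k) * Fc q k * (expi t ^ (n - k) * expi (- t) ^ k))) (S n)).
    - rewrite psum_scal. f_equal.
      (* The sum is reversed so that e^{-it} carries the exponent [k]; multiplication by e^{-2it} is
         then the step from k to k+1 in the frequency. *)
      assert (RV : forall u : nat -> C, psum (fun k => u (n - k)%nat) (S n) = psum u (S n)).
      { clear. intros u. induction n as [ | n IH]; [easy | ].
        rewrite psum_S_l.
        transitivity (u (S n) + psum u (S n)); [ | simpl; ring].
        rewrite Nat.sub_0_r. f_equal. rewrite <- IH. now apply psum_ext. }
      rewrite <- (RV (fun k => Fc q k * Fc q (n - k) * (expi t ^ k * expi (- t) ^ (n - k)))).
      apply psum_ext. intros k Hk. now replace (n - (n - k))%nat with k by lia.
    - apply psum_ext. intros k Hk.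
      replace (expi (IZR (Z.of_nat n - 2 * Z.of_nat k) * t))
        with (expi t ^ (n - k) * expi (- t) ^ k).
      2:{ rewrite !expi_pow, <- expi_add. f_equal. rewrite minus_INR by lia.
          rewrite minus_IZR, mult_IZR, <- !INR_IZR_INZ. ring. }
      replace (expi (IZR (Z.of_nat n - 2 * Z.of_nat (S k)) * t))
        with (expi t ^ (n - k) * expi (- t) ^ k * (expi (- t) * expi (- t))).
      2:{ rewrite !expi_pow, <- !expi_add. f_equal. rewrite minus_INR by lia.
          rewrite minus_IZR, mult_IZR, <- !INR_IZR_INZ, S_INR. ring. }
      ring. }
  eapply Int_ext; [intros t; symmetry; apply E | ].
  destruct (Nat.Even_or_Odd n) as [[p Hp] | [p Hp]].
  - set (v := fun k => Fc q (n - k) * Fc q k *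
       (2 * PI * theta_coef p k + -(1) * (2 * PI * theta_coef p (S k)))).
    replace (RtoC 0) with (psum v (S n)).
    + apply (Int_psum (fun k t => Fc q (n - k) * Fc q k *
      (theta t * expi (IZR (Z.of_nat n - 2 * Z.of_nat k) * t)
       + -(1) * (theta t * expi (IZR (Z.of_nat n - 2 * Z.of_nat (S k)) * t))))).
      intros k. apply Int_scal, Int_plus; [ | apply Int_scal].
      * replace (Z.of_nat n - 2 * Z.of_nat k)%Z with (2 * (Z.of_nat p - Z.of_nat k))%Z by lia.
        apply theta_moment.
      * replace (Z.of_nat n - 2 * Z.of_nat (S k))%Z
          with (2 * (Z.of_nat p - Z.of_nat (S k)))%Z by lia.
        apply theta_moment.
    + assert (NQ := qpow_neq_0 q Hq).
      set (C1 := 2 * PI * ((-(1)) ^ p * q ^ tri (S p) * / qpoch_inf q q)).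
      rewrite (psum_ext v (fun k => C1 * (Ec q k * Fc q (n - k) * (/ q ^ p) ^ k)
         + C1 * / q ^ p * (Ec q k * Fc q (n - k) * (/ q ^ (p - 1)) ^ k))).
      * rewrite psum_plus, !psum_scal, !q_binomial.
        rewrite !qpoch_inv_qpow_0 by lia. ring.
      * intros k _. unfold v, theta_coef, C1, Ec. rewrite (tri_S k), (Cpow_add_r q (tri k)).
        replace ((/ q ^ (p - 1)) ^ k) with (q ^ k * (/ q ^ p) ^ k).
        2:{ rewrite !Cpow_inv by apply NQ. rewrite <- !Cpow_mult_r.
            replace (p * k)%nat with (k + (p - 1) * k)%nat by nia.
            rewrite Cpow_add_r. field. split; apply NQ. }
        unfold Fc. rewrite !(Cpow_S _ k). unfold Cdiv. ring.
  - replace (RtoC 0) with (psum (fun _ => 0) (S n)).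
    2:{ generalize (S n). intros m. induction m as [ | m IH]; simpl; [easy | rewrite IH; ring]. }
    apply (Int_psum (fun k t => Fc q (n - k) * Fc q k *
      (theta t * expi (IZR (Z.of_nat n - 2 * Z.of_nat k) * t)
       + -(1) * (theta t * expi (IZR (Z.of_nat n - 2 * Z.of_nat (S k)) * t)))) (fun _ => 0)).
    intros k. replace (RtoC 0) with (Fc q (n - k) * Fc q k * (0 + -(1) * 0)) by ring.
    apply Int_scal, Int_plus; [ | apply Int_scal].
    + replace (Z.of_nat n - 2 * Z.of_nat k)%Z with (2 * (Z.of_nat p - Z.of_nat k) + 1)%Z by lia.
      apply theta_moment_odd.
    + replace (Z.of_nat n - 2 * Z.of_nat (S k))%Z
        with (2 * (Z.of_nat p - Z.of_nat (S k)) + 1)%Z by lia.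
      apply theta_moment_odd.
Qed.

(** The two theta coefficients involved are 1 and -1 over (q;q)_oo; their difference doubles 2
    PI. *)
Lemma awnum_Int : Int awnum (4 * PI * / qpoch_inf q q).
Proof.
  replace (4 * PI * / qpoch_inf q q)
    with (2 * PI * theta_coef 0 0 + -(1) * (2 * PI * theta_coef 0 1)).
  2:{ unfold theta_coef. change (tri 1) with O. change (tri 0) with O. simpl.
      field. apply qinf_neq_0; [easy | apply Cmod_q_lt_1]. }
  eapply Int_ext.
  2:{ exact (Int_plus _ _ _ _ (theta_moment 0 0) (Int_scal (-(1)) _ _ (theta_moment 0 1))). }
  intros t. cbv beta. rewrite awnum_theta, <- !expi_add.
  replace (IZR (2 * (Z.of_nat 0 - Z.of_nat 0)) * t)%R with 0%R by (simpl; ring).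
  replace (IZR (2 * (Z.of_nat 0 - Z.of_nat 1)) * t)%R with (- t + - t)%R by (simpl; ring).
  rewrite expi_0. ring.
Qed.

End Theta.

(** * The integral with five parameters *)

Lemma csums_scal_r (k : C) (u : nat -> C) (l : C) :
  csums u l -> csums (fun n => u n * k) (l * k).
Proof.
  intros H. rewrite Cmult_comm. eapply csums_ext; [ | exact (csums_scal k _ _ H)].
  intros n. apply Cmult_comm.
Qed.

Section FiveParameters.
Context (q : R) (Hq : (0 < q < 1)%R).

Definition ipair (x : C) (t : R) : C :=
  / qpoch_inf (x * expi t) q * / qpoch_inf (x * expi (- t)) q.

Definition w5 (a b c d r : C) (t : R) : C :=
  awnum q t * (ipair a t * ipair b t * ipair c t * ipair d t * ipair r t).

Definition integral (a b c d r : C) : C :=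
  RInt (V := C_R_CompleteNormedModule) (w5 a b c d r) (- PI) PI.

Lemma Cmod_mul_expi (x : C) (t : R) : Cmod (x * expi t) = Cmod x.
Proof. rewrite Cmod_mult, Cmod_expi. ring. Qed.

Lemma ipair_0 (t : R) : ipair 0 t = 1.
Proof.
  unfold ipair. rewrite !Cmult_0_l, qinf_0 by easy. field.
Qed.

Section Disc.
Context (rho : R) (Hrho : (0 < rho < 1)%R).

Lemma ulim_ipair (f : R -> C -> C) (A : R) : (A < 1)%R -> ulim rho f -> bounded rho f A ->
  ulim rho (fun t b => ipair (f t b) t).
Proof.
  intros HA Hf HB. unfold ipair. apply ulim_mul; try easy.
  - apply (ulim_inv_qinf rho Hrho q (fun t b => f t b * expi t) A); try easy.
    + apply ulim_mul; [easy | easy | apply ulim_expi].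
    + intros t b Hb. rewrite Cmod_mul_expi. now apply HB.
  - apply (ulim_inv_qinf rho Hrho q (fun t b => f t b * expi (- t)) A); try easy.
    + apply ulim_mul; [easy | easy | apply ulim_expi_opp].
    + intros t b Hb. rewrite Cmod_mul_expi. now apply HB.
Qed.

Lemma ulim_ipair_const (x : C) : (Cmod x < 1)%R -> ulim rho (fun t _ => ipair x t).
Proof.
  intros Hx. apply (ulim_ipair (fun _ _ => x) (Cmod x)); [easy | apply ulim_const | ].
  intros t b _. lra.
Qed.

Lemma ulim_ipair_var : ulim rho (fun t b => ipair b t).
Proof.
  apply (ulim_ipair (fun _ b => b) rho); [easy | apply ulim_var | ].
  intros t b Hb. exact Hb.
Qed.

Lemma ulim_awnum : ulim rho (fun t _ => awnum q t).
Proof.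
  unfold awnum. apply ulim_mul; try easy.
  - apply (ulim_qinf rho Hrho q (fun t _ => expi t * expi t)); try easy.
    + apply ulim_mul; try easy; apply ulim_expi.
    + intros t b _. rewrite Cmod_expi2. lra.
  - apply (ulim_qinf rho Hrho q (fun t _ => expi (- t) * expi (- t))); try easy.
    + apply ulim_mul; try easy; apply ulim_expi_opp.
    + intros t b _. rewrite Cmod_expi2. lra.
Qed.

Lemma ulim_w5_var (a c d r : C) :
  (Cmod a < 1)%R -> (Cmod c < 1)%R -> (Cmod d < 1)%R -> (Cmod r < 1)%R ->
  ulim rho (fun t b => w5 a b c d r t).
Proof.
  intros. unfold w5. apply ulim_mul; [easy | apply ulim_awnum | ].
  do 3 (apply ulim_mul; [easy | | now apply ulim_ipair_const]).
  apply ulim_mul; [easy | now apply ulim_ipair_const | apply ulim_ipair_var].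
Qed.

End Disc.

Lemma integral_eq (a b c d r v : C) : Int (w5 a b c d r) v -> integral a b c d r = v.
Proof. apply (is_RInt_unique (V := C_R_CompleteNormedModule)). Qed.

(** The radius [rho] is taken between |b| and 1, so that [b] lies in a disc on which the weight is a
    uniform limit of trigonometric polynomials. *)
Lemma w5_Int (a b c d r : C) :
  (Cmod a < 1)%R -> (Cmod b < 1)%R -> (Cmod c < 1)%R -> (Cmod d < 1)%R -> (Cmod r < 1)%R ->
  Int (w5 a b c d r) (integral a b c d r).
Proof.
  intros. set (rho := ((1 + Cmod b) / 2)%R). assert (Hb := Cmod_ge_0 b).
  assert (Hrho : (0 < rho < 1)%R) by (unfold rho; lra).
  destruct (ulim_Int rho (fun t b => w5 a b c d r t) b (ulim_w5_var rho Hrho a c d r ltac:(easy)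
    ltac:(easy) ltac:(easy) ltac:(easy)) ltac:(unfold rho; lra)) as [v Hv].
  now rewrite (integral_eq _ _ _ _ _ v Hv).
Qed.

Lemma integral_ext (a b c d r a' b' c' d' r' : C) :
  (forall t, w5 a b c d r t = w5 a' b' c' d' r' t) ->
  integral a b c d r = integral a' b' c' d' r'.
Proof. intros E. apply (RInt_ext (V := C_R_CompleteNormedModule)). intros t _. apply E. Qed.

Lemma ipair_mul_q (x : C) (t : R) : (Cmod x < 1)%R ->
  ipair (x * q) t = (1 - x * expi t) * (1 - x * expi (- t)) * ipair x t.
Proof.
  intros Hx. unfold ipair.
  replace (x * q * expi t) with (x * expi t * q) by ring.
  replace (x * q * expi (- t)) with (x * expi (- t) * q) by ring.
  assert (H1 : (Cmod (x * expi t) < 1)%R) by now rewrite Cmod_mul_expi.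
  assert (H2 : (Cmod (x * expi (- t)) < 1)%R) by now rewrite Cmod_mul_expi.
  rewrite !qinf_mul_q by assumption.
  assert (N1 := qinf_neq_0 q Hq _ H1). assert (N2 := qinf_neq_0 q Hq _ H2).
  assert (M1 := one_minus_neq_0 _ H1). assert (M2 := one_minus_neq_0 _ H2).
  set (m1 := 1 - x * expi t) in *. set (m2 := 1 - x * expi (- t)) in *.
  field. repeat split; assumption.
Qed.

Lemma integral_recurrence (a b c d r : C) :
  (Cmod a < 1)%R -> (Cmod b < 1)%R -> (Cmod c < 1)%R -> (Cmod d < 1)%R -> (Cmod r < 1)%R ->
  r * integral a (b * q) c d r - b * integral a b c d (r * q)
  = (r - b) * (1 - b * r) * integral a b c d r.
Proof.
  intros Ha Hb Hc Hd Hr.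
  assert (Hbq := Cmod_mul_q_lt q Hq b Hb). assert (Hrq := Cmod_mul_q_lt q Hq r Hr).
  apply (Int_unique (fun t => (r - b) * (1 - b * r) * w5 a b c d r t)).
  2:{ apply Int_scal. now apply w5_Int. }
  replace (r * integral a (b * q) c d r - b * integral a b c d (r * q))
    with (r * integral a (b * q) c d r + - b * integral a b c d (r * q)) by ring.
  eapply Int_ext.
  2:{ apply Int_plus; apply Int_scal; [apply (w5_Int a (b * q) c d r) |
        apply (w5_Int a b c d (r * q))]; assumption. }
  intros t. cbv beta. unfold w5. rewrite !ipair_mul_q by assumption.
  assert (E := expi_opp_r t). set (e := expi t) in *. set (e' := expi (- t)) in *.
  transitivity (awnum q t * (ipair a t * ipair b t * ipair c t * ipair d t * ipair r t)
    * ((r - b) * (1 - (e * e') * b * r))); [ring | ].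
  rewrite E. ring.
Qed.

Lemma awnum_bound (t : R) :
  (Cmod (awnum q t) <= upper_bound_qpoch q 1 * upper_bound_qpoch q 1)%R.
Proof.
  unfold awnum. apply Cmod_mult_le; (apply qinf_bound; [easy | ]);
    rewrite Cmod_expi2; lra.
Qed.

(** Generating function of the Rogers polynomials, as the Cauchy product of Euler's two
    expansions. *)
Lemma ipair_diagonal (x : C) (t : R) : (Cmod x < 1)%R ->
  csums (fun n => x ^ n * rogers q n t) (ipair x t).
Proof.
  intros Hx. assert (HL := lower_bound_pos q q).
  assert (H1 : (Cmod (x * expi t) < 1)%R) by now rewrite Cmod_mul_expi.
  assert (H2 : (Cmod (x * expi (- t)) < 1)%R) by now rewrite Cmod_mul_expi.
  apply csums_ext with (diagonal (fun i j => (Fc q i * (x * expi t) ^ i)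
    * (Fc q j * (x * expi (- t)) ^ j))).
  - intros n. unfold rogers, diagonal. rewrite <- psum_scal. apply psum_ext.
    intros k Hk. replace (x ^ n) with (x ^ k * x ^ (n - k)).
    + rewrite !Cpow_mult_l. ring.
    + rewrite <- Cpow_add_r. f_equal. lia.
  - apply csums_diagonal with (s := fun i => Fc q i * (x * expi t) ^ i * / qpoch_inf (x * expi (- t)) q)
      (K := (lower_bound_qpoch q q * lower_bound_qpoch q q)%R) (x := Cmod x).
    + split; [apply Cmod_ge_0 | easy].
    + nra.
    + intros k j.
      replace (lower_bound_qpoch q q * lower_bound_qpoch q q * Cmod x ^ k * Cmod x ^ j)%R
        with ((lower_bound_qpoch q q * Cmod x ^ k) * (lower_bound_qpoch q q * Cmod x ^ j))%R by ring.
      apply Cmod_mult_le; (apply Fc_bound; [easy | ]); rewrite Cmod_mul_expi; lra.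
    + intros k. apply csums_scal. now apply inv_qinf_series.
    + unfold ipair. apply csums_scal_r. now apply inv_qinf_series.
Qed.

Lemma rogers_bound (n : nat) (t : R) :
  (Cmod (rogers q n t) <= lower_bound_qpoch q q * lower_bound_qpoch q q * (INR n + 1))%R.
Proof.
  assert (H := diagonal_bound (fun i j => Fc q i * Fc q j * (expi t ^ i * expi (- t) ^ j))
    (lower_bound_qpoch q q * lower_bound_qpoch q q) 1 n).
  rewrite pow1, Rmult_1_r in H. apply H; [lra | ]. clear H. intros k j.
  rewrite !pow1, !Rmult_1_r.
  assert (HF : forall i s, (Cmod (Fc q i * expi s ^ i) <= lower_bound_qpoch q q)%R).
  { intros i s. rewrite <- (Rmult_1_r (lower_bound_qpoch q q)), <- (pow1 i).
    apply Fc_bound; [easy | ]. rewrite Cmod_expi. lra. }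
  replace (Fc q k * Fc q j * (expi t ^ k * expi (- t) ^ j))
    with ((Fc q k * expi t ^ k) * (Fc q j * expi (- t) ^ j)) by ring.
  apply Cmod_mult_le; apply HF.
Qed.

(** After expansion in Rogers polynomials every term but n = 0 integrates to 0, and that term does
    not involve [r]. Their linear growth in n is harmless against |r|^n. *)
Lemma integral_one_parameter (r : C) : (Cmod r < 1)%R ->
  integral 0 0 0 0 r = 4 * PI * / qpoch_inf q q.
Proof.
  intros Hr. apply integral_eq.
  set (U := upper_bound_qpoch q 1). set (L := lower_bound_qpoch q q).
  assert (HU : (0 < U)%R) by apply upper_bound_pos.
  assert (HL : (0 < L)%R) by apply lower_bound_pos.
  set (v := fun n : nat => match n with O => 4 * PI * / qpoch_inf q q | S _ => 0 end).
  destruct (Int_csums (fun n t => r ^ n * (awnum q t * rogers q n t)) (w5 0 0 0 0 r) v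
    (fun n => (U * U * (L * L)) * (INR n + 1) * Cmod r ^ n)%R) as [w [H1 H2]].
  - apply summable_arith_geom; [split; [apply Cmod_ge_0 | easy] | nra].
  - intros n t.
    replace (U * U * (L * L) * (INR n + 1) * Cmod r ^ n)%R
      with (Cmod r ^ n * ((U * U) * (L * L * (INR n + 1))))%R by ring.
    apply Cmod_mult_le; [rewrite Cmod_pow; lra | ]. apply Cmod_mult_le.
    + apply awnum_bound.
    + apply rogers_bound.
  - intros t. unfold w5. rewrite !ipair_0, !Cmult_1_l.
    apply csums_ext with (fun n => awnum q t * (r ^ n * rogers q n t)); [intros n; ring | ].
    apply csums_scal. now apply ipair_diagonal.
  - intros [ | n].
    + eapply Int_ext; [ | exact (awnum_Int q Hq)]. intros t. simpl.
      unfold rogers, diagonal, Fc. simpl. field.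
    + replace (v (S n)) with (r ^ S n * 0) by (simpl v; ring).
      apply Int_scal. apply rogers_moment; [easy | lia].
  - replace (4 * PI * / qpoch_inf q q) with w; [exact H1 | ].
    apply (csums_unique v); [exact H2 | ].
    replace (4 * PI * / qpoch_inf q q) with (psum v 1) by (simpl; ring).
    apply csums_finite. intros [ | n] Hn; [lia | easy].
Qed.

(** * The closed form as a uniform limit of polynomials in [b] *)

Section ValueUlim.
Context (rho : R) (Hrho : (0 < rho < 1)%R).

(* A reciprocal can be pulled through a product only for nonvanishing factors. *)
Definition ulim_inv (f : R -> C -> C) : Prop :=
  ulim rho (fun t b => / f t b) /\ forall t b, (Cmod b <= rho)%R -> f t b <> 0.

Lemma ulim_inv_mul (f g : R -> C -> C) : ulim_inv f -> ulim_inv g ->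
  ulim_inv (fun t b => f t b * g t b).
Proof.
  intros [Hf1 Hf2] [Hg1 Hg2]. split.
  - apply ulim_ext with (fun t b => / f t b * / g t b).
    + intros t b Hb. field. auto.
    + now apply ulim_mul.
  - intros t b Hb. apply Cmult_neq_0; auto.
Qed.

Lemma ulim_inv_qinf_inv (f : R -> C -> C) (A : R) : (A < 1)%R -> ulim rho f ->
  bounded rho f A -> ulim_inv (fun t b => qpoch_inf (f t b) q).
Proof.
  intros HA Hf HB. split; [now apply ulim_inv_qinf with A | ].
  intros t b Hb. apply qinf_neq_0; [easy | ]. generalize (HB t b Hb). lra.
Qed.

Lemma ulim_inv_qpoch_inv (f : R -> C -> C) (A : R) (n : nat) : (A < 1)%R -> ulim rho f ->
  bounded rho f A -> ulim_inv (fun t b => qpoch (f t b) q n).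
Proof.
  intros HA Hf HB. split; [now apply ulim_inv_qpoch with A | ].
  intros t b Hb. apply qpoch_neq_0; [easy | ]. generalize (HB t b Hb). lra.
Qed.

Context (a c d r : C) (A : R) (HA : (0 <= A < 1)%R)
  (Ha : in_disc A a) (HrA : (rho <= A)%R) (Hc : in_disc A c) (Hd : in_disc A d)
  (Hr : in_disc A r) (HqA : (q <= A)%R).

(** Products such as a b c d are viewed as functions of [b]. Membership in the disc of radius [A] <
    1 is carried along because reciprocals of infinite products require it. *)
Let good (f : C -> C) : Prop :=
  ulim rho (fun _ b => f b) /\ forall b, (Cmod b <= rho)%R -> in_disc A (f b).

Lemma good_const (x : C) : in_disc A x -> good (fun _ => x).
Proof. intros Hx. split; [apply ulim_const | auto]. Qed.

Lemma good_var : good (fun b => b).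
Proof. split; [apply ulim_var | ]. intros b Hb. unfold in_disc. lra. Qed.

Lemma good_mul (f g : C -> C) : good f -> good g -> good (fun b => f b * g b).
Proof.
  intros [Hf1 Hf2] [Hg1 Hg2]. split; [now apply ulim_mul | ].
  intros b Hb. apply in_disc_mul; [lra | auto | ].
  apply in_disc_weaken with A; [lra | auto].
Qed.

Lemma good_qinf (f : C -> C) : good f -> ulim rho (fun _ b => qpoch_inf (f b) q).
Proof.
  intros [Hf1 Hf2]. apply (ulim_qinf rho Hrho q (fun _ b => f b)); try easy.
  intros t b Hb. specialize (Hf2 b Hb). unfold in_disc in Hf2. lra.
Qed.

Lemma good_inv_qinf (f : C -> C) : good f -> ulim_inv (fun _ b => qpoch_inf (f b) q).
Proof.
  intros [Hf1 Hf2]. apply (ulim_inv_qinf_inv (fun _ b => f b) A); easy.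
Qed.

Lemma good_inv_qpoch (f : C -> C) (n : nat) : good f ->
  ulim_inv (fun _ b => qpoch (f b) q n).
Proof.
  intros [Hf1 Hf2]. apply (ulim_inv_qpoch_inv (fun _ b => f b) A); easy.
Qed.

Lemma good_qpoch (f : C -> C) (n : nat) : good f -> ulim rho (fun _ b => qpoch (f b) q n).
Proof. intros [Hf _]. now apply (ulim_qpoch rho Hrho q (fun _ b => f b)). Qed.

Lemma good_ulim (f : C -> C) : good f -> ulim rho (fun _ b => f b).
Proof. now intros [Hf _]. Qed.

Lemma good_q : in_disc A q.
Proof. unfold in_disc. rewrite Cmod_q; lra. Qed.

Lemma good_vwp (f : C -> C) (n : nat) : good f -> ulim rho (fun _ b => vwp q (f b) n).
Proof.
  intros [Hf _]. destruct n as [ | m]; simpl; [apply ulim_const | ].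
  apply ulim_mul; try easy.
  - apply ulim_minus; try easy; [apply ulim_const | ].
    apply ulim_mul; try easy. apply ulim_const.
  - now apply (ulim_qpoch rho Hrho q (fun _ b => f b)).
Qed.

(** Descends along the product structure. The constant pattern precedes the product one, since a
    product free of [b] matches both. *)
Ltac good_tac := lazymatch goal with
  | |- good (fun _ => ?k) => apply good_const;
      repeat (apply in_disc_mul; [lra | | apply in_disc_weaken with A; [lra | ]]);
      assumption || apply good_q
  | |- good (fun b => b) => apply good_var
  | |- good (fun b => @?f b * @?g b) => apply (good_mul f g); good_tac
  end.

Lemma ulim_value : ulim rho (fun _ b => value q a b c d r).
Proof.
  unfold value. apply ulim_mul; [easy | | ].
  - apply ulim_scal; [easy | ]. unfold prefac. apply ulim_mul; [easy | | ].
    + repeat (apply ulim_mul; [easy | | ]); apply good_qinf; good_tac.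
    + refine (proj1 (_ : ulim_inv _)). unfold kap.
      repeat apply ulim_inv_mul;
      lazymatch goal with |- ulim_inv (fun t b => qpoch_inf (@?f b) q) =>
        apply (good_inv_qinf f) end; good_tac.
  - apply ulim_series with (u := fun n _ b => vwp_term q a b c d r n)
      (M := fun n => (weighted_bound q A * A ^ n)%R).
    + intros n. unfold vwp_term, weighted_term.
      apply ulim_mul; [easy | | apply ulim_const].
      apply ulim_mul; [easy | | ].
      * apply ulim_mul; [easy | | ]; [apply ulim_mul; [easy | | ] | ].
        -- apply good_vwp. unfold kap. good_tac.
        -- repeat (apply ulim_mul; [easy | | ]);
           lazymatch goal with |- ulim rho (fun t b => qpoch (@?f b) q _) =>
             apply (good_qpoch f) end; good_tac.
        -- refine (proj1 (_ : ulim_inv _)). repeat apply ulim_inv_mul;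
           lazymatch goal with |- ulim_inv (fun t b => qpoch (@?f b) q _) =>
             apply (good_inv_qpoch f) end; good_tac.
      * apply (ulim_pow rho Hrho (fun _ b => - (b * c * d * r))).
        apply ulim_ext with (fun _ b => -(1) * (b * c * d * r)); [intros; ring | ].
        apply ulim_scal; [easy | ].
        apply (good_ulim (fun b => b * c * d * r)). good_tac.
    + apply summable_geom; [easy | ]. left. apply weighted_bound_pos.
    + intros n t b Hb. assert (Hb' : in_disc A b) by (unfold in_disc; lra).
      eapply Rle_trans; [apply (vwp_term_bound q Hq A); auto | ].
      apply Rmult_le_compat_l; [left; apply weighted_bound_pos | ].
      apply pow_incr. split; [apply Cmod_ge_0 | ]. now apply prod4_in_disc.
    + intros t b Hb. unfold in_disc in *. apply vwp_csums; [easy | lra ..].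
Qed.

End ValueUlim.

Lemma integral_swap (a b c d r : C) : integral a r c d b = integral a b c d r.
Proof. apply integral_ext. intros t. unfold w5. ring. Qed.

Lemma integral_value_step (a c d : C) :
  (Cmod a < 1)%R -> (Cmod c < 1)%R -> (Cmod d < 1)%R ->
  (forall r, (Cmod r < 1)%R -> integral a 0 c d r = value q a 0 c d r) ->
  forall b r, (Cmod b < 1)%R -> (Cmod r < 1)%R -> integral a b c d r = value q a b c d r.
Proof.
  intros Ha Hc Hd H0 b r Hb Hr.
  (* The functional equation says nothing at r = 0; the symmetry in b and r turns this case into the
     assumption at b = 0. *)
  destruct (Ceq_dec r 0) as [-> | Hr0].
  { rewrite <- integral_swap, <- value_swap. now apply H0. }
  set (rho := ((1 + Cmod b) / 2)%R). assert (Hb0 := Cmod_ge_0 b).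
  assert (Hrho : (0 < rho < 1)%R) by (unfold rho; lra).
  apply Ceq_minus.
  apply (functional_equation_unique q Hq rho Hrho
    (fun r b => integral a b c d r - value q a b c d r)); try easy.
  - intros r' _ Hr'.
    (* The closed form goes under the integral as a constant in [t], divided by the length 2 PI of
       the interval, so that the whole difference is one integral. *)
    apply (ulimpoly_Int rho (fun t b => w5 a b c d r' t - / (2 * PI) * value q a b c d r')).
    + apply ulim_minus; [easy | now apply ulim_w5_var | ]. apply ulim_scal; [easy | ].
      assert (Hq1 : (Cmod q < 1)%R) by (apply Cmod_q_lt_1; easy).
      assert (Hrh : Cmod rho = rho) by (rewrite Cmod_R; apply Rabs_pos_eq; lra).
      destruct (common_disc a rho c d r') as [A [HA [A1 [A2 [A3 [A4 A5]]]]]]; auto; [lra | ].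
      unfold in_disc in A2. rewrite Hrh in A2.
      (* The common radius must dominate [q] too, since (q;q)_oo and (q;q)_n are among the
         denominators. *)
      assert (M1 := Rmax_l A q). assert (M2 := Rmax_r A q).
      assert (M3 : (Rmax A q < 1)%R) by now apply Rmax_lub_lt.
      unfold in_disc in *.
      apply (ulim_value rho Hrho a c d r' (Rmax A q)); unfold in_disc; lra.
    + intros b' Hb'. assert (NP := C_2PI_neq_0).
      replace (integral a b' c d r' - value q a b' c d r')
        with (integral a b' c d r' + -(1) * (2 * PI * (/ (2 * PI) * value q a b' c d r'))).
      2:{ set (p := 2 * PI) in *. field. exact NP. }
      eapply Int_ext.
      2:{ apply Int_plus; [apply (w5_Int a b' c d r'); auto; lra | ].
          apply Int_scal, Int_const. }
      intros t. cbv beta. ring.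
  - intros r' _ Hr'. rewrite H0 by easy. ring.
  - intros r' b' _ Hr' Hb'. assert (Hb1 : (Cmod b' < 1)%R) by lra.
    assert (E1 := integral_recurrence a b' c d r' Ha Hb1 Hc Hd Hr').
    assert (E2 := value_recurrence q Hq a b' c d r' Ha Hb1 Hc Hd Hr').
    transitivity ((r' * integral a (b' * q) c d r' - b' * integral a b' c d (r' * q))
      - (r' * value q a (b' * q) c d r' - b' * value q a b' c d (r' * q))); [ring | ].
    rewrite E1, E2. ring.
  - unfold rho. lra.
Qed.

End FiveParameters.

(** * Evaluation of the integral and the shift of the first parameter *)

Lemma Int_half (f : R -> C) (W : C) : (forall t, f (- t)%R = f t) -> Int f W ->
  is_RInt (V := C_R_NormedModule) f 0 PI (W / 2).
Proof.
  intros Hf HW. assert (HPI := PI_RGT_0).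
  assert (HE : ex_RInt (V := C_R_CompleteNormedModule) f 0 PI).
  { apply (ex_RInt_Chasles_2 (V := C_R_CompleteNormedModule) f (- PI)); [lra | ].
    now exists W. }
  destruct HE as [I HI].
  assert (HI2 : is_RInt (V := C_R_NormedModule) f (- PI) 0 I).
  { assert (H1 := is_RInt_swap (V := C_R_NormedModule) _ _ _ _ HI).
    rewrite <- (Ropp_involutive PI), <- Ropp_0 in H1.
    apply (is_RInt_comp_opp (V := C_R_NormedModule)) in H1.
    apply (is_RInt_opp (V := C_R_NormedModule)) in H1.
    rewrite opp_opp in H1.
    eapply is_RInt_ext; [ | exact H1]. intros t _. cbv beta. rewrite opp_opp. apply Hf. }
  assert (HS := is_RInt_Chasles (V := C_R_NormedModule) _ _ _ _ _ _ HI2 HI).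
  assert (E : W = Cplus I I) by exact (Int_unique f W _ HW HS).
  assert (F : forall x : C, Cplus x x / 2 = x).
  { intros x. field. }
  rewrite E, F. exact HI.
Qed.

Section Final.
Context (q : R) (Hq : (0 < q < 1)%R).

Lemma weighted_term_swap_bc (w a b c d r : C) (n : nat) :
  weighted_term q w a c b d r n = weighted_term q w a b c d r n.
Proof.
  unfold weighted_term.
  replace (a * c * b * d) with (a * b * c * d) by ring.
  replace (a * c * b * r) with (a * b * c * r) by ring.
  replace (c * b * d * r) with (b * c * d * r) by ring.
  replace (qpoch q q n * qpoch (a * b * c * d) q n * qpoch (a * b * c * r) q n *
     qpoch (a * c * d * r) q n * qpoch (a * b * d * r) q n) with
    (qpoch q q n * qpoch (a * b * c * d) q n * qpoch (a * b * c * r) q n *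
     qpoch (a * b * d * r) q n * qpoch (a * c * d * r) q n) by ring.
  ring.
Qed.

Lemma prefac_swap_bc (a b c d r : C) : prefac q a c b d r = prefac q a b c d r.
Proof.
  unfold prefac.
  replace (kap a c b d r) with (kap a b c d r) by (unfold kap; ring).
  replace (a * c * b * d) with (a * b * c * d) by ring.
  replace (a * c * b * r) with (a * b * c * r) by ring.
  replace (c * b) with (b * c) by ring.
  f_equal; [ring | f_equal; ring].
Qed.

Lemma value_swap_bc (a b c d r : C) : value q a c b d r = value q a b c d r.
Proof.
  unfold value. rewrite prefac_swap_bc. f_equal. apply vwp_sum_ext. intros n.
  unfold vwp_term. rewrite weighted_term_swap_bc.
  now replace (kap a c b d r) with (kap a b c d r) by (unfold kap; ring).
Qed.

Lemma weighted_term_swap_cd (w a b c d r : C) (n : nat) :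
  weighted_term q w a b d c r n = weighted_term q w a b c d r n.
Proof.
  unfold weighted_term.
  replace (a * b * d * c) with (a * b * c * d) by ring.
  replace (a * d * c * r) with (a * c * d * r) by ring.
  replace (b * d * c * r) with (b * c * d * r) by ring.
  replace (qpoch q q n * qpoch (a * b * c * d) q n * qpoch (a * b * d * r) q n *
     qpoch (a * b * c * r) q n * qpoch (a * c * d * r) q n) with
    (qpoch q q n * qpoch (a * b * c * d) q n * qpoch (a * b * c * r) q n *
     qpoch (a * b * d * r) q n * qpoch (a * c * d * r) q n) by ring.
  ring.
Qed.

Lemma prefac_swap_cd (a b c d r : C) : prefac q a b d c r = prefac q a b c d r.
Proof.
  unfold prefac.
  replace (kap a b d c r) with (kap a b c d r) by (unfold kap; ring).
  replace (a * b * d * c) with (a * b * c * d) by ring.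
  replace (a * d * c * r) with (a * c * d * r) by ring.
  replace (d * c) with (c * d) by ring.
  f_equal; [ring | f_equal; ring].
Qed.

Lemma value_swap_cd (a b c d r : C) : value q a b d c r = value q a b c d r.
Proof.
  unfold value. rewrite prefac_swap_cd. f_equal. apply vwp_sum_ext. intros n.
  unfold vwp_term. rewrite weighted_term_swap_cd.
  now replace (kap a b d c r) with (kap a b c d r) by (unfold kap; ring).
Qed.

Lemma vwp_0 (n : nat) : vwp q 0 n = 1.
Proof. destruct n as [ | m]; simpl; [easy | ]. rewrite qpoch_0. ring. Qed.

(** Each term with n >= 1 contains a positive power of b c d r. *)
Lemma vwp_sum_b_0 (a c d r : C) : vwp_sum q a 0 c d r = 1.
Proof.
  apply csums_CSeries.
  replace (RtoC 1) with (psum (vwp_term q a 0 c d r) 1).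
  - apply csums_finite. intros [ | n] Hn; [lia | ].
    unfold vwp_term, weighted_term. rewrite (Cpow_S (- (0 * c * d * r))). ring.
  - simpl. unfold vwp_term, weighted_term. change (tri 0) with O. simpl. field.
Qed.

Lemma vwp_sum_a_0 (b c d r : C) : (Cmod (b * c * d * r) <= 1)%R ->
  vwp_sum q 0 b c d r = qpoch_inf (b * c * d * r) q.
Proof.
  intros H. apply csums_CSeries. eapply csums_ext; [ | now apply qinf_series].
  intros n. unfold vwp_term, weighted_term, Ec.
  replace (kap 0 b c d r) with (RtoC 0) by (unfold kap; ring). rewrite vwp_0.
  replace (- (b * c * d * r)) with (-(1) * (b * c * d * r)) by ring.
  rewrite !Cpow_mult_l, !Cmult_0_l, !qpoch_0. field. now apply qpoch_q_neq_0.
Qed.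

(* Both sides are the Askey-Wilson integral with parameters [b, c, d, r]. *)
Lemma value_a_0 (b c d r : C) : (Cmod (b * c * d * r) <= 1)%R ->
  value q 0 b c d r = value q b 0 c d r.
Proof.
  intros H. unfold value. rewrite vwp_sum_b_0, vwp_sum_a_0 by assumption.
  unfold prefac, kap. rewrite !Cmult_0_r, !Cmult_0_l, !qinf_0, !Cmult_1_l, !Cmult_1_r by easy.
  ring.
Qed.

Lemma integral_value (a b c d r : C) :
  (Cmod a < 1)%R -> (Cmod b < 1)%R -> (Cmod c < 1)%R -> (Cmod d < 1)%R -> (Cmod r < 1)%R ->
  integral q a b c d r = value q a b c d r.
Proof.
  intros Ha Hb Hc Hd Hr.
  assert (H0 : (Cmod 0 < 1)%R) by (rewrite Cmod_0; lra).
  (* Each stage frees the slot [b]; its assumption at b = 0 is the previous stage, after a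
     permutation of b, c, d, r has moved the parameters to the slots used there. *)
  assert (S1 : forall b r, (Cmod b < 1)%R -> (Cmod r < 1)%R ->
            integral q 0 b 0 0 r = value q 0 b 0 0 r).
  { apply integral_value_step; try easy. intros r' Hr'.
    rewrite integral_one_parameter by easy. unfold value. rewrite vwp_sum_b_0.
    unfold prefac, kap. rewrite !Cmult_0_l, !qinf_0 by easy.
    rewrite !Cmult_1_r. rewrite Cmult_1_l. reflexivity. }
  assert (S2 : forall c b r, (Cmod c < 1)%R -> (Cmod b < 1)%R -> (Cmod r < 1)%R ->
            integral q 0 b c 0 r = value q 0 b c 0 r).
  { intros c' b' r' Hc' Hb' Hr'. apply integral_value_step; try easy. clear r' Hr'.
    intros r' Hr'. rewrite value_swap_bc, <- S1 by easy.
    apply integral_ext. intros t. unfold w5. ring. }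
  assert (S3 : forall c d b r, (Cmod c < 1)%R -> (Cmod d < 1)%R -> (Cmod b < 1)%R ->
            (Cmod r < 1)%R -> integral q 0 b c d r = value q 0 b c d r).
  { intros c' d' b' r' Hc' Hd' Hb' Hr'. apply integral_value_step; try easy. clear r' Hr'.
    intros r' Hr'. rewrite value_swap_bc, value_swap_cd, value_swap_bc.
    transitivity (integral q 0 d' c' 0 r').
    - apply integral_ext. intros t. unfold w5. ring.
    - rewrite S2 by easy. reflexivity. }
  apply integral_value_step; try easy. clear r Hr. intros r Hr.
  (* The closed form is visibly symmetric in b, c, d, r but not in [a]; [value_a_0] is what lets [a]
     stand in the slot [b] of the four-parameter case. *)
  rewrite <- value_a_0.
  - rewrite <- S3 by easy. apply integral_ext. intros t. unfold w5. ring.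
  - left. now apply Cmod_mult4_lt_1.
Qed.

(** With n = k + j, the factor (alpha q^n;q)_k of the terminating series prolongs the (alpha;q)_n of
    the very-well-poised one; together they regroup into (alpha q;q)_(2k) and the factor for a q^k,
    whose [kap] is k0 q^(2k). The case j = 0 stands apart because [vwp] is defined by cases. *)
Lemma vwp_add (k0 alpha : C) (k j : nat) : alpha * q = k0 ->
  vwp q k0 (k + j) * qpoch (alpha * q ^ (k + j)) q k
  = qpoch k0 q (k + k) * vwp q (k0 * q ^ (k + k)) j.
Proof.
  intros Hk. destruct j as [ | m].
  - rewrite Nat.add_0_r. destruct k as [ | k]; simpl vwp; [simpl; ring | ].
    replace (alpha * q ^ S k) with (k0 * q ^ k) by (rewrite <- Hk; simpl; ring).
    replace (k + (k + 0) + 1)%nat with (k + S k)%nat by lia.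
    replace (S k + S k)%nat with (S (k + S k)) by lia.
    simpl (qpoch k0 q (S _)). rewrite (qpoch_add q k0 k (S k)). ring.
  - replace (k + S m)%nat with (S (k + m)) by lia. unfold vwp.
    replace (alpha * q ^ S (k + m)) with (k0 * q ^ (k + m)) by (rewrite <- Hk; simpl; ring).
    rewrite <- Cmult_assoc, <- qpoch_add.
    replace (k + m + k)%nat with (k + k + m)%nat by lia. rewrite qpoch_add.
    replace (2 * (k + m) + 1)%nat with (k + k + (2 * m + 1))%nat by lia.
    rewrite (Cpow_add_r q (k + k)). ring.
Qed.

(** Reversal of (q^(-n);q)_k with n = k + j. The factor [q ^ k] is the q in the argument q z of the
    terminating series. *)
Lemma qpoch_inv_qpow (k j : nat) :
  qpoch (/ q ^ (k + j)) q k * q ^ k * q ^ tri (k + j)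
  = (-(1)) ^ k * q ^ tri j * qpoch (q * q ^ j) q k.
Proof.
  assert (NQ := qpow_neq_0 q Hq). induction k as [ | k IH]; [simpl; ring | ].
  rewrite qpoch_S_l. simpl Nat.add.
  replace (/ q ^ S (k + j) * q) with (/ q ^ (k + j)).
  2:{ simpl. field. split; [apply NQ | now apply q_neq_0]. }
  rewrite tri_S, (Cpow_add_r q (tri _)).
  transitivity ((1 - / q ^ S (k + j)) * q * q ^ (k + j)
    * (qpoch (/ q ^ (k + j)) q k * q ^ k * q ^ tri (k + j))); [simpl; ring | ].
  rewrite IH. simpl qpoch.
  replace ((1 - / q ^ S (k + j)) * q * q ^ (k + j)) with (- (1 - q * q ^ j * q ^ k)).
  - simpl. ring.
  - simpl. rewrite !Cpow_add_r. field. repeat split; first [apply NQ | now apply q_neq_0].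
Qed.

Lemma qinf_mul_qpow (x : C) (k : nat) : (Cmod x < 1)%R ->
  qpoch_inf (x * q ^ k) q = qpoch_inf x q / qpoch x q k.
Proof.
  intros Hx. rewrite (qinf_split q Hq x k) by lra. field. now apply qpoch_neq_0.
Qed.

(** The identity behind the interchange of summations. The leftover power of b c d r supplies the
    argument b c d r z of the 4phi3 under the integral. *)
Lemma prefac_term_shift (a b c d r alpha : C) (k j : nat) :
  (Cmod a < 1)%R -> (Cmod b < 1)%R -> (Cmod c < 1)%R -> (Cmod d < 1)%R -> (Cmod r < 1)%R ->
  alpha * q = kap a b c d r ->
  prefac q a b c d r * vwp_term q a b c d r (k + j)
    * (qpoch (/ q ^ (k + j)) q k * qpoch (alpha * q ^ (k + j)) q k * q ^ k)
  = (b * c * d * r) ^ k * (prefac q (a * q ^ k) b c d r * vwp_term q (a * q ^ k) b c d r j).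
Proof.
  intros Ha Hb Hc Hd Hr Hal.
  assert (EV := vwp_add (kap a b c d r) alpha k j Hal).
  assert (EQ := qpoch_inv_qpow k j).
  unfold vwp_term, weighted_term.
  transitivity ((vwp q (kap a b c d r) (k + j) * qpoch (alpha * q ^ (k + j)) q k)
    * (qpoch (/ q ^ (k + j)) q k * q ^ k * q ^ tri (k + j))
    * (prefac q a b c d r * (qpoch (a * b) q (k + j) * qpoch (a * c) q (k + j)
         * qpoch (a * d) q (k + j) * qpoch (a * r) q (k + j))
       * / (qpoch q q (k + j) * qpoch (a * b * c * d) q (k + j) * qpoch (a * b * c * r) q (k + j)
            * qpoch (a * b * d * r) q (k + j) * qpoch (a * c * d * r) q (k + j))
       * (- (b * c * d * r)) ^ (k + j))); [ring | ].
  rewrite EV, EQ. clear EV EQ. unfold prefac.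
  replace (kap (a * q ^ k) b c d r) with (kap a b c d r * q ^ (k + k))
    by (unfold kap; rewrite Cpow_add_r; ring).
  replace (a * q ^ k * b) with (a * b * q ^ k) by ring.
  replace (a * q ^ k * c) with (a * c * q ^ k) by ring.
  replace (a * q ^ k * d) with (a * d * q ^ k) by ring.
  replace (a * q ^ k * r) with (a * r * q ^ k) by ring.
  replace (a * b * q ^ k * c * d) with (a * b * c * d * q ^ k) by ring.
  replace (a * b * q ^ k * c * r) with (a * b * c * r * q ^ k) by ring.
  replace (a * b * q ^ k * d * r) with (a * b * d * r * q ^ k) by ring.
  replace (a * c * q ^ k * d * r) with (a * c * d * r * q ^ k) by ring.
  assert (LK := Cmod_kap_lt_1 a b c d r Ha Hb Hc Hd Hr).
  assert (L1 := Cmod_mult4_lt_1 a b c d Ha Hb Hc Hd). assert (L2 := Cmod_mult4_lt_1 a b c r Ha Hb Hc Hr).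
  assert (L3 := Cmod_mult4_lt_1 a b d r Ha Hb Hd Hr). assert (L4 := Cmod_mult4_lt_1 a c d r Ha Hc Hd Hr).
  assert (Lab := Cmod_mult_lt_1 a b Ha Hb). assert (Lac := Cmod_mult_lt_1 a c Ha Hc).
  assert (Lad := Cmod_mult_lt_1 a d Ha Hd). assert (Lar := Cmod_mult_lt_1 a r Ha Hr).
  rewrite !qinf_mul_qpow by assumption.
  assert (EP : qpoch q q (k + j) = qpoch q q j * qpoch (q * q ^ j) q k).
  { rewrite (Nat.add_comm k j). apply qpoch_add. }
  rewrite EP, (qpoch_add q (a * b)), (qpoch_add q (a * c)), (qpoch_add q (a * d)),
    (qpoch_add q (a * r)), (qpoch_add q (a * b * c * d)), (qpoch_add q (a * b * c * r)),
    (qpoch_add q (a * b * d * r)), (qpoch_add q (a * c * d * r)), (Cpow_add_r (- _)).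
  replace ((- (b * c * d * r)) ^ k) with ((-(1)) ^ k * (b * c * d * r) ^ k)
    by (rewrite <- Cpow_mult_l; f_equal; ring).
  assert (ES : (-(1)) ^ k * (-(1)) ^ k = 1) by (rewrite <- Cpow_add_r; apply m1_pow_double).
  assert (LX : forall x, (Cmod x < 1)%R -> (Cmod (x * q ^ k) < 1)%R)
    by (intros x Hx; generalize (Cmod_mul_qpow_le q Hq x k); lra).
  assert (LQ : (Cmod (q * q ^ j) < 1)%R)
    by (generalize (Cmod_mul_qpow_le q Hq q j) (Cmod_q_lt_1 q Hq); lra).
  assert (NI := qinf_neq_0 q Hq). assert (NP := fun x n => qpoch_neq_0 q Hq x n).
  assert (Nq := NI _ (Cmod_q_lt_1 q Hq)). assert (NK := NI _ LK).
  assert (Nbc := NI _ (Cmod_mult_lt_1 b c Hb Hc)). assert (Nbd := NI _ (Cmod_mult_lt_1 b d Hb Hd)).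
  assert (Nbr := NI _ (Cmod_mult_lt_1 b r Hb Hr)). assert (Ncd := NI _ (Cmod_mult_lt_1 c d Hc Hd)).
  assert (Ncr := NI _ (Cmod_mult_lt_1 c r Hc Hr)). assert (Ndr := NI _ (Cmod_mult_lt_1 d r Hd Hr)).
  assert (Nab := NI _ Lab). assert (Nac := NI _ Lac). assert (Nad := NI _ Lad).
  assert (Nar := NI _ Lar).
  assert (Pab := NP _ k Lab). assert (Pac := NP _ k Lac). assert (Pad := NP _ k Lad).
  assert (Par := NP _ k Lar). assert (PK := NP _ (k + k)%nat LK).
  assert (P1 := NP _ k L1). assert (P2 := NP _ k L2). assert (P3 := NP _ k L3).
  assert (P4 := NP _ k L4). assert (Q1 := NP _ j (LX _ L1)). assert (Q2 := NP _ j (LX _ L2)).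
  assert (Q3 := NP _ j (LX _ L3)). assert (Q4 := NP _ j (LX _ L4)).
  assert (R1 := NP _ k LQ). assert (R2 := NP _ j (Cmod_q_lt_1 q Hq)).
  (* The two signs (-1)^k, from the reversed factorial and from the power of -bcdr, are exhibited as
     a square: [ES] removes it on one side, and [field] treats it as an atom on the other. *)
  transitivity ((-(1)) ^ k * (-(1)) ^ k * ((b * c * d * r) ^ k *
    (qpoch_inf (a * b * c * d) q / qpoch (a * b * c * d) q k *
     (qpoch_inf (a * b * c * r) q / qpoch (a * b * c * r) q k) *
     (qpoch_inf (a * b * d * r) q / qpoch (a * b * d * r) q k) *
     (qpoch_inf (a * c * d * r) q / qpoch (a * c * d * r) q k) *
     / (qpoch_inf q q * (qpoch_inf (a * b) q / qpoch (a * b) q k) *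
        (qpoch_inf (a * c) q / qpoch (a * c) q k) *
        (qpoch_inf (a * d) q / qpoch (a * d) q k) *
        (qpoch_inf (a * r) q / qpoch (a * r) q k) *
        qpoch_inf (b * c) q * qpoch_inf (b * d) q * qpoch_inf (b * r) q *
        qpoch_inf (c * d) q * qpoch_inf (c * r) q * qpoch_inf (d * r) q *
        (qpoch_inf (kap a b c d r) q / qpoch (kap a b c d r) q (k + k))) *
     (vwp q (kap a b c d r * q ^ (k + k)) j *
      (qpoch (a * b * q ^ k) q j * qpoch (a * c * q ^ k) q j *
       qpoch (a * d * q ^ k) q j * qpoch (a * r * q ^ k) q j) *
      / (qpoch q q j * qpoch (a * b * c * d * q ^ k) q j *
         qpoch (a * b * c * r * q ^ k) q j * qpoch (a * b * d * r * q ^ k) q j *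
         qpoch (a * c * d * r * q ^ k) q j) * (- (b * c * d * r)) ^ j * q ^ tri j)))).
  2:{ rewrite ES. ring. }
  generalize dependent ((-(1)) ^ k). intros sg _.
  generalize ((b * c * d * r) ^ k) ((- (b * c * d * r)) ^ j) (RtoC q ^ tri j).
  intros y1 y2 y3.
  generalize (vwp q (kap a b c d r * q ^ (k + k)) j) (qpoch (a * b * q ^ k) q j)
    (qpoch (a * c * q ^ k) q j) (qpoch (a * d * q ^ k) q j) (qpoch (a * r * q ^ k) q j).
  intros z1 z2 z3 z4 z5.
  field. repeat split; assumption.
Qed.

End Final.

(** * Termwise integration *)

Section Expansion.
Context (q : R) (Hq : (0 < q < 1)%R).

(** Translation between the summand of the theorem, with its quotient by 1 - alpha, and the
    division-free [vwp]. *)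
Lemma vwp_alpha (alpha k0 : C) (n : nat) : alpha <> 1 -> alpha * q = k0 ->
  (1 - alpha * q ^ (2 * n)) * qpoch alpha q n / (1 - alpha) = vwp q k0 n.
Proof.
  intros H1 <-. assert (N : 1 - alpha <> 0).
  { intros E. apply H1. symmetry. now apply Ceq_minus. }
  destruct n as [ | m].
  - simpl. field. exact N.
  - rewrite qpoch_S_l. unfold vwp.
    replace (2 * S m)%nat with (S (2 * m + 1)) by lia. rewrite (Cpow_S q (2 * m + 1)).
    field. exact N.
Qed.

(** The part of the k-th coefficient that the two 4phi3 series share; their first two numerator
    parameters differ. *)
Definition hyper_coef (beta delta s t h : C) (k : nat) : C :=
  qpoch beta q k * qpoch delta q k
  * / (qpoch q q k * qpoch s q k * qpoch t q k * qpoch h q k).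

Lemma hyper_coef_bound (beta delta s t h : C) :
  (Cmod s < 1)%R -> (Cmod t < 1)%R -> (Cmod h < 1)%R ->
  exists B, (0 <= B)%R /\ forall k, (Cmod (hyper_coef beta delta s t h k) <= B)%R.
Proof.
  intros Hs Ht Hh.
  exists (upper_bound_qpoch q (Cmod beta) * upper_bound_qpoch q (Cmod delta)
    * (lower_bound_qpoch q q * lower_bound_qpoch q (Cmod s) * lower_bound_qpoch q (Cmod t)
       * lower_bound_qpoch q (Cmod h)))%R.
  assert (H : forall k, (Cmod (hyper_coef beta delta s t h k) <=
    upper_bound_qpoch q (Cmod beta) * upper_bound_qpoch q (Cmod delta)
    * (lower_bound_qpoch q q * lower_bound_qpoch q (Cmod s) * lower_bound_qpoch q (Cmod t)
       * lower_bound_qpoch q (Cmod h)))%R).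
  { intros k.
    assert (N0 := qpoch_q_neq_0 q Hq k). assert (N1 := qpoch_neq_0 q Hq s k Hs).
    assert (N2 := qpoch_neq_0 q Hq t k Ht). assert (N3 := qpoch_neq_0 q Hq h k Hh).
    unfold hyper_coef. apply Cmod_mult_le.
    - apply Cmod_mult_le; apply qpoch_bound; try easy; lra.
    - repeat apply Cmod_inv_mult_le; repeat apply Cmult_neq_0; auto;
        apply inv_qpoch_bound; rewrite ?Cmod_q by easy; auto; lra. }
  split; [ | exact H]. eapply Rle_trans; [apply Cmod_ge_0 | apply (H O)].
Qed.

(** Uniformity in the parameters is the point, as the bound is applied to a q^k for all [k] at
    once. *)
Lemma prefac_bound (A : R) : (0 <= A < 1)%R -> exists B, (0 <= B)%R /\
  forall a b c d r, in_disc A a -> in_disc A b -> in_disc A c -> in_disc A d -> in_disc A r ->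
  (Cmod (prefac q a b c d r) <= B)%R.
Proof.
  intros HA. set (U := upper_bound_qpoch q 1). set (L := (lower_bound_qpoch q q / (1 - A))%R).
  set (L0 := (lower_bound_qpoch q q / (1 - q))%R).
  set (B := (U * U * U * U * (L0 * L * L * L * L * L * L * L * L * L * L * L))%R).
  assert (H : forall a b c d r, in_disc A a -> in_disc A b -> in_disc A c -> in_disc A d ->
     in_disc A r -> (Cmod (prefac q a b c d r) <= B)%R).
  { intros a b c d r Ha Hb Hc Hd Hr. unfold prefac, B.
    assert (W : forall x, in_disc A x -> in_disc 1 x)
      by (intros; now apply in_disc_weaken with A; [lra | ]).
    assert (Ml : forall x y, in_disc A x -> in_disc A y -> in_disc A (x * y))
      by (intros; apply in_disc_mul; auto; lra).
    assert (NZ : forall x, in_disc A x -> qpoch_inf x q <> 0).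
    { intros x Hx. apply qinf_neq_0; [easy | ]. unfold in_disc in Hx. lra. }
    assert (NQ := qinf_neq_0 q Hq q (Cmod_q_lt_1 q Hq)).
    assert (IB : forall x, in_disc A x -> (Cmod (/ qpoch_inf x q) <= L)%R).
    { intros x Hx. apply inv_qinf_bound; [easy | exact Hx | lra]. }
    assert (IQ : (Cmod (/ qpoch_inf q q) <= L0)%R).
    { apply inv_qinf_bound; [easy | rewrite Cmod_q; lra | lra]. }
    assert (UB : forall x, in_disc A x -> (Cmod (qpoch_inf x q) <= U)%R).
    { intros x Hx. apply qinf_bound; [easy | ]. now apply W. }
    assert (DK : in_disc A (kap a b c d r)) by now apply kap_in_disc.
    apply Cmod_mult_le.
    - repeat apply Cmod_mult_le; apply UB; auto.
    - assert (Nab := NZ _ (Ml _ _ Ha Hb)). assert (Nac := NZ _ (Ml _ _ Ha Hc)).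
      assert (Nad := NZ _ (Ml _ _ Ha Hd)). assert (Nar := NZ _ (Ml _ _ Ha Hr)).
      assert (Nbc := NZ _ (Ml _ _ Hb Hc)). assert (Nbd := NZ _ (Ml _ _ Hb Hd)).
      assert (Nbr := NZ _ (Ml _ _ Hb Hr)). assert (Ncd := NZ _ (Ml _ _ Hc Hd)).
      assert (Ncr := NZ _ (Ml _ _ Hc Hr)). assert (Ndr := NZ _ (Ml _ _ Hd Hr)).
      assert (NK := NZ _ DK).
      do 11 (apply Cmod_inv_mult_le; [repeat apply Cmult_neq_0; assumption | assumption | | apply IB; auto]).
      exact IQ. }
  exists B. split; [ | exact H].
  assert (H0 : in_disc A 0) by (unfold in_disc; rewrite Cmod_0; lra).
  eapply Rle_trans; [apply Cmod_ge_0 | apply (H 0 0 0 0 0)]; assumption.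
Qed.

Lemma prefac_neq_0 (a b c d r : C) :
  (Cmod a < 1)%R -> (Cmod b < 1)%R -> (Cmod c < 1)%R -> (Cmod d < 1)%R -> (Cmod r < 1)%R ->
  prefac q a b c d r <> 0.
Proof.
  intros Ha Hb Hc Hd Hr. unfold prefac.
  assert (NI := qinf_neq_0 q Hq). assert (Lq := Cmod_q_lt_1 q Hq).
  assert (LK := Cmod_kap_lt_1 a b c d r Ha Hb Hc Hd Hr).
  assert (NV : forall x : C, x <> 0 -> / x <> 0).
  { intros x Hx E. apply C1_nz. rewrite <- (Cinv_r x Hx), E. ring. }
  apply Cmult_neq_0; [ | apply NV]; repeat apply Cmult_neq_0; apply NI;
    try assumption; repeat apply Cmod_mult_lt_1; assumption.
Qed.

Lemma ipair_mul_qpow (x : C) (k : nat) (t : R) : (Cmod x < 1)%R ->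
  ipair q (x * q ^ k) t = qpoch (x * expi t) q k * qpoch (x * expi (- t)) q k * ipair q x t.
Proof.
  intros Hx. unfold ipair.
  replace (x * q ^ k * expi t) with (x * expi t * q ^ k) by ring.
  replace (x * q ^ k * expi (- t)) with (x * expi (- t) * q ^ k) by ring.
  assert (H1 : (Cmod (x * expi t) < 1)%R) by now rewrite Cmod_mul_expi.
  assert (H2 : (Cmod (x * expi (- t)) < 1)%R) by now rewrite Cmod_mul_expi.
  rewrite !qinf_mul_qpow by assumption.
  assert (N1 := qinf_neq_0 q Hq _ H1). assert (N2 := qinf_neq_0 q Hq _ H2).
  assert (M1 := qpoch_neq_0 q Hq _ k H1). assert (M2 := qpoch_neq_0 q Hq _ k H2).
  field. repeat split; assumption.
Qed.

Context (a b c d r s t h z beta delta : C).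
Context (Ha : (Cmod a < 1)%R) (Hb : (Cmod b < 1)%R) (Hc : (Cmod c < 1)%R)
  (Hd : (Cmod d < 1)%R) (Hr : (Cmod r < 1)%R) (Hs : (Cmod s < 1)%R)
  (Ht : (Cmod t < 1)%R) (Hh : (Cmod h < 1)%R) (Hz : (Cmod z <= 1)%R).

Let y : C := b * c * d * r.
Let phi : nat -> C := hyper_coef beta delta s t h.

Lemma prod4_lt_1 : (Cmod y < 1)%R.
Proof. now apply Cmod_mult4_lt_1. Qed.

Lemma yz_pow_le (k : nat) : (Cmod ((y * z) ^ k) <= Cmod y ^ k)%R.
Proof.
  rewrite Cmod_pow. apply pow_incr. split; [apply Cmod_ge_0 | ].
  rewrite Cmod_mult. generalize (Cmod_ge_0 y). nra.
Qed.

Lemma Cmod_aqk (k : nat) : (Cmod (a * q ^ k) < 1)%R.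
Proof. generalize (Cmod_mul_qpow_le q Hq a k). lra. Qed.

(** Row [k] sums to the closed form for a q^k times the k-th coefficient of the 4phi3 under the
    integral; the diagonals are identified in [term_diagonal]. *)
Definition shifted_term (k j : nat) : C :=
  phi k * (y * z) ^ k
  * (4 * PI * prefac q (a * q ^ k) b c d r * vwp_term q (a * q ^ k) b c d r j).

Lemma shifted_csums (l : C) :
  csums (fun k => phi k * (y * z) ^ k * value q (a * q ^ k) b c d r) l ->
  csums (diagonal shifted_term) l.
Proof.
  intros Hl.
  destruct (common_disc a b c d r) as [A [HA [A1 [A2 [A3 [A4 A5]]]]]]; auto.
  destruct (hyper_coef_bound beta delta s t h Hs Ht Hh) as [B [HB0 HB]].
  destruct (prefac_bound A HA) as [B' [HB0' HB']].
  assert (HW := weighted_bound_pos q A). assert (HPI := PI_RGT_0).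
  assert (Hy := prod4_lt_1). assert (Hy0 := Cmod_ge_0 y).
  apply (csums_diagonal shifted_term
    (fun k => phi k * (y * z) ^ k * value q (a * q ^ k) b c d r) l
    (B * (4 * PI * B' * weighted_bound q A))%R (Cmod y)); [easy | | | | exact Hl].
  - apply Rmult_le_pos; [easy | ]. apply Rmult_le_pos; [ | lra].
    apply Rmult_le_pos; lra.
  - intros k j. unfold shifted_term.
    replace (B * (4 * PI * B' * weighted_bound q A) * Cmod y ^ k * Cmod y ^ j)%R
      with (B * Cmod y ^ k * (4 * PI * B' * (weighted_bound q A * Cmod y ^ j)))%R by ring.
    assert (A1k : in_disc A (a * q ^ k)).
    { unfold in_disc in *. generalize (Cmod_mul_qpow_le q Hq a k). lra. }
    apply Cmod_mult_le.
    + apply Cmod_mult_le; [apply HB | apply yz_pow_le].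
    + apply Cmod_mult_le; [apply Cmod_mult_le; [ | now apply HB'] | now apply vwp_term_bound].
      rewrite <- RtoC_mult, Cmod_R, Rabs_pos_eq; lra.
  - intros k. unfold shifted_term, value. apply csums_scal, csums_scal.
    apply vwp_csums; auto. apply Cmod_aqk.
Qed.

Let alpha : C := a ^ 2 * b * c * d * r / q.

Lemma alpha_kap : alpha * q = kap a b c d r.
Proof. unfold alpha, kap. simpl. field. now apply q_neq_0. Qed.

Lemma terminating_bhyp (n : nat) :
  bhyp [/ (q ^ n); alpha * q ^ n; beta; delta] [s; t; h] q (q * z)
  = psum (fun k => phi k * (qpoch (/ q ^ n) q k * qpoch (alpha * q ^ n) q k * q ^ k) * z ^ k) (S n).
Proof.
  unfold bhyp. apply csums_CSeries.
  eapply csums_ext; [ | apply csums_finite].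
  - intros k. unfold phi, hyper_coef, qpochs. simpl. rewrite !Cmult_1_r, Cpow_mult_l.
    unfold Cdiv. rewrite !Cmult_assoc. ring.
  - intros k Hk. cbv beta. rewrite qpoch_inv_qpow_0 by (auto; lia). ring.
Qed.

Lemma term_diagonal (n : nat) : alpha <> 1 ->
  4 * PI * prefac q a b c d r *
  (((1 - alpha * q ^ (2 * n)) * qpochs [alpha; a * b; a * c; a * d; a * r] q n)
    / ((1 - alpha) * qpochs [RtoC q; a * b * c * d; a * b * c * r;
                             a * b * d * r; a * c * d * r] q n)
    * (- (b * c * d * r)) ^ n * q ^ (n * (n - 1) / 2)
    * bhyp [/ (q ^ n); alpha * q ^ n; beta; delta] [s; t; h] q (q * z))
  = diagonal shifted_term n.
Proof.
  intros Hal. rewrite terminating_bhyp.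
  replace (((1 - alpha * q ^ (2 * n)) * qpochs [alpha; a * b; a * c; a * d; a * r] q n)
    / ((1 - alpha) * qpochs [RtoC q; a * b * c * d; a * b * c * r;
                             a * b * d * r; a * c * d * r] q n)
    * (- (b * c * d * r)) ^ n * q ^ (n * (n - 1) / 2)) with (vwp_term q a b c d r n).
  - unfold diagonal. rewrite <- !psum_scal.
    apply psum_ext. intros k Hk. unfold shifted_term.
    assert (E := prefac_term_shift q Hq a b c d r alpha k (n - k) Ha Hb Hc Hd Hr alpha_kap).
    replace (k + (n - k))%nat with n in E by lia.
    transitivity (4 * PI * phi k * z ^ k * (prefac q a b c d r * vwp_term q a b c d r n
       * (qpoch (/ q ^ n) q k * qpoch (alpha * q ^ n) q k * q ^ k))); [ring | ].
    rewrite E. fold y. rewrite Cpow_mult_l. ring.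
  - unfold vwp_term, weighted_term. rewrite <- (vwp_alpha alpha _ n Hal alpha_kap).
    change (n * (n - 1) / 2)%nat with (tri n). unfold qpochs. simpl map. simpl fold_right.
    assert (N : 1 - alpha <> 0) by (intros E; apply Hal; symmetry; now apply Ceq_minus).
    assert (N0 := qpoch_q_neq_0 q Hq n).
    assert (N1 := qpoch_neq_0 q Hq _ n (Cmod_mult4_lt_1 a b c d Ha Hb Hc Hd)).
    assert (N2 := qpoch_neq_0 q Hq _ n (Cmod_mult4_lt_1 a b c r Ha Hb Hc Hr)).
    assert (N3 := qpoch_neq_0 q Hq _ n (Cmod_mult4_lt_1 a b d r Ha Hb Hd Hr)).
    assert (N4 := qpoch_neq_0 q Hq _ n (Cmod_mult4_lt_1 a c d r Ha Hc Hd Hr)).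
    set (na := 1 - alpha) in *.
    generalize (1 - alpha * q ^ (2 * n)) ((- (b * c * d * r)) ^ n) (RtoC q ^ tri n)
      (qpoch alpha q n).
    intros x1 x2 x3 x4. clearbody na.
    generalize dependent (qpoch (a * b * c * d) q n). intros m1 N1.
    generalize dependent (qpoch (a * b * c * r) q n). intros m2 N2.
    generalize dependent (qpoch (a * b * d * r) q n). intros m3 N3.
    generalize dependent (qpoch (a * c * d * r) q n). intros m4 N4.
    field. repeat split; assumption.
Qed.

(** A copy of the integrand of the theorem, convertible with it, to which lemmas can refer. *)
Definition integrand (theta : R) : C :=
  let e := expi theta in
  let e' := expi (- theta) in
  qpochs_inf [expi (2 * theta); expi (- (2 * theta))] q
  / qpochs_inf [a * e; a * e'; b * e; b * e'; c * e; c * e';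
                d * e; d * e'; r * e; r * e'] q
  * bhyp [a * e; a * e'; beta; delta] [s; t; h] q (b * c * d * r * z).

Lemma integrand_w5 (x : R) :
  integrand x = w5 q a b c d r x
    * bhyp [a * expi x; a * expi (- x); beta; delta] [s; t; h] q (y * z).
Proof.
  unfold integrand. cbv zeta. f_equal.
  unfold qpochs_inf. simpl map. simpl fold_right. unfold w5, awnum, ipair.
  replace (expi (- (2 * x))) with (expi (- x) * expi (- x))
    by (rewrite <- expi_add; f_equal; ring).
  rewrite expi_double.
  assert (NI : forall u v, (Cmod u < 1)%R -> qpoch_inf (u * expi v) q <> 0).
  { intros u v Hu. apply qinf_neq_0; [easy | ]. now rewrite Cmod_mul_expi. }
  assert (Na1 := NI a x Ha). assert (Na2 := NI a (- x)%R Ha).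
  assert (Nb1 := NI b x Hb). assert (Nb2 := NI b (- x)%R Hb).
  assert (Nc1 := NI c x Hc). assert (Nc2 := NI c (- x)%R Hc).
  assert (Nd1 := NI d x Hd). assert (Nd2 := NI d (- x)%R Hd).
  assert (Nr1 := NI r x Hr). assert (Nr2 := NI r (- x)%R Hr).
  field. repeat split; assumption.
Qed.

Lemma qpochs_swap (u v : C) (l : list C) (n : nat) :
  qpochs (u :: v :: l) q n = qpochs (v :: u :: l) q n.
Proof. unfold qpochs. simpl. ring. Qed.

(** The change of sign exchanges the two exponentials, and with them the first two numerator
    parameters of the 4phi3. *)
Lemma integrand_even (x : R) : integrand (- x) = integrand x.
Proof.
  rewrite !integrand_w5. rewrite Ropp_involutive. f_equal.
  - unfold w5, awnum, ipair. rewrite Ropp_involutive. ring.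
  - unfold bhyp, CSeries. f_equal; apply Series_ext; intros n; now rewrite qpochs_swap.
Qed.

Lemma bhyp_csums (x : R) :
  exists l, csums (fun k => phi k * (y * z) ^ k
    * (qpoch (a * expi x) q k * qpoch (a * expi (- x)) q k)) l /\
  bhyp [a * expi x; a * expi (- x); beta; delta] [s; t; h] q (y * z) = l.
Proof.
  destruct (hyper_coef_bound beta delta s t h Hs Ht Hh) as [B [HB0 HB]].
  set (U := upper_bound_qpoch q 1).
  destruct (dominated_csums (fun k => B * (U * U) * Cmod y ^ k)%R (fun k => phi k * (y * z) ^ k
    * (qpoch (a * expi x) q k * qpoch (a * expi (- x)) q k))) as [l Hl].
  - apply summable_geom; [split; [apply Cmod_ge_0 | apply prod4_lt_1] | ].
    apply Rmult_le_pos; [easy | ]. assert (HU := upper_bound_pos q 1). fold U in HU. nra.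
  - intros k. replace (B * (U * U) * Cmod y ^ k)%R with (B * Cmod y ^ k * (U * U))%R by ring.
    apply Cmod_mult_le.
    + apply Cmod_mult_le; [apply HB | apply yz_pow_le].
    + apply Cmod_mult_le; apply qpoch_bound; try easy; rewrite Cmod_mul_expi; lra.
  - exists l. split; [exact Hl | ]. unfold bhyp. apply csums_CSeries.
    eapply csums_ext; [ | exact Hl]. intros k. unfold phi, hyper_coef, qpochs. simpl.
    rewrite !Cmult_1_r. unfold Cdiv. rewrite !Cmult_assoc. ring.
Qed.

(** Termwise integration in [k] under a geometric majorant: the weight, the coefficients and the
    q-factorials are bounded, and |(yz)^k| <= |y|^k since |z| <= 1. *)
Lemma integrand_Int : exists W, Int integrand W /\ csums (diagonal shifted_term) W.
Proof.
  destruct (hyper_coef_bound beta delta s t h Hs Ht Hh) as [B [HB0 HB]].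
  set (U := upper_bound_qpoch q 1). assert (HU : (0 < U)%R) by apply upper_bound_pos.
  set (rho := ((1 + Cmod b) / 2)%R). assert (Hb0 := Cmod_ge_0 b).
  assert (Hrho : (0 < rho < 1)%R) by (unfold rho; lra).
  (* The bound of the unshifted weight serves all [k]: the weight for a q^k is the unshifted one
     times two q-factorials of modulus at most [U]. *)
  destruct (ulim_bounded rho _ (ulim_w5_var q Hq rho Hrho a c d r Ha Hc Hd Hr)) as [V HV].
  assert (HV0 := bounded_nonneg rho Hrho _ _ HV).
  destruct (Int_csums (fun k x => phi k * (y * z) ^ k * w5 q (a * q ^ k) b c d r x) integrand
    (fun k => phi k * (y * z) ^ k * value q (a * q ^ k) b c d r)
    (fun k => V * (B * (U * U)) * Cmod y ^ k)%R) as [W [H1 H2]].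
  - apply summable_geom; [split; [apply Cmod_ge_0 | apply prod4_lt_1] | ].
    apply Rmult_le_pos; [easy | ]. nra.
  - intros k x. unfold w5. rewrite ipair_mul_qpow by assumption.
    replace (V * (B * (U * U)) * Cmod y ^ k)%R
      with (V * (B * Cmod y ^ k * (U * U)))%R by ring.
    replace (phi k * (y * z) ^ k * (awnum q x * (qpoch (a * expi x) q k
        * qpoch (a * expi (- x)) q k * ipair q a x * ipair q b x * ipair q c x
        * ipair q d x * ipair q r x)))
      with (w5 q a b c d r x * (phi k * (y * z) ^ k * (qpoch (a * expi x) q k
        * qpoch (a * expi (- x)) q k))) by (unfold w5; ring).
    apply Cmod_mult_le; [apply HV; unfold rho; lra | ]. apply Cmod_mult_le.
    + apply Cmod_mult_le; [apply HB | apply yz_pow_le].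
    + apply Cmod_mult_le; apply qpoch_bound; try easy; rewrite Cmod_mul_expi; lra.
  - intros x. destruct (bhyp_csums x) as [l [Hl El]]. rewrite integrand_w5, El.
    eapply csums_ext; [ | exact (csums_scal (w5 q a b c d r x) _ _ Hl)].
    intros k. unfold w5. rewrite ipair_mul_qpow by assumption. ring.
  - intros k. apply Int_scal. rewrite <- integral_value by (auto; apply Cmod_aqk).
    apply w5_Int; auto. apply Cmod_aqk.
  - exists W. split; [exact H1 | ]. now apply shifted_csums.
Qed.

End Expansion.

Theorem theorem1p9 :
  forall (q : R) (a b c d r s t h z beta delta : C),
  (0 < q < 1)%R ->
  (Cmod a < 1)%R -> (Cmod b < 1)%R -> (Cmod c < 1)%R -> (Cmod d < 1)%R ->
  (Cmod r < 1)%R -> (Cmod s < 1)%R -> (Cmod t < 1)%R -> (Cmod h < 1)%R ->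
  let alpha : C := a ^ 2 * b * c * d * r / q in
  let integrand : R -> C := fun theta =>
    let e := expi theta in
    let e' := expi (- theta) in
    qpochs_inf [expi (2 * theta); expi (- (2 * theta))] q
    / qpochs_inf [a * e; a * e'; b * e; b * e'; c * e; c * e';
                  d * e; d * e'; r * e; r * e'] q
    * bhyp [a * e; a * e'; beta; delta] [s; t; h] q (b * c * d * r * z) in
  let term : nat -> C := fun n =>
    ((1 - alpha * q ^ (2 * n)) * qpochs [alpha; a * b; a * c; a * d; a * r] q n)
    / ((1 - alpha) * qpochs [RtoC q; a * b * c * d; a * b * c * r;
                             a * b * d * r; a * c * d * r] q n)
    * (- (b * c * d * r)) ^ n * q ^ (n * (n - 1) / 2)
    * bhyp [/ (q ^ n); alpha * q ^ n; beta; delta] [s; t; h] q (q * z) in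
  let prefactor : C :=
    2 * PI * qpochs_inf [a * b * c * d; a * b * c * r;
                         a * b * d * r; a * c * d * r] q
    / qpochs_inf [RtoC q; a * b; a * c; a * d; a * r; b * c; b * d; b * r;
                  c * d; c * r; d * r; q * alpha] q in
  alpha <> 1 ->
  (Cmod z < 1)%R \/
    (Cmod z = 1%R /\ ex_series (fun n => Cmod (term n))) ->
  ex_series (V := C_NormedModule) term /\
  is_RInt (V := C_R_NormedModule) integrand 0 PI (prefactor * CSeries term).
Proof.
  intros q a b c d r s t h z beta delta Hq Ha Hb Hc Hd Hr Hs Ht Hh
    alpha integ term prefactor Hal Hz'.
  assert (Hz : (Cmod z <= 1)%R) by (destruct Hz' as [H | [H _]]; lra).
  destruct (integrand_Int q Hq a b c d r s t h z beta delta Ha Hb Hc Hd Hr Hs Ht Hh Hz)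
    as [W [HW HC]].
  (* Twice the prefactor of the theorem. Diagonal [n] equals [P] times [term n], hence the division
     by [P]. *)
  set (P := 4 * PI * prefac q a b c d r).
  assert (HP : P <> 0).
  { apply Cmult_neq_0; [ | now apply prefac_neq_0].
    intros E. apply C_2PI_neq_0. replace (2 * PI) with (4 * PI * / 2) by field.
    rewrite E. ring. }
  assert (HT : csums term (/ P * W)).
  { eapply csums_ext; [ | exact (csums_scal (/ P) _ _ HC)]. intros n. cbv beta.
    rewrite <- (term_diagonal q Hq a b c d r s t h z beta delta Ha Hb Hc Hd Hr n Hal).
    fold P. rewrite Cmult_assoc, Cinv_l, Cmult_1_l by exact HP. reflexivity. }
  split.
  - exists (/ P * W). now apply csums_is_series.
  - rewrite (csums_CSeries _ _ HT).
    (* Passing to the half period halves [W], which matches the ratio 1/2 of [prefactor] to [P]. *)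
    replace (prefactor * (/ P * W)) with (W / 2).
    + apply Int_half; [ | exact HW]. intros x.
      exact (integrand_even q Hq a b c d r s t h z beta delta Ha Hb Hc Hd Hr x).
    + assert (E : prefactor = P * / 2).
      { unfold prefactor, P, prefac, qpochs_inf. simpl map. simpl fold_right.
        replace (q * alpha) with (kap a b c d r).
        2:{ rewrite <- (alpha_kap q Hq a b c d r). fold alpha. ring. }
        rewrite !Cmult_1_r. unfold Cdiv. rewrite !Cmult_assoc.
        match goal with |- context [/ (?D * qpoch_inf (kap a b c d r) q)] =>
          generalize (/ (D * qpoch_inf (kap a b c d r) q)) end.
        intros D. field. }
      rewrite E. field. exact HP.
Qed.
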